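(* Let $f\in\mathcal S$ with $S(f)\subset\mathbb D$, and let $\epsilon>0$ satisfy $\mathrm{dist}(S(f),\partial\mathbb D)>4\epsilon$ and $|a-b|>4\epsilon$ for all distinct $a,b\in S(f)$. Then there is $r<\infty$, depending only on $\epsilon$, such that for every $a\in S(f)$ and every partition arc $I$ of $\partial W(a,\epsilon)$ there is an edge $J$ of $\partial\Omega$ with $I\subset J(r)$ and $J\subset I(r)$. Moreover $\mathrm{diam}(I)\simeq\mathrm{diam}(J)\simeq\mathrm{dist}(I,J)$, and the length of $I$ (resp. $J$) is comparable to $\mathrm{diam}(I)$ (resp. $\mathrm{diam}(J)$), with comparability constants depending only on $\epsilon$.
   Context: $S(f)$ is the closure of the finite critical and asymptotic values of $f$; $\mathcal S$ is the class of transcendental entire functions with finite $S(f)$; $\mathbb D$ is the open unit disk. For $a\in S(f)$, $D_a=D(a,\epsilon)$ and $W(a,\epsilon)=f^{-1}(D_a)$; the points $f^{-1}(a+\epsilon)$ partition $\partial W(a,\epsilon)$ into arcs, called partition arcs. $\Omega=\{z:|f(z)|>1\}$; on each component $\Omega_j$ of $\Omega$ a branch $\tau_j$ of $\log f$ maps $\Omega_j$ conformally onto the right half-plane $\{x>0\}$, and the edges of $\partial\Omega$ are the arcs $\tau_j^{-1}([i\pi k,i\pi(k+1)])$, $k\in\mathbb Z$. For an arc $I$ and $r>0$, $I(r)=\{z:\mathrm{dist}(z,I)<r\cdot\mathrm{diam}(I)\}$. $A\simeq B$ means $A/C\le B\le CA$ for a constant $C$. *)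

(* Defs.v *)
From Stdlib Require Import Reals List ZArith.
From Coquelicot Require Import Coquelicot.
Open Scope R_scope.

Definition cset := C -> Prop.

Definition Cexp (z : C) : C := (exp (fst z) * cos (snd z), exp (fst z) * sin (snd z)).

Fixpoint Cpow (z : C) (n : nat) : C :=
  match n with O => RtoC 1 | S m => Cmult z (Cpow z m) end.

Fixpoint Csum (a : nat -> C) (n : nat) : C :=
  match n with O => a O | S m => Cplus (Csum a m) (a (S m)) end.

Definition holo_at (f : C -> C) (z : C) : Prop :=
  ex_derive (K := C_AbsRing) (V := C_NormedModule) f z.
Definition entire (f : C -> C) : Prop := forall z, holo_at f z.
Definition is_polynomial (f : C -> C) : Prop :=
  exists (n : nat) (a : nat -> C), forall z, f z = Csum (fun k => Cmult (a k) (Cpow z k)) n.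
Definition transcendental_entire (f : C -> C) : Prop := entire f /\ ~ is_polynomial f.

Definition closure (A : cset) : cset :=
  fun w => forall e, 0 < e -> exists v, A v /\ Cmod (Cminus v w) < e.
Definition interior (A : cset) : cset :=
  fun w => exists e, 0 < e /\ forall v, Cmod (Cminus v w) < e -> A v.
Definition boundary (A : cset) : cset := fun w => closure A w /\ ~ interior A w.
Definition subset (A B : cset) : Prop := forall z, A z -> B z.
Definition connected (A : cset) : Prop :=
  forall U V : C -> Prop, open U -> open V -> subset A (fun z => U z \/ V z) ->
    (exists z, A z /\ U z) -> (exists z, A z /\ V z) -> exists z, A z /\ U z /\ V z.
Definition component (A K : cset) : Prop :=
  subset K A /\ (exists z, K z) /\ connected K /\
  forall K', connected K' -> subset K K' -> subset K' A -> subset K' K.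
Definition cbounded (A : cset) : Prop := exists M, forall z, A z -> Cmod z <= M.
Definition finite_set (A : cset) : Prop := exists l : list C, forall z, A z <-> In z l.

(* diameter and distance (used for bounded nonempty sets) *)
Definition diam (A : cset) : R :=
  real (Lub_Rbar (fun d => exists z w, A z /\ A w /\ d = Cmod (Cminus z w))).
Definition setdist (A B : cset) : R :=
  real (Glb_Rbar (fun d => exists z w, A z /\ B w /\ d = Cmod (Cminus z w))).
Definition nbhd (I : cset) (r : R) : cset :=
  fun z => real (Glb_Rbar (fun d => exists w, I w /\ d = Cmod (Cminus z w))) < r * diam I.
Definition comparable (K A B : R) : Prop := A / K <= B /\ B <= K * A.

Definition critical_value (f : C -> C) (w : C) : Prop :=
  exists z, is_derive (K := C_AbsRing) (V := C_NormedModule) f z (RtoC 0) /\ f z = w.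
Definition asymptotic_value (f : C -> C) (w : C) : Prop :=
  exists gam : R -> C, (forall t, 0 <= t -> continuous gam t) /\
    filterlim (fun t => Cmod (gam t)) (Rbar_locally p_infty) (Rbar_locally p_infty) /\
    filterlim (fun t => f (gam t)) (Rbar_locally p_infty) (locally w).
Definition sing (f : C -> C) : cset :=
  closure (fun w => critical_value f w \/ asymptotic_value f w).
Definition classS (f : C -> C) : Prop := transcendental_entire f /\ finite_set (sing f).

Definition Wset (f : C -> C) (a : C) (eps : R) : cset := fun z => Cmod (Cminus (f z) a) < eps.
Definition partition_arc (f : C -> C) (a : C) (eps : R) (I : cset) : Prop :=
  exists K, component (fun z => boundary (Wset f a eps) z /\ f z <> Cplus a (RtoC eps)) K
            /\ I = closure K.

Definition Omega (f : C -> C) : cset := fun z => 1 < Cmod (f z).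
Definition edge (f : C -> C) (J : cset) : Prop :=
  exists (Oj : cset) (tau : C -> C) (k : Z),
    component (Omega f) Oj /\
    (forall z, Oj z -> holo_at tau z) /\
    (forall z, Oj z -> 0 < fst (tau z)) /\
    (forall z w, Oj z -> Oj w -> tau z = tau w -> z = w) /\
    (forall u, 0 < fst u -> exists z, Oj z /\ tau z = u) /\
    (forall z, closure Oj z -> forall e, 0 < e -> exists d, 0 < d /\
        forall w, closure Oj w -> Cmod (Cminus w z) < d -> Cmod (Cminus (tau w) (tau z)) < e) /\
    (forall z, closure Oj z -> Cexp (tau z) = f z) /\
    J = (fun z => closure Oj z /\ fst (tau z) = 0 /\
           PI * IZR k <= snd (tau z) <= PI * (IZR k + 1)).

Fixpoint polysum (gam : R -> C) (ts : list R) : R :=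
  match ts with
  | t :: ((s :: _) as rest) => Cmod (Cminus (gam s) (gam t)) + polysum gam rest
  | _ => 0
  end.
Fixpoint increasing_from (t : R) (ts : list R) : Prop :=
  match ts with nil => t = 1 | s :: rest => t <= s /\ increasing_from s rest end.
Definition curve_length (gam : R -> C) : Rbar :=
  Lub_Rbar (fun L => exists ts, increasing_from 0 ts /\ L = polysum gam (0 :: ts)).
(* gam parametrizes K over [0,1] as an arc or a Jordan curve *)
Definition simple_param (gam : R -> C) (K : cset) : Prop :=
  (forall t, 0 <= t <= 1 -> continuous gam t) /\
  (forall s t, 0 <= s < 1 -> 0 <= t < 1 -> gam s = gam t -> s = t) /\
  (forall z, K z <-> exists t, 0 <= t <= 1 /\ gam t = z).
Definition length_comparable (K : R) (A : cset) : Prop :=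
  exists gam, simple_param gam A /\
    Rbar_le (Finite (diam A / K)) (curve_length gam) /\
    Rbar_le (curve_length gam) (Finite (K * diam A)).

(* Main.v *)
Require Import Defs.
From Stdlib Require Import Reals Lra Lia List ZArith Classical ClassicalEpsilon FunctionalExtensionality PropExtensionality.
From Coquelicot Require Import Coquelicot.
Open Scope R_scope.

(** For [a] in the singular set, [u |-> a + exp u] on [{Re u < ln (4 eps)}] and [u |-> exp u] on
    [{Re u > ln (1 - 4 eps)}] avoid the singular values of [f], hence lift through [f]: a lift can only
    fail to continue along a segment at a critical or an asymptotic value. A partition arc is the image of
    [ln eps + i [0, 2 pi]] under a lift [g] of the first map, an edge the image of
    [i [pi k, pi (k + 1)]] under a lift [G] of the second, and [G] is injective because a periodic
    lift would give [f] polynomial growth.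

    On a disc where the lifted map is univalent the lift is univalent and, [f] being entire, omits a
    value within a bounded multiple of (radius) x |derivative| of its centre value: otherwise Cauchy's
    estimate would make [f'] too small there. The logarithm of an injective function minus an
    omitted value contains no large disc in its image, so Bloch's theorem yields a Koebe type distortion
    theorem. Thus [1 / |f'|] is comparable along the arc, along the edge, and along a chain of boundedly
    many discs leading from [a + i eps] to the unit circle at distance [eps / 4] from the singular
    set, and [1 / |f'|] is the common scale of all diameters, distances and lengths. *)

(** * Complex derivatives *)

(** The constants have to depend on [eps] alone, so crude values of Bloch's and Koebe's constants
    suffice. The danger is a dependence on the number or the position of the singular values: the
    number of discs in the chain must be governed by [eps]. The chain follows the graph of a
    function of the real part, namely the horizontal line through [a] with a roof over each singular
    value close to it. This graph is Lipschitz whatever the number of roofs, and it stays clear of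
    the singular set because the singular values are far from each other.

    Distances in the plane are read through [f]. Two points with distant values are far apart, since
    the lift of a disc about one value covers a neighbourhood of the point above it; upper bounds
    come from integrating the derivative of a lift.

    Both half-planes extend strictly beyond the line that carries the arc or the edge. Hence arcs,
    edges and the closure of a component of [Omega f] consist of ordinary values of a lift, and no
    boundary behaviour of conformal maps has to be studied. The images of lifts are relatively
    closed because two lifts that meet differ by a period. *)

Lemma Cmod_sym (a b : C) : Cmod (a - b) = Cmod (b - a).
Proof. rewrite <- (Cmod_opp (a - b)). f_equal. ring. Qed.

Lemma Cmod_tri3 (a b c : C) : Cmod (a - c) <= Cmod (a - b) + Cmod (b - c).
Proof. replace (a - c)%C with ((a - b) + (b - c))%C by ring. apply Cmod_triangle. Qed.

Lemma Cmod_tri_minus (a b : C) : Cmod (a - b) <= Cmod a + Cmod b.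
Proof. unfold Cminus. rewrite <- (Cmod_opp b). apply Cmod_triangle. Qed.

Lemma Cmod_tri_rev (a b : C) : Cmod a - Cmod b <= Cmod (a - b).
Proof.
  assert (H := Cmod_triangle (a - b) b). replace (a - b + b)%C with a in H by ring. lra.
Qed.

Lemma Cmod_minus_diag (a : C) : Cmod (a - a) = 0.
Proof. replace (a - a)%C with (RtoC 0) by ring. apply Cmod_0. Qed.

Lemma Cmod_minus_eq0 (a b : C) : Cmod (a - b) = 0 -> a = b.
Proof.
  intros H. apply Cmod_eq_0 in H. replace a with ((a - b) + b)%C by ring. rewrite H. ring.
Qed.

Lemma Cmod_minus_gt0 (a b : C) : a <> b -> 0 < Cmod (a - b).
Proof.
  intros H. destruct (Cmod_ge_0 (a - b)) as [h|h]; auto.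
  exfalso. apply H, Cmod_minus_eq0. auto.
Qed.

Lemma Cmod_le_abs (x y : R) : Cmod (x, y) <= Rabs x + Rabs y.
Proof.
  replace ((x, y) : C) with (RtoC x + (0, y))%C by (unfold Cplus, RtoC; simpl; f_equal; ring).
  eapply Rle_trans. apply Cmod_triangle. rewrite Cmod_R.
  apply Rplus_le_compat_l. unfold Cmod; simpl.
  replace (0 * (0 * 1) + y * (y * 1)) with (Rsqr y) by (unfold Rsqr; ring).
  rewrite sqrt_Rsqr_abs. lra.
Qed.

Lemma im_le_Cmod (c : C) : Rabs (Im c) <= Cmod c.
Proof.
  apply Rle_trans with (2 := Rmax_Cmod c). apply Rmax_r.
Qed.

(** This form in [Cmod] agrees with the derivative for both normed module structures on [C], as the
    next two lemmas show, and is convenient for direct estimates. *)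
Definition Cder (f : C -> C) (z l : C) : Prop :=
  forall e, 0 < e -> exists d, 0 < d /\ forall w, Cmod (w - z) < d ->
    Cmod (f w - f z - l * (w - z)) <= e * Cmod (w - z).

Definition Ccont (f : C -> C) (z : C) : Prop :=
  forall e, 0 < e -> exists d, 0 < d /\ forall w, Cmod (w - z) < d -> Cmod (f w - f z) < e.

Lemma Cder_is_derive (f : C -> C) (z l : C) :
  is_derive (K := C_AbsRing) (V := C_NormedModule) f z l <-> Cder f z l.
Proof.
  assert (E : forall w, minus (minus (f w) (f z)) (scal (minus w z) l : C_NormedModule) = (f w - f z - l * (w - z))%C).
  { intros w. unfold minus, plus, opp, scal; simpl. unfold mult; simpl. ring. }
  split.
  - intros [_ H] e He.
    destruct (H z (fun P HP => HP) (mkposreal e He)) as [d Hd]. exists d. split. apply cond_pos.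
    intros w Hw. rewrite <- E. exact (Hd w Hw).
  - intros H. split. apply is_linear_scal_l.
    intros x Hx. apply (is_filter_lim_locally_unique (K := C_AbsRing) (V := AbsRing_NormedModule C_AbsRing)) in Hx. subst x.
    intros e. destruct (H e (cond_pos e)) as [d [Hd Hw]].
    exists (mkposreal d Hd). intros w h. specialize (Hw w h). rewrite <- E in Hw. exact Hw.
Qed.

Lemma Cder_is_derive_ring (f : C -> C) (z l : C) :
  is_derive (K := C_AbsRing) (V := AbsRing_NormedModule C_AbsRing) f z l <-> Cder f z l.
Proof.
  rewrite <- Cder_is_derive. split; intros [_ H]; (split; [apply is_linear_scal_l | exact H]).
Qed.

Lemma Ccont_continuous (f : C -> C) (z : C) :
  continuous (T := AbsRing_UniformSpace C_AbsRing) (U := AbsRing_UniformSpace C_AbsRing) f z <-> Ccont f z.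
Proof.
  split.
  - intros H e He. destruct (H (ball (M := AbsRing_UniformSpace C_AbsRing) (f z) (mkposreal e He))) as [d Hd]. { exists (mkposreal e He). intros y Hy; exact Hy. }
    exists d. split. apply cond_pos. exact Hd.
  - intros H P [e He]. destruct (H e (cond_pos e)) as [d [Hd Hw]]. exists (mkposreal d Hd). intros w h. apply He, Hw, h.
Qed.

Lemma Cder_cont (f : C -> C) (z l : C) : Cder f z l -> Ccont f z.
Proof.
  intros H. apply Ccont_continuous. apply (ex_derive_continuous (K := C_AbsRing) (V := AbsRing_NormedModule C_AbsRing)).
  exists l. apply Cder_is_derive_ring; auto.
Qed.

Lemma Cder_ext_loc (f g : C -> C) (z l : C) d : 0 < d ->
  (forall w, Cmod (w - z) < d -> f w = g w) -> Cder f z l -> Cder g z l.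
Proof.
  intros Hd Hfg H e He. destruct (H e He) as [d' [Hd' Hw]].
  exists (Rmin d d'). split. apply Rmin_pos; auto.
  intros w h. destruct (Rmin_Rgt_l _ _ _ h) as [h1 h2].
  rewrite <- (Hfg w h1), <- (Hfg z). auto. rewrite Cmod_minus_diag; auto.
Qed.

Lemma Cder_ext (f g : C -> C) (z l : C) : (forall w, f w = g w) -> Cder f z l -> Cder g z l.
Proof. intros H. apply Cder_ext_loc with 1; auto. lra. Qed.

Lemma Ccont_ext_loc (f g : C -> C) (z : C) d : 0 < d ->
  (forall w, Cmod (w - z) < d -> f w = g w) -> Ccont f z -> Ccont g z.
Proof.
  intros Hd Hfg H e He. destruct (H e He) as [d' [Hd' Hw]].
  exists (Rmin d d'). split. apply Rmin_pos; auto.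
  intros w h. destruct (Rmin_Rgt_l _ _ _ h) as [h1 h2].
  rewrite <- (Hfg w h1), <- (Hfg z). auto. rewrite Cmod_minus_diag; auto.
Qed.

Lemma Cder_unique (f : C -> C) (z l m : C) : Cder f z l -> Cder f z m -> l = m.
Proof.
  intros Hl Hm. rewrite <- (is_C_derive_unique f z l), <- (is_C_derive_unique f z m); auto; apply Cder_is_derive; auto.
Qed.

Lemma Cder_const (c z : C) : Cder (fun _ => c) z 0.
Proof. apply Cder_is_derive, (is_derive_const (K := C_AbsRing) (V := C_NormedModule)). Qed.

Lemma Cder_id (z : C) : Cder (fun w => w) z 1.
Proof. apply Cder_is_derive_ring, (is_derive_id (K := C_AbsRing)). Qed.

Lemma Cder_plus (f g : C -> C) (z l m : C) :
  Cder f z l -> Cder g z m -> Cder (fun w => f w + g w)%C z (l + m).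
Proof.
  rewrite <- !Cder_is_derive. apply (is_derive_plus (K := C_AbsRing) (V := C_NormedModule)).
Qed.

Lemma Cder_mult (f g : C -> C) (z l m : C) :
  Cder f z l -> Cder g z m -> Cder (fun w => f w * g w)%C z (l * g z + f z * m).
Proof.
  rewrite <- !Cder_is_derive_ring. intros Hf Hg. apply (is_derive_mult (K := C_AbsRing) f g); auto. intros; apply Cmult_comm.
Qed.

Lemma Cder_scal (k : C) (f : C -> C) (z l : C) : Cder f z l -> Cder (fun w => k * f w)%C z (k * l).
Proof.
  intros H. replace (k * l)%C with (0 * f z + k * l)%C by ring.
  apply (Cder_mult (fun _ => k) f); auto. apply Cder_const.
Qed.

Lemma Cder_opp (f : C -> C) (z l : C) : Cder f z l -> Cder (fun w => - f w)%C z (- l).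
Proof.
  intros H. replace (- l)%C with (- RtoC 1 * l)%C by ring.
  apply Cder_ext with (fun w => (- RtoC 1 * f w)%C).
  intros; ring. apply Cder_scal; auto.
Qed.

Lemma Cder_minus (f g : C -> C) (z l m : C) :
  Cder f z l -> Cder g z m -> Cder (fun w => f w - g w)%C z (l - m).
Proof. intros Hf Hg. apply (Cder_plus f (fun w => - g w)%C); auto. apply Cder_opp; auto. Qed.

Lemma Cder_comp (f g : C -> C) (z l m : C) :
  Cder f (g z) l -> Cder g z m -> Cder (fun w => f (g w)) z (l * m).
Proof.
  rewrite Cmult_comm, <- (Cder_is_derive f), <- Cder_is_derive_ring, <- Cder_is_derive.
  apply (is_derive_comp (K := C_AbsRing) (V := C_NormedModule)).
Qed.

(** Differentiability of a continuous lift is obtained in two rounds. Since [l] is not zero, a first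
    crude use of the derivative of [f] bounds [g w - g u] by [B * Cmod (w - u)], half of the left
    side being absorbed; with this bound the error terms of [f] and [p] become small against
    [w - u]. *)
Lemma Cder_lift (f g p : C -> C) (u l m : C) (d : R) :
  0 < d -> (forall w, Cmod (w - u) < d -> f (g w) = p w) -> Ccont g u ->
  Cder f (g u) l -> l <> 0 -> Cder p u m -> Cder g u (m / l).
Proof.
  intros Hd Hfg Hg Hf Hl Hp e He.
  set (a := Cmod l). set (c := Cmod m).
  assert (Ha : 0 < a) by (apply Cmod_gt_0; auto).
  assert (Hc : 0 <= c) by apply Cmod_ge_0.
  set (B := 2 * (c + 1) / a).
  assert (HB : 0 < B) by (apply Rdiv_lt_0_compat; lra).
  destruct (Hf (Rmin (a / 2) (e * a / (2 * B)))) as [d1 [Hd1 H1]].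
  { apply Rmin_pos. lra. apply Rdiv_lt_0_compat; nra. }
  destruct (Hg d1 Hd1) as [d2 [Hd2 H2]].
  destruct (Hp (Rmin 1 (e * a / 2))) as [d3 [Hd3 H3]].
  { apply Rmin_pos. lra. nra. }
  set (d0 := Rmin d (Rmin d2 d3)).
  assert (Hd0 : 0 < d0) by (repeat apply Rmin_pos; auto).
  exists d0. split; auto. intros w h.
  assert (h1 : Cmod (w - u) < d) by (apply Rlt_le_trans with (1:=h); apply Rmin_l).
  assert (h2 : Cmod (w - u) < d2) by (apply Rlt_le_trans with (1:=h); unfold d0; eapply Rle_trans; [apply Rmin_r|apply Rmin_l]).
  assert (h3 : Cmod (w - u) < d3) by (apply Rlt_le_trans with (1:=h); unfold d0; eapply Rle_trans; [apply Rmin_r|apply Rmin_r]).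
  specialize (H3 _ h3). specialize (H1 _ (H2 _ h2)).
  rewrite (Hfg w h1), (Hfg u) in H1 by (rewrite Cmod_minus_diag; auto).
  assert (hw := Cmod_ge_0 (w - u)). set (q := Cmod (w - u)) in *.
  set (G := Cmod (g w - g u)) in *. assert (HG : 0 <= G) by apply Cmod_ge_0.
  assert (HpB : Cmod (p w - p u) <= (c + 1) * q).
  { replace (p w - p u)%C with ((p w - p u - m * (w - u)) + m * (w - u))%C by ring.
    eapply Rle_trans. apply Cmod_triangle. rewrite Cmod_mult. fold c q.
    assert (Rmin 1 (e * a / 2) <= 1) by apply Rmin_l. nra. }
  assert (HGB : G <= B * q).
  { assert (E : a * G <= (c + 1) * q + a / 2 * G).
    { unfold a, G. rewrite <- Cmod_mult.
      replace (l * (g w - g u))%C with ((p w - p u) - (p w - p u - l * (g w - g u)))%C by ring.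
      eapply Rle_trans. apply Cmod_tri_minus.
      assert (Rmin (a / 2) (e * a / (2 * B)) <= a / 2) by apply Rmin_l.
      fold a G. nra. }
    unfold B. apply Rmult_le_reg_l with (a / 2). lra.
    replace (a / 2 * (2 * (c + 1) / a * q)) with ((c + 1) * q) by (field; lra). lra. }
  apply Rmult_le_reg_l with a; auto.
  unfold a at 1. rewrite <- Cmod_mult.
  replace (l * (g w - g u - m / l * (w - u)))%C with
    ((p w - p u - m * (w - u)) - (p w - p u - l * (g w - g u)))%C by (field; auto).
  eapply Rle_trans. apply Cmod_tri_minus.
  assert (r1 : Rmin 1 (e * a / 2) <= e * a / 2) by apply Rmin_r.
  assert (r2 : Rmin (a / 2) (e * a / (2 * B)) <= e * a / (2 * B)) by apply Rmin_r.
  assert (r3 : Rmin (a / 2) (e * a / (2 * B)) * G <= e * a / (2 * B) * (B * q)).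
  { apply Rmult_le_compat; auto. left. apply Rmin_pos. lra. apply Rdiv_lt_0_compat; nra. }
  replace (e * a / (2 * B) * (B * q)) with (e * a / 2 * q) in r3 by (field; lra).
  nra.
Qed.

Lemma Ccont_inv (z : C) : z <> 0 -> Ccont Cinv z.
Proof.
  intros Hz e He. assert (Ha : 0 < Cmod z) by (apply Cmod_gt_0; auto). set (a := Cmod z) in *.
  exists (Rmin (a / 2) (e * a * a / 2)). split. apply Rmin_pos. lra. assert (0 < e * a) by nra. nra.
  intros w h. destruct (Rmin_Rgt_l _ _ _ h) as [h1 h2].
  assert (hw : a / 2 < Cmod w).
  { assert (H := Cmod_tri_rev z (z - w)). replace (z - (z - w))%C with w in H by ring.
    rewrite (Cmod_sym z w) in H. fold a in H. lra. }
  assert (w <> 0). { apply Cmod_gt_0. lra. }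
  replace (/ w - / z)%C with ((z - w) / (w * z))%C by (field; auto).
  rewrite Cmod_div by (apply Cmult_neq_0; auto). rewrite Cmod_mult. fold a. rewrite Cmod_sym.
  apply Rmult_lt_reg_r with (Cmod w * a). nra.
  unfold Rdiv. rewrite Rmult_assoc, Rinv_l, Rmult_1_r by nra.
  assert (0 < e * a) by nra. nra.
Qed.

Lemma Cder_inv (z : C) : z <> 0 -> Cder Cinv z (- / (z * z)).
Proof.
  intros Hz. assert (Ha : 0 < Cmod z) by (apply Cmod_gt_0; auto).
  intros e He.
  destruct (Ccont_inv z Hz (e * Cmod z)) as [d [Hd H]]. nra.
  exists (Rmin d (Cmod z)). split. apply Rmin_pos; auto.
  intros w h. destruct (Rmin_Rgt_l _ _ _ h) as [h1 h2].
  specialize (H w h1).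
  assert (w <> 0).
  { intros E. subst w. replace (0 - z)%C with (- z)%C in h2 by ring. rewrite Cmod_opp in h2. lra. }
  replace (/ w - / z - - / (z * z) * (w - z))%C with (- (/ w - / z) * / z * (w - z))%C by (field; auto).
  rewrite !Cmod_mult, Cmod_opp, Cmod_inv by auto.
  apply Rmult_le_compat_r. apply Cmod_ge_0.
  apply Rmult_le_reg_r with (Cmod z); auto. rewrite Rmult_assoc, Rinv_l by lra. lra.
Qed.

Lemma Ccont_comp (f g : C -> C) (z : C) : Ccont f (g z) -> Ccont g z -> Ccont (fun w => f (g w)) z.
Proof.
  intros Hf Hg e He. destruct (Hf e He) as [d [Hd H]]. destruct (Hg d Hd) as [d' [Hd' H']].
  exists d'. split; auto.
Qed.

Lemma Ccont_plus (f g : C -> C) (z : C) : Ccont f z -> Ccont g z -> Ccont (fun w => f w + g w)%C z.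
Proof.
  rewrite <- !Ccont_continuous. apply (continuous_plus (U := AbsRing_UniformSpace C_AbsRing) (K := C_AbsRing) (V := AbsRing_NormedModule C_AbsRing)).
Qed.

Lemma Ccont_mult (f g : C -> C) (z : C) : Ccont f z -> Ccont g z -> Ccont (fun w => f w * g w)%C z.
Proof.
  rewrite <- !Ccont_continuous. apply (continuous_mult (U := AbsRing_UniformSpace C_AbsRing) (K := C_AbsRing)).
Qed.

Lemma Ccont_const (c z : C) : Ccont (fun _ => c) z.
Proof. eapply Cder_cont, Cder_const. Qed.
Lemma Ccont_id (z : C) : Ccont (fun w => w) z.
Proof. eapply Cder_cont, Cder_id. Qed.
Lemma Ccont_minus (f g : C -> C) (z : C) : Ccont f z -> Ccont g z -> Ccont (fun w => f w - g w)%C z.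
Proof.
  rewrite <- !Ccont_continuous. apply (continuous_minus (U := AbsRing_UniformSpace C_AbsRing) (K := C_AbsRing) (V := AbsRing_NormedModule C_AbsRing)).
Qed.

(** * Segments and the mean value inequality *)

Definition Cseg (a b : C) (t : R) : C := (a + RtoC t * (b - a))%C.

Lemma Cseg_diff (a b : C) (s t : R) : (Cseg a b s - Cseg a b t)%C = (RtoC (s - t) * (b - a))%C.
Proof. unfold Cseg. rewrite RtoC_minus. ring. Qed.
Lemma Cseg_0 (a b : C) : Cseg a b 0 = a.
Proof. unfold Cseg. ring. Qed.
Lemma Cseg_1 (a b : C) : Cseg a b 1 = b.
Proof. unfold Cseg. ring. Qed.
Lemma Cseg_const (a : C) (t : R) : Cseg a a t = a.
Proof. unfold Cseg. ring. Qed.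
Lemma Cseg_ball (c a b : C) (r t : R) : 0 <= t <= 1 -> Cmod (a - c) < r -> Cmod (b - c) < r ->
  Cmod (Cseg a b t - c) < r.
Proof.
  intros Ht Ha Hb.
  replace (Cseg a b t - c)%C with (RtoC (1 - t) * (a - c) + RtoC t * (b - c))%C
    by (unfold Cseg; rewrite RtoC_minus; ring).
  eapply Rle_lt_trans. apply Cmod_triangle. rewrite !Cmod_mult, !Cmod_R, !Rabs_pos_eq by lra.
  destruct (Rle_lt_dec t 0). assert (t = 0) by lra. subst. lra. nra.
Qed.

Lemma Rmvt_bound (h h' : R -> R) (M : R) :
  (forall t, 0 <= t <= 1 -> is_derive h t (h' t)) -> (forall t, 0 <= t <= 1 -> h' t <= M) ->
  h 1 - h 0 <= M.
Proof.
  intros Hd Hb.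
  destruct (MVT_gen h 0 1 h') as [c [Hc E]].
  - intros x. rewrite Rmin_left, Rmax_right by lra. intros; apply Hd; lra.
  - intros x. rewrite Rmin_left, Rmax_right by lra. intros Hx.
    apply continuity_pt_filterlim. apply (ex_derive_continuous (K := R_AbsRing) (V := R_NormedModule)).
    eexists. apply Hd; lra.
  - rewrite Rmin_left, Rmax_right in Hc by lra. specialize (Hb c Hc). lra.
Qed.

Lemma Cmod_sq (z : C) : Cmod z * Cmod z = fst z * fst z + snd z * snd z.
Proof. assert (H := Cmod2_alt z). unfold Re, Im in H. simpl in H. lra. Qed.

Lemma is_derive_R_eps (h : R -> R) (t l : R) :
  (forall e, 0 < e -> exists d, 0 < d /\ forall s, Rabs (s - t) < d ->
     Rabs (h s - h t - l * (s - t)) <= e * Rabs (s - t)) -> is_derive h t l.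
Proof.
  intros H. split. apply is_linear_scal_l.
  intros x Hx. apply (is_filter_lim_locally_unique (K := R_AbsRing) (V := R_NormedModule)) in Hx. subst x.
  intros e. destruct (H e (cond_pos e)) as [d [Hd Hw]].
  exists (mkposreal d Hd). intros w h'.
  specialize (Hw w h').
  replace (h w - h t - l * (w - t)) with
    (minus (minus (h w) (h t)) (scal (minus w t) l)) in Hw.
  exact Hw. unfold minus, plus, opp, scal; simpl. unfold mult; simpl. ring.
Qed.

(* Projecting [f] on the direction of [f b - f a] reduces the inequality to the real mean value theorem. *)
Lemma Cmvt (f f' : C -> C) (a b : C) (M : R) :
  (forall t, 0 <= t <= 1 -> Cder f (Cseg a b t) (f' (Cseg a b t))) ->
  (forall t, 0 <= t <= 1 -> Cmod (f' (Cseg a b t)) <= M) ->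
  Cmod (f b - f a) <= M * Cmod (b - a).
Proof.
  intros Hd Hb. set (c := (f b - f a)%C). set (q := Cmod c).
  assert (Hq : 0 <= q) by apply Cmod_ge_0.
  set (L := fun z : C => fst (Cconj c * z)%C).
  assert (HL : forall x y, L (x - y)%C = L x - L y) by (intros; unfold L; simpl; ring).
  assert (HLb : forall x, Rabs (L x) <= q * Cmod x).
  { intros x. unfold L. eapply Rle_trans. apply re_le_Cmod. rewrite Cmod_mult, Cmod_conj. apply Rle_refl. }
  assert (HLs : forall (s : R) x, L (x * RtoC s)%C = L x * s) by (intros; unfold L; simpl; ring).
  set (h := fun t => L (f (Cseg a b t))).
  assert (HM := Rmvt_bound h (fun t => L (f' (Cseg a b t) * (b - a))%C) (q * (M * Cmod (b - a)))).
  assert (E : h 1 - h 0 = q * q).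
  { unfold h. rewrite Cseg_0, Cseg_1, <- HL. fold c. unfold q. rewrite Cmod_sq. unfold L. simpl. ring. }
  rewrite E in HM.
  assert (Hf : q * q <= q * (M * Cmod (b - a))).
  { apply HM.
    - intros t Ht. apply is_derive_R_eps. intros e He.
      set (k := q * Cmod (b - a) + 1).
      assert (Hk : 0 < k) by (assert (0 <= q * Cmod (b - a)) by (apply Rmult_le_pos; auto; apply Cmod_ge_0); unfold k; lra).
      destruct (Hd t Ht (e / k)) as [d [Hdp H]]. apply Rdiv_lt_0_compat; lra.
      assert (Hba := Cmod_ge_0 (b - a)).
      exists (d / (Cmod (b - a) + 1)). split. apply Rdiv_lt_0_compat; lra.
      intros s Hs. specialize (H (Cseg a b s)). rewrite Cseg_diff in H.
      rewrite Cmod_mult, Cmod_R in H. unfold h.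
      assert (Hsd : Rabs (s - t) * Cmod (b - a) < d).
      { apply Rle_lt_trans with (Rabs (s - t) * (Cmod (b - a) + 1)).
        apply Rmult_le_compat_l. apply Rabs_pos. lra.
        apply Rlt_le_trans with (d / (Cmod (b - a) + 1) * (Cmod (b - a) + 1)).
        apply Rmult_lt_compat_r; lra. right. field. lra. }
      specialize (H Hsd).
      replace (L (f (Cseg a b s)) - L (f (Cseg a b t)) - L (f' (Cseg a b t) * (b - a))%C * (s - t))
        with (L (f (Cseg a b s) - f (Cseg a b t) - f' (Cseg a b t) * (RtoC (s - t) * (b - a)))%C).
      2: { rewrite !HL. f_equal. rewrite <- HLs. f_equal. ring. }
      eapply Rle_trans. apply HLb.
      apply Rle_trans with (q * (e / k * (Rabs (s - t) * Cmod (b - a)))).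
      apply Rmult_le_compat_l; auto.
      replace (q * (e / k * (Rabs (s - t) * Cmod (b - a)))) with (e * Rabs (s - t) * ((k - 1) / k)) by (unfold k; field; unfold k in Hk; lra).
      rewrite <- (Rmult_1_r (e * Rabs (s - t))) at 2. apply Rmult_le_compat_l.
      apply Rmult_le_pos. lra. apply Rabs_pos.
      apply Rmult_le_reg_r with k; auto. unfold Rdiv. rewrite Rmult_assoc, Rinv_l; lra.
    - intros t Ht. eapply Rle_trans. apply Rle_abs. eapply Rle_trans. apply HLb.
      apply Rmult_le_compat_l; auto. rewrite Cmod_mult. apply Rmult_le_compat_r. apply Cmod_ge_0. auto. }
  fold q. destruct Hq as [Hq|Hq]. apply Rmult_le_reg_l with q; auto.
  rewrite <- Hq. apply Rmult_le_pos. eapply Rle_trans. 2: apply (Hb 0); lra. apply Cmod_ge_0. apply Cmod_ge_0.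
Qed.

Lemma Cmvt_lin (f f' : C -> C) (l a b : C) (M : R) :
  (forall t, 0 <= t <= 1 -> Cder f (Cseg a b t) (f' (Cseg a b t))) ->
  (forall t, 0 <= t <= 1 -> Cmod (f' (Cseg a b t) - l) <= M) ->
  Cmod (f b - f a - l * (b - a)) <= M * Cmod (b - a).
Proof.
  intros Hd Hb.
  replace (f b - f a - l * (b - a))%C with ((f b - l * b) - (f a - l * a))%C by ring.
  apply (Cmvt (fun z => f z - l * z)%C (fun z => f' z - l)%C); auto.
  intros t Ht. apply Cder_minus; auto. replace l with (l * 1)%C at 2 by ring.
  apply Cder_scal. apply Cder_id.
Qed.

(** * Bisection of rectangles *)

Lemma pow2_gt0 n : 0 < 2 ^ n.
Proof. apply pow_lt; lra. Qed.

Lemma pow2_small (L d : R) : 0 < d -> exists n, L / 2 ^ n < d.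
Proof.
  intros Hd. destruct (INR_unbounded (Rabs L / d)) as [n Hn]. exists n.
  assert (INR n < 2 ^ n).
  { clear. induction n. simpl; lra. rewrite S_INR. simpl.
    assert (1 <= 2 ^ n) by (apply pow_R1_Rle; lra). lra. }
  assert (h := pow2_gt0 n).
  apply Rmult_lt_reg_r with (2 ^ n); auto. unfold Rdiv. rewrite Rmult_assoc, Rinv_l, Rmult_1_r by lra.
  apply Rle_lt_trans with (Rabs L). apply Rle_abs.
  apply Rmult_lt_reg_r with (/ d). apply Rinv_0_lt_compat; auto.
  replace (d * 2 ^ n * / d) with (2 ^ n) by (field; lra). unfold Rdiv in Hn. lra.
Qed.

Lemma nested_intervals (U V : nat -> R) : (forall n, U n <= U (S n)) -> (forall n, V (S n) <= V n) ->
  (forall n, U n <= V n) -> exists x, forall n, U n <= x <= V n.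
Proof.
  intros HU HV HUV.
  assert (MU : forall n k, U n <= U (n + k)%nat).
  { intros n k; induction k. rewrite Nat.add_0_r; lra. rewrite Nat.add_succ_r. eapply Rle_trans; eauto. }
  assert (MV : forall n k, V (n + k)%nat <= V n).
  { intros n k; induction k. rewrite Nat.add_0_r; lra. rewrite Nat.add_succ_r. eapply Rle_trans; eauto. }
  destruct (completeness (fun x => exists n, x = U n)) as [x [Hx1 Hx2]].
  - exists (V 0%nat). intros x [n ->]. eapply Rle_trans. apply HUV. apply (MV 0%nat n).
  - exists (U 0%nat). eauto.
  - exists x. intros n. split. apply Hx1; eauto. apply Hx2. intros y [m ->].
    eapply Rle_trans. apply (MU m n). eapply Rle_trans. apply HUV. rewrite Nat.add_comm. apply MV.
Qed.

(** Bisection takes the place of compactness: it yields Goursat's theorem, boundedness on closed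
    discs and the escape of a path to infinity. [Hloc] prescribes both sides as halvings by the same
    [n], so that small rectangles keep the shape of the first one; Goursat's estimate needs the
    square of the perimeter to be comparable with the area. *)
Section Bisection.
Variable P : R -> R -> R -> R -> Prop.
Variables (a b c d : R).
Hypothesis Hab : a <= b.
Hypothesis Hcd : c <= d.
Hypothesis Hsub : forall x1 x2 y1 y2, a <= x1 <= x2 -> x2 <= b -> c <= y1 <= y2 -> y2 <= d ->
  let x := (x1 + x2) / 2 in let y := (y1 + y2) / 2 in
  P x1 x y1 y -> P x x2 y1 y -> P x1 x y y2 -> P x x2 y y2 -> P x1 x2 y1 y2.
Hypothesis Hloc : forall x y, a <= x <= b -> c <= y <= d -> exists e, 0 < e /\
  forall n x1 x2 y1 y2, a <= x1 <= x -> x <= x2 <= b -> c <= y1 <= y -> y <= y2 <= d ->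
   x2 - x1 = (b - a) / 2 ^ n -> y2 - y1 = (d - c) / 2 ^ n -> x2 - x1 < e -> y2 - y1 < e -> P x1 x2 y1 y2.

Let next (q : R * R * R * R) : R * R * R * R :=
  let '(x1, x2, y1, y2) := q in
  let x := (x1 + x2) / 2 in let y := (y1 + y2) / 2 in
  if excluded_middle_informative (P x1 x y1 y) then
   if excluded_middle_informative (P x x2 y1 y) then
    if excluded_middle_informative (P x1 x y y2) then (x, x2, y, y2)
    else (x1, x, y, y2)
   else (x, x2, y1, y)
  else (x1, x, y1, y).
Let Q := fix Q n := match n with O => (a, b, c, d) | S m => next (Q m) end.
Let X1 n := fst (fst (fst (Q n))).
Let X2 n := snd (fst (fst (Q n))).
Let Y1 n := snd (fst (Q n)).
Let Y2 n := snd (Q n).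

Lemma bisection_invariant (Hn : ~ P a b c d) n :
  (a <= X1 n /\ X2 n <= b /\ c <= Y1 n /\ Y2 n <= d /\
  X2 n - X1 n = (b - a) / 2 ^ n /\ Y2 n - Y1 n = (d - c) / 2 ^ n /\ ~ P (X1 n) (X2 n) (Y1 n) (Y2 n)) /\
  (X1 n <= X1 (S n) /\ X2 (S n) <= X2 n /\ Y1 n <= Y1 (S n) /\ Y2 (S n) <= Y2 n).
Proof.
  assert (Step : forall n, (a <= X1 n /\ X2 n <= b /\ c <= Y1 n /\ Y2 n <= d /\
     X2 n - X1 n = (b - a) / 2 ^ n /\ Y2 n - Y1 n = (d - c) / 2 ^ n /\ ~ P (X1 n) (X2 n) (Y1 n) (Y2 n)) ->
     (a <= X1 (S n) /\ X2 (S n) <= b /\ c <= Y1 (S n) /\ Y2 (S n) <= d /\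
     X2 (S n) - X1 (S n) = (b - a) / 2 ^ (S n) /\ Y2 (S n) - Y1 (S n) = (d - c) / 2 ^ (S n) /\ ~ P (X1 (S n)) (X2 (S n)) (Y1 (S n)) (Y2 (S n))) /\
     (X1 n <= X1 (S n) /\ X2 (S n) <= X2 n /\ Y1 n <= Y1 (S n) /\ Y2 (S n) <= Y2 n)).
  { clear n. intros n. unfold X1, X2, Y1, Y2. change (Q (S n)) with (next (Q n)).
    destruct (Q n) as [[[x1 x2] y1] y2]. simpl fst; simpl snd.
    intros [h1 [h2 [h3 [h4 [h5 [h6 h7]]]]]].
    assert (hp := pow2_gt0 n).
    assert (0 <= (b - a) / 2 ^ n) by (apply Rdiv_le_0_compat; lra).
    assert (0 <= (d - c) / 2 ^ n) by (apply Rdiv_le_0_compat; lra).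
    assert (e5 : (b - a) / 2 ^ S n = (x2 - x1) / 2) by (rewrite h5; simpl; field; lra).
    assert (e6 : (d - c) / 2 ^ S n = (y2 - y1) / 2) by (rewrite h6; simpl; field; lra).
    rewrite e5, e6. clear e5 e6. unfold next.
    assert (hs := Hsub x1 x2 y1 y2). simpl in hs.
    repeat match goal with |- context [excluded_middle_informative ?A] => destruct (excluded_middle_informative A) end; simpl;
    repeat split; try lra; auto.
    (* In the remaining branch [P] holds on three quarters, so [Hsub] makes it fail on the
       fourth. *)
    intros k. apply h7, hs; auto; lra. }
  assert (Base : forall n, a <= X1 n /\ X2 n <= b /\ c <= Y1 n /\ Y2 n <= d /\
     X2 n - X1 n = (b - a) / 2 ^ n /\ Y2 n - Y1 n = (d - c) / 2 ^ n /\ ~ P (X1 n) (X2 n) (Y1 n) (Y2 n)).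
  { clear n. induction n. unfold X1, X2, Y1, Y2; simpl. repeat split; try lra. auto. apply Step; auto. }
  split. apply Base. apply Step, Base.
Qed.

Lemma bisection : P a b c d.
Proof.
  apply NNPP; intros Hn. assert (Inv := bisection_invariant Hn).
  assert (Len : forall n, X1 n <= X2 n /\ Y1 n <= Y2 n).
  { intros n. destruct (Inv n) as [h _]. assert (hp := pow2_gt0 n).
    assert (0 <= (b - a) / 2 ^ n) by (apply Rdiv_le_0_compat; lra).
    assert (0 <= (d - c) / 2 ^ n) by (apply Rdiv_le_0_compat; lra). lra. }
  destruct (nested_intervals X1 X2) as [x Hx]; try (intros; apply Inv); try (intros; apply Len).
  destruct (nested_intervals Y1 Y2) as [y Hy]; try (intros; apply Inv); try (intros; apply Len).
  destruct (Hloc x y) as [e [He HP]].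
  { generalize (Hx 0%nat). unfold X1, X2; simpl; auto. }
  { generalize (Hy 0%nat). unfold Y1, Y2; simpl; auto. }
  destruct (pow2_small (Rmax (b - a) (d - c)) e He) as [n Hn'].
  destruct (Inv n) as [[h1 [h2 [h3 [h4 [h5 [h6 h7]]]]]] _].
  apply h7. specialize (Hx n). specialize (Hy n).
  assert (hp := pow2_gt0 n). assert (hp' := Rinv_0_lt_compat _ hp).
  apply (HP n); auto; try lra.
  - rewrite h5. eapply Rle_lt_trans. 2: apply Hn'. apply Rmult_le_compat_r. lra. apply Rmax_l.
  - rewrite h6. eapply Rle_lt_trans. 2: apply Hn'. apply Rmult_le_compat_r. lra. apply Rmax_r.
Qed.
End Bisection.

Lemma Cball_rect (x y x' y' e : R) : Rabs (x' - x) < e / 2 -> Rabs (y' - y) < e / 2 ->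
  Cmod ((x', y') - (x, y)) < e.
Proof.
  intros H1 H2. replace ((x', y') - (x, y))%C with ((x' - x, y' - y) : C) by (unfold Cminus, Cplus, Copp; simpl; f_equal; ring).
  eapply Rle_lt_trans. apply Cmod_le_abs. lra.
Qed.


(** * The Goursat theorem and Cauchy estimates *)

Lemma is_derive_R_eps_inv (h : R -> R) (t l : R) : is_derive h t l ->
  forall e, 0 < e -> exists d, 0 < d /\ forall s, Rabs (s - t) < d ->
     Rabs (h s - h t - l * (s - t)) <= e * Rabs (s - t).
Proof.
  intros [_ H] e He.
  destruct (H t (fun P HP => HP) (mkposreal e He)) as [d Hd]. exists d. split. apply cond_pos.
  intros s Hs. specialize (Hd s Hs).
  replace (h s - h t - l * (s - t)) with
    (minus (minus (h s) (h t)) (scal (minus s t) l)).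
  exact Hd. unfold minus, plus, opp, scal; simpl. unfold mult; simpl. ring.
Qed.

(** * The exponential and its derivative *)

Lemma Cexp_plus (z w : C) : Cexp (z + w) = (Cexp z * Cexp w)%C.
Proof.
  destruct z as [a b], w as [c d]. unfold Cexp, Cmult, Cplus; simpl.
  rewrite exp_plus, cos_plus, sin_plus. f_equal; ring.
Qed.
Lemma Cexp_0 : Cexp 0 = 1.
Proof. unfold Cexp; simpl. rewrite exp_0, cos_0, sin_0. unfold RtoC. f_equal; ring. Qed.
Lemma Cexp_neg (z : C) : (Cexp z * Cexp (- z))%C = 1.
Proof. rewrite <- Cexp_plus. replace (z + - z)%C with (RtoC 0) by ring. apply Cexp_0. Qed.
Lemma Cmod_Cexp (z : C) : Cmod (Cexp z) = exp (fst z).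
Proof.
  assert (H := Cmod_sq (Cexp z)). unfold Cexp in *; simpl in H.
  replace (exp (fst z) * cos (snd z) * (exp (fst z) * cos (snd z)) + exp (fst z) * sin (snd z) * (exp (fst z) * sin (snd z)))
   with (exp (fst z) * exp (fst z) * (Rsqr (sin (snd z)) + Rsqr (cos (snd z)))) in H by (unfold Rsqr; ring).
  rewrite sin2_cos2 in H.
  assert (h := exp_pos (fst z)).
  assert (h' := Cmod_ge_0 (exp (fst z) * cos (snd z), exp (fst z) * sin (snd z))). nra.
Qed.
Lemma Cexp_neq_0 (z : C) : Cexp z <> 0.
Proof. apply Cmod_gt_0. rewrite Cmod_Cexp. apply exp_pos. Qed.

Lemma Cder_Cexp (z : C) : Cder Cexp z (Cexp z).
Proof.
  intros e He.
  (* The final estimate collects six error terms, each at most [k * Cmod u]; the divisor 8 leaves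
     room for them. *)
  set (k := e / exp (fst z) / 8).
  assert (Hk : 0 < k) by (unfold k; assert (h := exp_pos (fst z)); assert (0 < e / exp (fst z)) by (apply Rdiv_lt_0_compat; auto); lra).
  destruct (is_derive_R_eps_inv exp 0 1) with (e := k) as [d1 [Hd1 H1]]; auto.
  { replace 1 with (exp 0) by apply exp_0. apply is_derive_exp. }
  destruct (is_derive_R_eps_inv sin 0 1) with (e := k) as [d2 [Hd2 H2]]; auto.
  { replace 1 with (cos 0) by apply cos_0. apply is_derive_sin. }
  destruct (is_derive_R_eps_inv cos 0 0) with (e := k) as [d3 [Hd3 H3]]; auto.
  { replace 0 with (- sin 0) at 2 by (rewrite sin_0; ring). apply is_derive_cos. }
  destruct (is_derive_R_eps_inv exp 0 1) with (e := 1) as [d4 [Hd4 H4]]; auto.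
  { replace 1 with (exp 0) by apply exp_0. apply is_derive_exp. } lra.
  rewrite exp_0 in *. rewrite sin_0 in *. rewrite cos_0 in *.
  set (d := Rmin (Rmin d1 d2) (Rmin (Rmin d3 d4) (Rmin (1/2) (k/2)))).
  assert (Hd : 0 < d) by (repeat apply Rmin_pos; lra).
  exists d. split; auto. intros w hw. set (u := (w - z)%C) in *.
  assert (Ed : d <= d1 /\ d <= d2 /\ d <= d3 /\ d <= d4 /\ d <= 1/2 /\ d <= k/2).
  { clearbody k. clear. unfold d, Rmin; repeat destruct (Rle_dec _ _); repeat split; lra. }
  assert (Ew : w = (z + u)%C) by (unfold u; ring). rewrite Ew, Cexp_plus.
  replace (Cexp z * Cexp u - Cexp z - Cexp z * u)%C with (Cexp z * (Cexp u - 1 - u))%C by ring.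
  rewrite Cmod_mult, Cmod_Cexp.
  replace (e * Cmod u) with (exp (fst z) * (8 * k * Cmod u)).
  2:{ unfold k. field. assert (h := exp_pos (fst z)). lra. }
  apply Rmult_le_compat_l. left; apply exp_pos.
  assert (hr : Rabs (fst u) <= Cmod u) by apply re_le_Cmod.
  assert (hi : Rabs (snd u) <= Cmod u) by apply im_le_Cmod.
  clearbody u. destruct u as [s t]. simpl fst in *; simpl snd in *.
  set (q := Cmod (s, t)) in *. assert (0 <= q) by apply Cmod_ge_0.
  specialize (H1 s). specialize (H2 t). specialize (H3 t). specialize (H4 s).
  rewrite Rminus_0_r in *.
  specialize (H1 ltac:(lra)). specialize (H2 ltac:(lra)). specialize (H3 ltac:(lra)). specialize (H4 ltac:(lra)).
  assert (hkr : k * Rabs s <= k * q) by (apply Rmult_le_compat_l; lra).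
  assert (hki : k * Rabs t <= k * q) by (apply Rmult_le_compat_l; lra).
  assert (e1 : Rabs (exp s - 1 - s) <= k * q).
  { replace (exp s - 1 - s) with (exp s - 1 - 1 * s) by ring. lra. }
  assert (e2 : Rabs (sin t - t) <= k * q).
  { replace (sin t - t) with (sin t - 0 - 1 * t) by ring. lra. }
  assert (e3 : Rabs (cos t - 1) <= k * q).
  { replace (cos t - 1) with (cos t - 1 - 0 * t) by ring. lra. }
  assert (e4 : Rabs (exp s - 1) <= 2 * q).
  { replace (exp s - 1) with ((exp s - 1 - 1 * s) + s) by ring. eapply Rle_trans. apply Rabs_triang. lra. }
  assert (e5 : 0 < exp s <= 2). { split. apply exp_pos. assert (h := Rle_abs (exp s - 1)). lra. }
  unfold Cexp, Cminus, Cplus, Copp, RtoC; simpl.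
  eapply Rle_trans. apply Cmod_le_abs.
  replace (exp s * cos t + - (1) + - s) with (exp s * (cos t - 1) + (exp s - 1 - s)) by ring.
  replace (exp s * sin t + - 0 + - t) with (exp s * (sin t - t) + t * (exp s - 1)) by ring.
  assert (f1 := Rabs_triang (exp s * (cos t - 1)) (exp s - 1 - s)).
  assert (f2 := Rabs_triang (exp s * (sin t - t)) (t * (exp s - 1))).
  rewrite Rabs_mult in f1. rewrite !Rabs_mult in f2. rewrite (Rabs_pos_eq (exp s)) in f1, f2 by lra.
  assert (g1 : exp s * Rabs (cos t - 1) <= 2 * (k * q)) by (apply Rmult_le_compat; try lra; apply Rabs_pos).
  assert (g2 : exp s * Rabs (sin t - t) <= 2 * (k * q)) by (apply Rmult_le_compat; try lra; apply Rabs_pos).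
  assert (g3 : Rabs t * Rabs (exp s - 1) <= (k/2) * (2 * q)) by (apply Rmult_le_compat; try lra; apply Rabs_pos).
  assert (0 <= k * q) by (apply Rmult_le_pos; lra). lra.
Qed.

(** * Continuous curves and integrals over real intervals *)

Definition Pcont (g : R -> C) (t : R) : Prop :=
  forall e, 0 < e -> exists d, 0 < d /\ forall s, Rabs (s - t) < d -> Cmod (g s - g t) < e.

Lemma Pcont_continuous (g : R -> C) (t : R) :
  continuous (U := C_UniformSpace) g t <-> Pcont g t.
Proof.
  split.
  - intros H e He.
    (* The balls of the uniform structure on [C] are squares, and a square of half side [r] lies in
       the disc of radius [sqrt 2 * r]. *)
    assert (He' : 0 < e / sqrt 2) by (apply Rdiv_lt_0_compat; auto; apply sqrt_lt_R0; lra).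
    destruct (H (fun y => ball (g t) (mkposreal _ He') y)) as [d Hd].
    { exists (mkposreal _ He'). auto. }
    exists d. split. apply cond_pos. intros s Hs. specialize (Hd s Hs).
    apply C_NormedModule_mixin_compat2 in Hd. simpl in Hd.
    replace (sqrt 2 * (e / sqrt 2)) with e in Hd. exact Hd.
    field. apply Rgt_not_eq. apply sqrt_lt_R0; lra.
  - intros H P [e He]. destruct (H e (cond_pos e)) as [d [Hd Hs]].
    exists (mkposreal d Hd). intros s h. apply He. apply C_NormedModule_mixin_compat1. apply Hs. exact h.
Qed.

Lemma Pcont_comp (f : C -> C) (g : R -> C) (t : R) : Ccont f (g t) -> Pcont g t -> Pcont (fun s => f (g s)) t.
Proof.
  intros Hf Hg e He. destruct (Hf e He) as [d [Hd H]]. destruct (Hg d Hd) as [d' [Hd' H']].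
  exists d'. split; auto.
Qed.

Lemma Pcont_hor (y t : R) : Pcont (fun x => (x, y) : C) t.
Proof.
  intros e He. exists e. split; auto. intros s Hs.
  replace ((s, y) - (t, y))%C with (RtoC (s - t)) by (unfold RtoC, Cminus, Cplus, Copp; simpl; f_equal; ring).
  rewrite Cmod_R; auto.
Qed.
Lemma Pcont_ver (x t : R) : Pcont (fun y => (x, y) : C) t.
Proof.
  intros e He. exists e. split; auto. intros s Hs.
  replace ((x, s) - (x, t))%C with (Ci * RtoC (s - t))%C by (unfold Ci, Cmult, RtoC, Cminus, Cplus, Copp; simpl; f_equal; ring).
  rewrite Cmod_mult, Cmod_Ci, Cmod_R. lra.
Qed.

Definition CI (f : R -> C) (a b : R) : C := RInt (V := C_R_CompleteNormedModule) f a b.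
Definition exCI (f : R -> C) (a b : R) : Prop := ex_RInt (V := C_R_NormedModule) f a b.

Lemma exCI_cont (f : R -> C) (a b : R) : a <= b -> (forall t, a <= t <= b -> Pcont f t) -> exCI f a b.
Proof.
  intros Hab H. apply (ex_RInt_continuous (V := C_R_CompleteNormedModule)).
  rewrite Rmin_left, Rmax_right by auto. intros z Hz. apply Pcont_continuous. auto.
Qed.

Lemma CI_Chasles (f : R -> C) (a b c : R) : exCI f a b -> exCI f b c -> (CI f a b + CI f b c)%C = CI f a c.
Proof. intros H1 H2. apply (RInt_Chasles (V := C_R_CompleteNormedModule)); auto. Qed.

Lemma CI_minus (f g : R -> C) (a b : R) : exCI f a b -> exCI g a b ->
  CI (fun x => f x - g x)%C a b = (CI f a b - CI g a b)%C.
Proof. intros H1 H2. apply (RInt_minus (V := C_R_CompleteNormedModule)); auto. Qed.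

Lemma exCI_minus (f g : R -> C) (a b : R) : exCI f a b -> exCI g a b -> exCI (fun x => f x - g x)%C a b.
Proof. intros H1 H2. apply (ex_RInt_minus (V := C_R_CompleteNormedModule)); auto. Qed.

Lemma CI_const (c : C) (a b : R) : CI (fun _ => c) a b = (RtoC (b - a) * c)%C.
Proof. unfold CI. rewrite RInt_const. apply scal_R_Cmult. Qed.

Lemma exCI_const (c : C) (a b : R) : exCI (fun _ => c) a b.
Proof. apply ex_RInt_const. Qed.

Lemma CI_bound (f : R -> C) (a b M : R) : a <= b -> exCI f a b -> (forall t, a <= t <= b -> Cmod (f t) <= M) ->
  Cmod (CI f a b) <= (b - a) * M.
Proof.
  intros Hab Hex H. rewrite Cmod_norm.
  apply (norm_RInt_le (V := C_R_NormedModule) f (fun _ => M) a b); auto.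
  intros t Ht. change (norm (f t)) with (norm (f t : prod_NormedModule R_AbsRing R_NormedModule R_NormedModule)). rewrite <- Cmod_norm. auto.
  apply (RInt_correct (V := C_R_CompleteNormedModule)); auto.
  apply (is_RInt_const (V := R_NormedModule) a b M).
Qed.

Lemma CI_near (f : R -> C) (k : C) (a b M : R) : a <= b -> exCI f a b ->
  (forall t, a <= t <= b -> Cmod (f t - k) <= M) ->
  Cmod (CI f a b - RtoC (b - a) * k) <= (b - a) * M.
Proof.
  intros Hab Hex H. rewrite <- CI_const, <- CI_minus; auto using exCI_const.
  apply CI_bound; auto. apply exCI_minus; auto using exCI_const.
Qed.

Lemma CI_ext (f g : R -> C) (a b : R) : (forall t, f t = g t) -> CI f a b = CI g a b.
Proof. intros H. apply (RInt_ext (V := C_R_CompleteNormedModule)). intros; apply H. Qed.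

(** The contour integral of [F] along the boundary of the rectangle, counterclockwise. *)
Definition rectI (F : C -> C) (x1 x2 y1 y2 : R) : C :=
  (CI (fun x => F (x, y1)) x1 x2 - CI (fun x => F (x, y2)) x1 x2 +
   Ci * (CI (fun y => F (x2, y)) y1 y2 - CI (fun y => F (x1, y)) y1 y2))%C.

Lemma goursat (F F' : C -> C) (a b c d : R) : a < b -> c < d ->
  (forall x y, a <= x <= b -> c <= y <= d -> Cder F (x, y) (F' (x, y))) ->
  rectI F a b c d = 0.
Proof.
  intros Hab Hcd HF.
  assert (EH : forall y x1 x2, c <= y <= d -> a <= x1 -> x1 <= x2 -> x2 <= b -> exCI (fun x => F (x, y)) x1 x2).
  { intros y x1 x2 Hy h1 h2 h3. apply exCI_cont; auto. intros t Ht.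
    apply (Pcont_comp F (fun x => (x, y))). eapply Cder_cont. apply HF; lra. apply Pcont_hor. }
  assert (EV : forall x y1 y2, a <= x <= b -> c <= y1 -> y1 <= y2 -> y2 <= d -> exCI (fun y => F (x, y)) y1 y2).
  { intros x y1 y2 Hy h1 h2 h3. apply exCI_cont; auto. intros t Ht.
    apply (Pcont_comp F (fun y => (x, y))). eapply Cder_cont. apply HF; lra. apply Pcont_ver. }
  assert (Key : forall k, 0 < k -> Cmod (rectI F a b c d) <= k * ((b - a) * (d - c))).
  { intros k Hk.
    apply (bisection (fun x1 x2 y1 y2 => Cmod (rectI F x1 x2 y1 y2) <= k * ((x2 - x1) * (y2 - y1))) a b c d); try lra.
    - intros x1 x2 y1 y2 h1 h2 h3 h4 x y H1 H2 H3 H4.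
      assert (Hx : x1 <= x <= x2) by (unfold x; lra). assert (Hy : y1 <= y <= y2) by (unfold y; lra).
      replace (rectI F x1 x2 y1 y2) with ((rectI F x1 x y1 y + rectI F x x2 y1 y) + (rectI F x1 x y y2 + rectI F x x2 y y2))%C.
      2:{ unfold rectI.
        rewrite <- (CI_Chasles (fun x => F (x, y1)) x1 x x2) by (apply EH; lra).
        rewrite <- (CI_Chasles (fun x => F (x, y2)) x1 x x2) by (apply EH; lra).
        rewrite <- (CI_Chasles (fun y => F (x1, y)) y1 y y2) by (apply EV; lra).
        rewrite <- (CI_Chasles (fun y => F (x2, y)) y1 y y2) by (apply EV; lra). ring. }
      eapply Rle_trans. apply Cmod_triangle.
      eapply Rle_trans. apply Rplus_le_compat; apply Cmod_triangle.
      replace (k * ((x2 - x1) * (y2 - y1))) with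
       ((k * ((x - x1) * (y - y1)) + k * ((x2 - x) * (y - y1))) + (k * ((x - x1) * (y2 - y)) + k * ((x2 - x) * (y2 - y)))) by ring.
      lra.
    - intros x0 y0 Hx Hy. set (W := b - a). set (H := d - c).
      assert (HW : 0 < W) by (unfold W; lra). assert (HH : 0 < H) by (unfold H; lra).
      (* Chosen so that the bound [2 * e * (w + h)^2] below equals [k * w * h] for every rectangle
         of sides [w], [h] similar to the first one. *)
      set (e := k * (W * H) / (2 * ((W + H) * (W + H)))).
      assert (HWH : 0 < W * H) by (apply Rmult_lt_0_compat; auto).
      assert (HWH2 : 0 < (W + H) * (W + H)) by (apply Rmult_lt_0_compat; lra).
      assert (He : 0 < e).
      { apply Rdiv_lt_0_compat. apply Rmult_lt_0_compat; auto. lra. }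
      destruct (HF x0 y0 Hx Hy e He) as [del [Hdel HD]].
      set (l := F' (x0, y0)) in *.
      exists (del / 2). split. lra. intros n x1 x2 y1 y2 h1 h2 h3 h4 h5 h6 h7 h8.
      set (w := x2 - x1) in *. set (h := y2 - y1) in *.
      assert (Hw : 0 <= w) by (unfold w; lra). assert (Hh : 0 <= h) by (unfold h; lra).
      set (G := fun z => (F z - F (x0, y0) - l * (z - (x0, y0)))%C).
      assert (GB : forall x y, x1 <= x <= x2 -> y1 <= y <= y2 -> Cmod (G (x, y)) <= e * (w + h)).
      { intros x y Hx' Hy'.
        assert (hm : Cmod ((x, y) - (x0, y0)) <= w + h).
        { replace ((x, y) - (x0, y0))%C with ((x - x0, y - y0) : C) by (unfold Cminus, Cplus, Copp; simpl; f_equal; ring).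
          eapply Rle_trans. apply Cmod_le_abs. apply Rplus_le_compat; apply Rabs_le; unfold w, h; lra. }
        unfold G. eapply Rle_trans. apply HD. lra. apply Rmult_le_compat_l; lra. }
      assert (E1 : Cmod (CI (fun x => F (x, y1) - F (x, y2))%C x1 x2 - RtoC (x2 - x1) * (l * Ci * RtoC (y1 - y2))) <= (x2 - x1) * (2 * (e * (w + h)))).
      { apply CI_near. lra. apply exCI_minus; apply EH; lra.
        intros t Ht. replace (F (t, y1) - F (t, y2) - l * Ci * RtoC (y1 - y2))%C with (G (t, y1) - G (t, y2))%C.
        eapply Rle_trans. apply Cmod_tri_minus. assert (g1 := GB t y1). assert (g2 := GB t y2). lra.
        unfold G. replace (l * Ci * RtoC (y1 - y2))%C with (l * ((t, y1) - (t, y2)))%C. ring.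
        rewrite <- Cmult_assoc. f_equal. unfold Ci, Cmult, RtoC, Cminus, Cplus, Copp; simpl; f_equal; ring. }
      assert (E2 : Cmod (CI (fun y => F (x2, y) - F (x1, y))%C y1 y2 - RtoC (y2 - y1) * (l * RtoC (x2 - x1))) <= (y2 - y1) * (2 * (e * (w + h)))).
      { apply CI_near. lra. apply exCI_minus; apply EV; lra.
        intros t Ht. replace (F (x2, t) - F (x1, t) - l * RtoC (x2 - x1))%C with (G (x2, t) - G (x1, t))%C.
        eapply Rle_trans. apply Cmod_tri_minus. assert (g1 := GB x1 t). assert (g2 := GB x2 t). lra.
        unfold G. replace (RtoC (x2 - x1))%C with ((x2, t) - (x1, t))%C. ring.
        unfold Ci, Cmult, RtoC, Cminus, Cplus, Copp; simpl; f_equal; ring. }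
      rewrite CI_minus in E1 by (apply EH; lra). rewrite CI_minus in E2 by (apply EV; lra).
      (* Opposite sides are paired. The two subtracted terms come from the linear part of [F], and
         they cancel in the sum. *)
      replace (rectI F x1 x2 y1 y2) with
        ((CI (fun x => F (x, y1)) x1 x2 - CI (fun x => F (x, y2)) x1 x2 - RtoC (x2 - x1) * (l * Ci * RtoC (y1 - y2))) +
         Ci * (CI (fun y => F (x2, y)) y1 y2 - CI (fun y => F (x1, y)) y1 y2 - RtoC (y2 - y1) * (l * RtoC (x2 - x1))))%C.
      2:{ unfold rectI. rewrite !RtoC_minus. ring. }
      eapply Rle_trans. apply Cmod_triangle. rewrite Cmod_mult, Cmod_Ci, Rmult_1_l.
      fold w in E1, E2 |- *. fold h in E1, E2 |- *.
      apply Rle_trans with (2 * e * ((w + h) * (w + h))). lra.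
      rewrite h5, h6. fold W H. right. assert (hp := pow2_gt0 n). unfold e. field. split; lra. }
  apply Cmod_eq_0. apply Rle_antisym. 2: apply Cmod_ge_0.
  apply le_epsilon. intros e He.
  assert (0 < (b - a) * (d - c)) by (apply Rmult_lt_0_compat; lra).
  specialize (Key (e / ((b - a) * (d - c)))). rewrite Rplus_0_l.
  replace (e / ((b - a) * (d - c)) * ((b - a) * (d - c))) with e in Key by (field; lra).
  apply Key. apply Rdiv_lt_0_compat; auto.
Qed.

(** * Cauchy's estimate and differentiability of the derivative *)

Definition Dholo (h h' : C -> C) (c : C) (R : R) : Prop :=
  forall z, Cmod (z - c) < R -> Cder h z (h' z).

Lemma Cder_shift (h : C -> C) (c z l : C) : Cder h (z + c) l -> Cder (fun w => h (w + c)%C) z l.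
Proof.
  intros H. replace l with (l * 1)%C by ring. apply (Cder_comp h (fun w => w + c)%C); auto.
  replace (RtoC 1) with (1 + 0)%C by ring. apply Cder_plus. apply Cder_id. apply Cder_const.
Qed.

Lemma Cder_Cexp_neg (z : C) : Cder (fun w => Cexp (- w)) z (- Cexp (- z)).
Proof.
  replace (- Cexp (- z))%C with (Cexp (- z) * - (1))%C by ring.
  apply (Cder_comp Cexp Copp). apply Cder_Cexp. apply (Cder_opp (fun w => w)). apply Cder_id.
Qed.

Lemma Cexp_lnball (c : C) (r y : R) : 0 < r -> Cmod (c + Cexp (ln r, y) - c) = r.
Proof.
  intros Hr. replace (c + Cexp (ln r, y) - c)%C with (Cexp (ln r, y)) by ring.
  rewrite Cmod_Cexp. simpl. apply exp_ln; auto.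
Qed.

(** In the coordinate [u] with [z = c + Cexp u], circles become vertical segments of length
    [2 * PI]. The function [F] is holomorphic to the left of [ln r] and has the period [2 * PI] in
    the imaginary direction, so Goursat's theorem on a rectangle makes its vertical integral
    independent of [x]. As [x] tends to minus infinity, [F] tends to [h' c]. *)
Lemma mean_deriv (h h' : C -> C) (c : C) (R r : R) : 0 < r < R -> Dholo h h' c R ->
  CI (fun y => ((h (c + Cexp (ln r, y)) - h c) * Cexp (- (ln r, y)))%C) 0 (2 * PI) = (RtoC (2 * PI) * h' c)%C
  /\ exCI (fun y => ((h (c + Cexp (ln r, y)) - h c) * Cexp (- (ln r, y)))%C) 0 (2 * PI).
Proof.
  intros Hr Hh. assert (Hpi := PI_RGT_0).
  set (F := fun u : C => ((h (c + Cexp u) - h c) * Cexp (- u))%C).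
  set (F' := fun u : C => (((h' (c + Cexp u) * (0 + Cexp u)) - 0) * Cexp (- u) + (h (c + Cexp u) - h c) * - Cexp (- u))%C).
  assert (HF : forall u : C, fst u <= ln r -> Cder F u (F' u)).
  { intros u Hu. unfold F, F'.
    apply (Cder_mult (fun u => h (c + Cexp u) - h c)%C (fun u => Cexp (- u))).
    2: apply Cder_Cexp_neg.
    apply Cder_minus. 2: apply Cder_const.
    apply (Cder_comp h (fun u => c + Cexp u)%C). apply Hh.
    replace (c + Cexp u - c)%C with (Cexp u) by ring. rewrite Cmod_Cexp.
    apply Rle_lt_trans with (exp (ln r)). destruct Hu as [Hu|Hu]. left; apply exp_increasing; auto. rewrite Hu; lra.
    rewrite exp_ln; lra.
    apply Cder_plus. apply Cder_const. apply Cder_Cexp. }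
  assert (EX : forall x, x <= ln r -> exCI (fun y => F (x, y)) 0 (2 * PI)).
  { intros x Hx. apply exCI_cont. lra. intros t _. apply (Pcont_comp F (fun y => (x, y))).
    eapply Cder_cont. apply HF. simpl; lra. apply Pcont_ver. }
  split. 2: apply EX; lra.
  assert (Per : forall x, F (x, 0) = F (x, 2 * PI)).
  { intros x. unfold F. replace (Cexp (- ((x, 2 * PI) : C))) with (Cexp (- ((x, 0) : C))).
    replace (Cexp (x, 2 * PI)) with (Cexp (x, 0)). reflexivity.
    - unfold Cexp; simpl. rewrite cos_2PI, sin_2PI, cos_0, sin_0. reflexivity.
    - unfold Cexp; simpl. rewrite !cos_neg, !sin_neg, cos_2PI, sin_2PI, cos_0, sin_0. reflexivity. }
  assert (Key : forall x, x < ln r -> CI (fun y => F (x, y)) 0 (2 * PI) = CI (fun y => F (ln r, y)) 0 (2 * PI)).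
  { intros x Hx. assert (G := goursat F F' x (ln r) 0 (2 * PI) Hx ltac:(lra)).
    unfold rectI in G. rewrite (CI_ext _ _ x (ln r) Per) in G.
    assert (G' : (Ci * (CI (fun y => F (ln r, y)) 0 (2 * PI) - CI (fun y => F (x, y)) 0 (2 * PI)))%C = 0).
    { rewrite <- G. ring. intros x' y Hx' _. apply HF. simpl; lra. }
    apply Cmod_minus_eq0. rewrite Cmod_sym.
    rewrite <- (Rmult_1_l (Cmod _)), <- Cmod_Ci, <- Cmod_mult, G'. apply Cmod_0. }
  change (CI (fun y => F (ln r, y)) 0 (2 * PI) = (RtoC (2 * PI) * h' c)%C).
  apply Cmod_minus_eq0. apply Rle_antisym. 2: apply Cmod_ge_0.
  apply le_epsilon. intros e He. rewrite Rplus_0_l.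
  assert (Hc := Hh c). rewrite Cmod_minus_diag in Hc. specialize (Hc ltac:(lra)).
  destruct (Hc (e / (2 * PI))) as [d [Hd HD]]. apply Rdiv_lt_0_compat; lra.
  (* Far enough to the left for the circle of radius [exp x] to lie where the difference quotient is
     within [e / (2 * PI)] of [h' c]. *)
  set (x := Rmin (ln r) (ln d) - 1).
  assert (Hx : x < ln r) by (unfold x; assert (h0 := Rmin_l (ln r) (ln d)); lra).
  assert (Hx' : exp x < d). { rewrite <- (exp_ln d) by auto. apply exp_increasing. unfold x; assert (h0 := Rmin_r (ln r) (ln d)); lra. }
  rewrite <- (Key x Hx).
  replace (2 * PI) with (2 * PI - 0) at 2 by ring.
  replace e with ((2 * PI - 0) * (e / (2 * PI))) by (field; lra).
  apply CI_near. lra. apply EX; lra.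
  intros t _. unfold F.
  replace ((h (c + Cexp (x, t)) - h c) * Cexp (- (x, t)) - h' c)%C with
    ((h (c + Cexp (x, t)) - h c - h' c * (c + Cexp (x, t) - c)) * Cexp (- (x, t)))%C.
  2:{ assert (E := Cexp_neg (x, t)).
      replace (h' c) with (h' c * (Cexp (x, t) * Cexp (- (x, t))))%C at 2 by (rewrite E; ring). ring. }
  rewrite Cmod_mult.
  assert (E1 : Cmod (c + Cexp (x, t) - c) = exp x).
  { replace (c + Cexp (x, t) - c)%C with (Cexp (x, t)) by ring. apply Cmod_Cexp. }
  assert (E2 : exp x * Cmod (Cexp (- (x, t))) = 1).
  { rewrite Cmod_Cexp. simpl. rewrite exp_Ropp. field. apply Rgt_not_eq, exp_pos. }
  specialize (HD (c + Cexp (x, t))%C). rewrite E1 in HD. specialize (HD Hx').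
  eapply Rle_trans. apply Rmult_le_compat_r. apply Cmod_ge_0. apply HD.
  rewrite Rmult_assoc, E2. lra.
Qed.

Lemma CI_bound_exp (g : R -> C) (r N : R) : 0 < r ->
  exCI (fun y => (g y * Cexp (- (ln r, y)))%C) 0 (2 * PI) ->
  (forall y, Cmod (g y) <= N) ->
  Cmod (CI (fun y => (g y * Cexp (- (ln r, y)))%C) 0 (2 * PI)) <= 2 * PI * (N / r).
Proof.
  intros Hr Hex HN. assert (Hpi := PI_RGT_0).
  replace (2 * PI) with (2 * PI - 0) at 2 by ring. apply CI_bound; auto. lra.
  intros t _. rewrite Cmod_mult. apply Rmult_le_compat; auto; try apply Cmod_ge_0.
  rewrite Cmod_Cexp. simpl. rewrite exp_Ropp, exp_ln; lra.
Qed.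

Lemma cauchy_estimate (h h' : C -> C) (c : C) (R r M : R) : 0 < r < R -> Dholo h h' c R ->
  (forall E, Cmod E = r -> Cmod (h (c + E)%C - h c) <= M) -> Cmod (h' c) <= M / r.
Proof.
  intros Hr Hh HM. assert (Hpi := PI_RGT_0).
  destruct (mean_deriv h h' c R r Hr Hh) as [E Ex].
  assert (B := CI_bound_exp (fun y => (h (c + Cexp (ln r, y)) - h c)%C) r M ltac:(lra) Ex).
  simpl in B. rewrite E, Cmod_mult, Cmod_R, Rabs_pos_eq in B by lra.
  apply Rmult_le_reg_l with (2 * PI). lra. apply B. intros y. apply HM.
  rewrite Cmod_Cexp. simpl. apply exp_ln; lra.
Qed.

(* Cauchy's estimate at the origin for [z |-> h (z + c1) - h (z + c2)]. *)
Lemma deriv_diff (h h' : C -> C) (c1 c2 : C) (R r N : R) : 0 < r < R ->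
  Dholo h h' c1 R -> Dholo h h' c2 R ->
  (forall E, Cmod E = r -> Cmod (h (E + c1)%C - h (E + c2)%C - (h c1 - h c2)) <= N) ->
  Cmod (h' c1 - h' c2) <= N / r.
Proof.
  intros Hr H1 H2 HN.
  assert (K := cauchy_estimate (fun z => h (z + c1) - h (z + c2))%C (fun z => h' (z + c1) - h' (z + c2))%C 0 R r N Hr).
  simpl in K. rewrite !Cplus_0_l in K. apply K.
  - intros z Hz. replace (z - 0)%C with z in Hz by ring.
    apply (Cder_minus (fun z => h (z + c1)%C) (fun z => h (z + c2)%C)); apply Cder_shift.
    apply H1. replace (z + c1 - c1)%C with z by ring. auto.
    apply H2. replace (z + c2 - c2)%C with z by ring. auto.
  - intros E HE. rewrite Cplus_0_l. auto.
Qed.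

Lemma Dholo_sub (h h' : C -> C) (c c' : C) (R R' : R) : Cmod (c' - c) + R' <= R -> Dholo h h' c R -> Dholo h h' c' R'.
Proof.
  intros H Hh z Hz. apply Hh. assert (T := Cmod_tri3 z c' c). lra.
Qed.

(** This replaces a bound on the second derivative before [h'] is known to be differentiable. By the
    mean value inequality [h (z + c1) - h (z + c2)] is at most [M * Cmod (c1 - c2)], and
    [deriv_diff] on a circle of radius [R / 4] gives the constant 8. *)
Lemma deriv_lipschitz (h h' : C -> C) (c c1 c2 : C) (R M : R) : 0 < R -> Dholo h h' c R ->
  (forall z, Cmod (z - c) < R -> Cmod (h' z) <= M) ->
  Cmod (c1 - c) < R / 2 -> Cmod (c2 - c) < R / 2 -> Cmod (h' c1 - h' c2) <= 8 * M / R * Cmod (c1 - c2).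
Proof.
  intros HR Hh HM H1 H2.
  assert (HL : forall a b, Cmod (a - c) < R -> Cmod (b - c) < R -> Cmod (h b - h a) <= M * Cmod (b - a)).
  { intros a b Ha Hb. apply (Cmvt h h').
    intros t Ht. apply Hh. apply Cseg_ball; auto. intros t Ht. apply HM. apply Cseg_ball; auto. }
  assert (D := deriv_diff h h' c1 c2 (R/2) (R/4) (2 * M * Cmod (c1 - c2)) ltac:(lra)).
  replace (8 * M / R * Cmod (c1 - c2)) with (2 * M * Cmod (c1 - c2) / (R / 4)) by (field; lra).
  apply D.
  - apply Dholo_sub with c R; auto. lra.
  - apply Dholo_sub with c R; auto. lra.
  - intros E HE. eapply Rle_trans. apply Cmod_tri_minus.
    assert (K1 := HL (E + c2)%C (E + c1)%C). assert (K2 := HL c2 c1).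
    replace (E + c1 - (E + c2))%C with (c1 - c2)%C in K1 by ring.
    assert (T1 := Cmod_triangle E (c1 - c)). assert (T2 := Cmod_triangle E (c2 - c)).
    replace (E + (c1 - c))%C with (E + c1 - c)%C in T1 by ring.
    replace (E + (c2 - c))%C with (E + c2 - c)%C in T2 by ring.
    specialize (K1 ltac:(lra) ltac:(lra)). specialize (K2 ltac:(lra) ltac:(lra)). lra.
Qed.

Lemma bounded_disc (f : C -> C) (c : C) (r : R) : 
  (forall z, Cmod (z - c) <= r -> exists e M, 0 < e /\ forall w, Cmod (w - z) < e -> Cmod (f w) <= M) ->
  exists M, forall z, Cmod (z - c) <= r -> Cmod (f z) <= M.
Proof.
  intros Hf.
  destruct (Rle_lt_dec 0 r) as [Hr|Hr].
  2:{ exists 0. intros z Hz. assert (h := Cmod_ge_0 (z - c)). lra. }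
  destruct (bisection (fun x1 x2 y1 y2 => exists M, forall x y, x1 <= x <= x2 -> y1 <= y <= y2 -> Cmod ((x, y) - c) <= r -> Cmod (f (x, y)) <= M)
   (fst c - r) (fst c + r) (snd c - r) (snd c + r)) as [M HM]; try lra.
  - intros x1 x2 y1 y2 _ _ _ _ xm ym [M1 H1] [M2 H2] [M3 H3] [M4 H4].
    exists (Rmax (Rmax M1 M2) (Rmax M3 M4)). intros x y Hx Hy Hd.
    destruct (Rle_lt_dec x xm); destruct (Rle_lt_dec y ym).
    + eapply Rle_trans. apply H1; auto; lra. eapply Rle_trans; [|apply Rmax_l]. apply Rmax_l.
    + eapply Rle_trans. apply H3; auto; lra. eapply Rle_trans; [|apply Rmax_r]. apply Rmax_l.
    + eapply Rle_trans. apply H2; auto; lra. eapply Rle_trans; [|apply Rmax_l]. apply Rmax_r.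
    + eapply Rle_trans. apply H4; auto; lra. eapply Rle_trans; [|apply Rmax_r]. apply Rmax_r.
  - intros x y Hx Hy.
    destruct (Rle_lt_dec (Cmod ((x, y) - c)) r) as [h|h].
    + destruct (Hf _ h) as [e [M [He H]]]. exists (e / 2). split. lra.
      intros n x1 x2 y1 y2 h1 h2 h3 h4 _ _ h5 h6. exists M. intros x' y' Hx' Hy' _.
      apply H. apply Cball_rect; apply Rabs_def1; lra.
    (* Near a point outside the closed disc there is nothing to bound. *)
    + set (e := Cmod ((x, y) - c) - r). exists (e / 2). split. unfold e; lra.
      intros n x1 x2 y1 y2 h1 h2 h3 h4 _ _ h5 h6. exists 0. intros x' y' Hx' Hy' Hd. exfalso.
      assert (K : Cmod ((x', y') - (x, y)) < e) by (apply Cball_rect; apply Rabs_def1; lra).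
      assert (T := Cmod_tri3 (x, y) (x', y') c). rewrite (Cmod_sym (x, y) (x', y')) in T. unfold e in K. lra.
  - exists M. intros [x y] Hz.
    assert (h1 := Rle_trans _ _ _ (re_le_Cmod _) Hz). assert (h2 := Rle_trans _ _ _ (im_le_Cmod _) Hz).
    simpl in h1, h2. apply Rabs_le_between in h1. apply Rabs_le_between in h2.
    apply HM; auto; lra.
Qed.

Lemma Ccont_loc_bounded (f : C -> C) (z : C) : Ccont f z ->
  exists e M, 0 < e /\ forall w, Cmod (w - z) < e -> Cmod (f w) <= M.
Proof.
  intros H. destruct (H 1 Rlt_0_1) as [d [Hd Hw]]. exists d, (Cmod (f z) + 1). split; auto.
  intros w h. specialize (Hw w h). assert (T := Cmod_tri_rev (f w) (f z)). lra.
Qed.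

Lemma deriv_loc_bounded (h h' : C -> C) (c : C) (R : R) : 0 < R -> Dholo h h' c R ->
  exists e M, 0 < e /\ e < R /\ forall w, Cmod (w - c) < e -> Cmod (h' w) <= M.
Proof.
  intros HR Hh.
  destruct (Ccont_loc_bounded h c) as [e [M [He HM]]].
  { eapply Cder_cont. apply Hh. rewrite Cmod_minus_diag; auto. }
  set (q := Rmin e R / 4). assert (Hq : 0 < q) by (unfold q; assert (0 < Rmin e R) by (apply Rmin_pos; auto); lra).
  assert (q <= e / 4 /\ q <= R / 4) by (unfold q, Rmin; destruct Rle_dec; lra).
  exists q, (2 * M / q). split; [auto|split;[lra|]]. intros w Hw.
  apply cauchy_estimate with h (2 * q). lra. apply Dholo_sub with c R; auto. lra.
  intros E HE. eapply Rle_trans. apply Cmod_tri_minus.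
  assert (T := Cmod_triangle (w - c) E). replace (w - c + E)%C with (w + E - c)%C in T by ring.
  assert (k1 := HM (w + E)%C). assert (k2 := HM w). lra.
Qed.

Lemma deriv_cont (h h' : C -> C) (c : C) (R : R) : 0 < R -> Dholo h h' c R -> Ccont h' c.
Proof.
  intros HR Hh. destruct (deriv_loc_bounded h h' c R HR Hh) as [r [M [Hr [HrR HM]]]].
  intros e He. set (L := 8 * M / r).
  assert (HL : 0 <= L).
  { apply Rdiv_le_0_compat; auto. assert (h0 := HM c). rewrite Cmod_minus_diag in h0. assert (h1 := Cmod_ge_0 (h' c)). lra. }
  exists (Rmin (r / 2) (e / (L + 1))). split. apply Rmin_pos. lra. apply Rdiv_lt_0_compat; lra.
  intros w Hw. destruct (Rmin_Rgt_l _ _ _ Hw) as [h1 h2].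
  eapply Rle_lt_trans. apply (deriv_lipschitz h h' c w c r M); auto.
  apply Dholo_sub with c R; auto. rewrite Cmod_minus_diag; lra. rewrite Cmod_minus_diag; lra.
  fold L. apply Rle_lt_trans with ((L + 1) * Cmod (w - c)). apply Rmult_le_compat_r. apply Cmod_ge_0. lra.
  apply Rlt_le_trans with ((L + 1) * (e / (L + 1))). apply Rmult_lt_compat_l; lra. right; field; lra.
Qed.

Lemma deriv_bounded_disc (h h' : C -> C) (c : C) (R r : R) : r < R -> Dholo h h' c R ->
  exists M, forall z, Cmod (z - c) <= r -> Cmod (h' z) <= M.
Proof.
  intros HR Hh. apply bounded_disc. intros z Hz. apply Ccont_loc_bounded.
  apply deriv_cont with h (R - r). lra. apply Dholo_sub with c R; auto. lra.
Qed.

(** The integral formula of [mean_deriv] is differentiated in its centre. The increment of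
    [h (c + E) - h c] under a shift by [k] is [k * (h' (c + E) - h' c)] up to an error quadratic in
    [k], by the Lipschitz bound on [h']. Hence the derivative of [h'] is given by the same integral,
    with [h'] in place of [h]. *)
Lemma deriv_holo (h h' : C -> C) (c : C) (R : R) : 0 < R -> Dholo h h' c R -> exists l, Cder h' c l.
Proof.
  intros HR Hh. assert (Hpi := PI_RGT_0).
  destruct (deriv_bounded_disc h h' c R (R / 2) ltac:(lra) Hh) as [M HM].
  assert (HM0 : 0 <= M).
  { assert (h0 := HM c). rewrite Cmod_minus_diag in h0. assert (h1 := Cmod_ge_0 (h' c)). lra. }
  set (L := 8 * M / (R / 2)). set (r := R / 8).
  assert (HL0 : 0 <= L) by (apply Rdiv_le_0_compat; lra).
  assert (HL : forall a b, Cmod (a - c) < R / 4 -> Cmod (b - c) < R / 4 -> Cmod (h' a - h' b) <= L * Cmod (a - b)).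
  { intros a b Ha Hb. apply deriv_lipschitz with h c; try lra. apply Dholo_sub with c R; auto. rewrite Cmod_minus_diag; lra.
    intros z Hz. apply HM; lra. }
  assert (HT : forall a k, Cmod (a - c) + Cmod k < R / 4 -> Cmod (h (a + k)%C - h a - k * h' a) <= L * (Cmod k * Cmod k)).
  { intros a k Ha. assert (P := Cmod_ge_0 k). assert (P' := Cmod_ge_0 (a - c)).
    assert (T := Cmod_triangle (a - c) k). replace (a - c + k)%C with (a + k - c)%C in T by ring.
    assert (K := Cmvt_lin h h' (h' a) a (a + k)%C (L * Cmod k)).
    replace (a + k - a)%C with k in K by ring. rewrite <- Rmult_assoc, (Cmult_comm k). apply K.
    - intros t Ht. apply Hh. assert (Cmod (Cseg a (a + k) t - c) < R / 4) by (apply Cseg_ball; lra). lra.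
    - intros t Ht. assert (Cmod (Cseg a (a + k) t - c) < R / 4) by (apply Cseg_ball; lra).
      eapply Rle_trans. apply HL; lra. apply Rmult_le_compat_l; auto.
      replace (Cseg a (a + k) t - a)%C with (RtoC t * k)%C by (unfold Cseg; ring).
      rewrite Cmod_mult, Cmod_R, Rabs_pos_eq by lra. nra. }
  set (G := fun y => ((h' (c + Cexp (ln r, y)) - h' c) * Cexp (- (ln r, y)))%C).
  assert (Hr : 0 < r < R) by (unfold r; lra).
  assert (EG : exCI G 0 (2 * PI)).
  { apply exCI_cont. lra. intros t _.
    set (g := fun u => ((h' (c + Cexp u) - h' c) * Cexp (- u))%C).
    apply (Pcont_comp g (fun y => (ln r, y))). 2: apply Pcont_ver.
    unfold g. apply Ccont_mult. 2: { eapply Cder_cont. apply Cder_Cexp_neg. }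
    apply Ccont_minus. 2: apply Ccont_const.
    apply (Ccont_comp h' (fun u => c + Cexp u)%C).
    apply deriv_cont with h (R - r). lra. apply Dholo_sub with c R; auto. rewrite Cexp_lnball; lra.
    apply Ccont_plus. apply Ccont_const. eapply Cder_cont. apply Cder_Cexp. }
  exists (/ RtoC (2 * PI) * CI G 0 (2 * PI))%C.
  assert (Hpn : RtoC (2 * PI) <> 0) by (intros E; apply RtoC_inj in E; lra).
  set (d := R / 16).
  assert (Main : forall k, Cmod k < d -> Cmod (h' (c + k)%C - h' c - / RtoC (2 * PI) * CI G 0 (2 * PI) * k) <= 2 * L / r * Cmod k * Cmod k).
  { intros k Hk. unfold d in Hk.
    destruct (mean_deriv h h' (c + k) (R/4) r) as [E1 X1]. unfold r; lra.
    apply Dholo_sub with c R; auto. replace (c + k - c)%C with k by ring. lra.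
    destruct (mean_deriv h h' c R r Hr Hh) as [E2 X2].
    apply Rmult_le_reg_l with (2 * PI). lra.
    rewrite <- (Rabs_pos_eq (2 * PI)) at 1 by lra. rewrite <- Cmod_R, <- Cmod_mult.
    set (g := fun y => ((h (c + k + Cexp (ln r, y)) - h (c + k) - (h (c + Cexp (ln r, y)) - h c)) - k * (h' (c + Cexp (ln r, y)) - h' c))%C).
    (* The integral is linear over the reals; for the complex factor [k] linearity is checked on
       coordinates. *)
    assert (XkG : exCI (fun y => (k * G y)%C) 0 (2 * PI) /\ CI (fun y => (k * G y)%C) 0 (2 * PI) = (k * CI G 0 (2 * PI))%C).
    { clear - EG. assert (HG := RInt_correct (V := C_R_CompleteNormedModule) G 0 (2 * PI) EG).
      set (I := RInt (V := C_R_CompleteNormedModule) G 0 (2 * PI)) in *.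
      assert (Hs : is_RInt (V := C_R_NormedModule) (fun y => (k * G y)%C) 0 (2 * PI) (k * I)%C).
      { assert (A1 := is_RInt_fct_extend_fst (U := R_NormedModule) (V := R_NormedModule) G 0 (2 * PI) I HG).
        assert (A2 := is_RInt_fct_extend_snd (U := R_NormedModule) (V := R_NormedModule) G 0 (2 * PI) I HG).
        destruct k as [k1 k2].
        apply (is_RInt_fct_extend_pair (U := R_NormedModule) (V := R_NormedModule)); simpl.
        apply (is_RInt_minus (V := R_NormedModule)); apply (is_RInt_scal (V := R_NormedModule)); auto.
        apply (is_RInt_plus (V := R_NormedModule)); apply (is_RInt_scal (V := R_NormedModule)); auto. }
      split. exists (k * I)%C; auto.
      apply (is_RInt_unique (V := C_R_CompleteNormedModule)); auto. }
    destruct XkG as [XkG EkG].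
    assert (Eg : (RtoC (2 * PI) * (h' (c + k) - h' c - / RtoC (2 * PI) * CI G 0 (2 * PI) * k))%C =
       CI (fun y => (g y * Cexp (- (ln r, y)))%C) 0 (2 * PI)
       /\ exCI (fun y => (g y * Cexp (- (ln r, y)))%C) 0 (2 * PI)).
    { replace (fun y => (g y * Cexp (- (ln r, y)))%C) with
       (fun y => ((h (c + k + Cexp (ln r, y)) - h (c + k)) * Cexp (- (ln r, y)) - (h (c + Cexp (ln r, y)) - h c) * Cexp (- (ln r, y)) - k * G y)%C).
      2:{ apply functional_extensionality. intros y. unfold g, G. ring. }
      split. 2: (apply exCI_minus; [apply exCI_minus|]; auto).
      rewrite CI_minus; auto. 2: apply exCI_minus; auto.
      rewrite CI_minus; auto. rewrite E1, E2, EkG. field. auto. }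
    destruct Eg as [Eg Xg]. rewrite Eg.
    replace (2 * PI * (2 * L / r * Cmod k * Cmod k)) with (2 * PI * (2 * L * (Cmod k * Cmod k) / r)) by (field; lra).
    apply CI_bound_exp; auto. lra.
    intros y. unfold g.
    assert (Ey : Cmod (c + Cexp (ln r, y) - c) = r) by (apply Cexp_lnball; lra).
    assert (K1 := HT (c + Cexp (ln r, y))%C k). assert (K2 := HT c k).
    rewrite Ey in K1. rewrite Cmod_minus_diag in K2. unfold r in K1.
    specialize (K1 ltac:(unfold r; lra)). specialize (K2 ltac:(lra)). fold r in K1.
    set (e := Cexp (ln r, y)) in *.
    replace (h (c + k + e) - h (c + k) - (h (c + e) - h c) - k * (h' (c + e) - h' c))%C with
     ((h (c + e + k) - h (c + e) - k * h' (c + e)) - (h (c + k) - h c - k * h' c))%C.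
    eapply Rle_trans. apply Cmod_tri_minus. lra.
    replace (c + e + k)%C with (c + k + e)%C by ring. ring. }
  intros e He. set (B := 2 * L / r).
  assert (HB : 0 <= B) by (apply Rdiv_le_0_compat; lra).
  exists (Rmin d (e / (B + 1))). split. apply Rmin_pos. unfold d; lra. apply Rdiv_lt_0_compat; lra.
  intros w Hw. destruct (Rmin_Rgt_l _ _ _ Hw) as [h1 h2].
  assert (K := Main (w - c)%C h1). replace (c + (w - c))%C with w in K by ring.
  eapply Rle_trans. apply K. fold B. apply Rmult_le_compat_r. apply Cmod_ge_0.
  apply Rle_trans with ((B + 1) * Cmod (w - c)). apply Rmult_le_compat_r. apply Cmod_ge_0. lra.
  apply Rle_trans with ((B + 1) * (e / (B + 1))). apply Rmult_le_compat_l; lra. right; field; lra.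
Qed.

(** * Polynomial growth, local inversion, the Bloch theorem *)

Lemma Cder0_const (h : C -> C) : (forall z, Cder h z 0) -> forall z, h z = h 0.
Proof.
  intros H z. apply Cmod_minus_eq0. apply Rle_antisym. 2: apply Cmod_ge_0.
  eapply Rle_trans. apply (Cmvt h (fun _ => 0) 0 z 0); auto.
  intros; rewrite Cmod_0; lra. lra.
Qed.

Lemma Cder_Cpow (n : nat) (z : C) :
  Cder (fun z => Defs.Cpow z (S n)) z (RtoC (INR (S n)) * Defs.Cpow z n)%C.
Proof.
  induction n.
  - simpl. apply Cder_ext with (fun z => z). intros; ring. replace (1 * 1)%C with (RtoC 1) by ring. apply Cder_id.
  - replace (RtoC (INR (S (S n))) * Defs.Cpow z (S n))%C with
     (1 * Defs.Cpow z (S n) + z * (RtoC (INR (S n)) * Defs.Cpow z n))%C.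
    apply (Cder_mult (fun z => z) (fun z => Defs.Cpow z (S n))); auto. apply Cder_id.
    rewrite (S_INR (S n)), RtoC_plus. simpl Defs.Cpow. ring.
Qed.

Lemma poly_primitive (n : nat) (a : nat -> C) (z : C) :
  Cder (fun z => Csum (fun k => match k with O => RtoC 0 | S m => a m * / RtoC (INR (S m)) end * Defs.Cpow z k)%C (S n)) z
    (Csum (fun k => a k * Defs.Cpow z k)%C n).
Proof.
  assert (T : forall m, Cder (fun z => (a m * / RtoC (INR (S m)) * Defs.Cpow z (S m))%C) z (a m * Defs.Cpow z m)).
  { intros m. assert (N : RtoC (INR (S m)) <> 0) by (intros E; apply RtoC_inj in E; apply not_0_INR in E; auto).
    replace (a m * Defs.Cpow z m)%C with (a m * / RtoC (INR (S m)) * (RtoC (INR (S m)) * Defs.Cpow z m))%C by (field; auto).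
    apply Cder_scal. apply Cder_Cpow. }
  induction n.
  - simpl Csum at 2. apply Cder_ext with (fun z => (a O * / RtoC (INR 1) * Defs.Cpow z 1)%C). 
    intros w. simpl. ring. apply T.
  - change (Cder (fun z => (Csum (fun k => match k with O => RtoC 0 | S m => a m * / RtoC (INR (S m)) end * Defs.Cpow z k)%C (S n) +
        a (S n) * / RtoC (INR (S (S n))) * Defs.Cpow z (S (S n)))%C) z
      (Csum (fun k => a k * Defs.Cpow z k)%C n + a (S n) * Defs.Cpow z (S n))%C).
    apply Cder_plus; auto.
Qed.

Lemma Csum_shift0 (a : nat -> C) (c : C) (n : nat) :
  Csum (fun k => match k with O => (a O + c)%C | _ => a k end) n = (Csum a n + c)%C.
Proof. induction n; simpl. auto. rewrite IHn. ring. Qed.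

Lemma is_polynomial_primitive (f f' : C -> C) : (forall z, Cder f z (f' z)) -> is_polynomial f' -> is_polynomial f.
Proof.
  intros H [n [a Ha]].
  set (b := fun k => match k with O => RtoC 0 | S m => (a m * / RtoC (INR (S m)))%C end).
  set (P := fun z => Csum (fun k => b k * Defs.Cpow z k)%C (S n)).
  assert (E : forall z, (f z - P z)%C = (f 0 - P 0)%C).
  { intros z. apply (Cder0_const (fun z => f z - P z)%C). intros w.
    replace (RtoC 0) with (f' w - f' w)%C by ring. apply Cder_minus; auto.
    rewrite Ha. apply poly_primitive. }
  exists (S n), (fun k => match k with O => (b O + (f 0 - P 0))%C | _ => b k end).
  intros z. replace (f z) with (P z + (f 0 - P 0))%C by (rewrite <- (E z); ring).
  unfold P at 1. rewrite <- (Csum_shift0 (fun k => b k * Defs.Cpow z k)%C).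
  f_equal. apply functional_extensionality. intros [|k]; simpl; ring.
Qed.

(** Cauchy's estimate on a circle of radius [1 + Cmod z] lowers the exponent by one for [f'], and a
    primitive of a polynomial is a polynomial. For exponent 0 this is Liouville's theorem. *)
Lemma poly_growth (n : nat) : forall (f f' : C -> C) (A : R), (forall z, Cder f z (f' z)) ->
  (forall z, Cmod (f z) <= A * (1 + Cmod z) ^ n) -> is_polynomial f.
Proof.
  induction n; intros f f' A Hf HA.
  - apply is_polynomial_primitive with (fun _ => RtoC 0).
    2:{ exists O, (fun _ => RtoC 0). intros; simpl; ring. }
    intros z. replace (RtoC 0) with (f' z); auto. apply Cmod_eq_0.
    apply Rle_antisym. 2: apply Cmod_ge_0. apply le_epsilon. intros e He. rewrite Rplus_0_l.
    assert (HA0 : 0 <= A). { assert (h := HA 0). assert (h' := Cmod_ge_0 (f 0)). simpl in h. lra. }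
    replace e with (2 * A / (2 * A / e + 1) + (e - 2 * A / (2 * A / e + 1))) by ring.
    assert (Hq : 0 <= 2 * A / e) by (apply Rdiv_le_0_compat; lra).
    assert (K : Cmod (f' z) <= 2 * A / (2 * A / e + 1)).
    { apply cauchy_estimate with f (2 * A / e + 2). lra. intros w _; auto.
      intros E _. eapply Rle_trans. apply Cmod_tri_minus. assert (h1 := HA (z + E)%C). assert (h2 := HA z). simpl in *. lra. }
    assert (2 * A / (2 * A / e + 1) <= e).
    { apply Rmult_le_reg_r with (2 * A / e + 1). lra. unfold Rdiv at 1. rewrite Rmult_assoc, Rinv_l by lra.
      replace (e * (2 * A / e + 1)) with (2 * A + e) by (field; lra). lra. }
    lra.
  - apply is_polynomial_primitive with f'; auto.
    assert (Hd : forall z, exists l, Cder f' z l).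
    { intros z. apply deriv_holo with f 1. lra. intros w _; auto. }
    destruct (choice (fun z l => Cder f' z l) Hd) as [f'' Hf''].
    assert (HA0 : 0 <= A). { assert (h := HA 0). assert (h' := Cmod_ge_0 (f 0)). rewrite Cmod_0, Rplus_0_r, pow1 in h. lra. }
    apply IHn with f'' (2 * (A * 2 ^ S n)); auto.
    intros z. set (r := 1 + Cmod z). assert (Hz := Cmod_ge_0 z). assert (Hr : 1 <= r) by (unfold r; lra).
    assert (HB : forall w, Cmod w <= Cmod z + r -> Cmod (f w) <= A * (2 ^ S n * r ^ S n)).
    { intros w Hw. eapply Rle_trans. apply HA. apply Rmult_le_compat_l; auto.
      rewrite <- Rpow_mult_distr. apply pow_incr. assert (Hw' := Cmod_ge_0 w). unfold r in *. lra. }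
    replace (2 * (A * 2 ^ S n) * r ^ n) with (2 * (A * (2 ^ S n * r ^ S n)) / r) by (simpl; field; lra).
    apply cauchy_estimate with f (r + 1). lra. intros w _; auto.
    intros E HE. eapply Rle_trans. apply Cmod_tri_minus.
    assert (h1 := HB (z + E)%C). assert (h2 := HB z). assert (T := Cmod_triangle z E).
    specialize (h1 ltac:(lra)). specialize (h2 ltac:(lra)). lra.
Qed.

Lemma Rseq_geom_lim (x : nat -> R) (q : R) : (forall n, Rabs (x (S n) - x n) <= q / 2 ^ n) ->
  exists l, forall n, Rabs (x n - l) <= 2 * q / 2 ^ n.
Proof.
  intros H.
  assert (St : forall n, 2 * q / 2 ^ S n = 2 * q / 2 ^ n - q / 2 ^ n).
  { intros n. assert (h := pow2_gt0 n). simpl. field. lra. }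
  assert (Q : 0 <= q). { assert (h := H O). assert (h' := Rabs_pos (x 1%nat - x O)). simpl in h. lra. }
  assert (Pn : forall n, 0 <= 2 * q / 2 ^ n) by (intros n; apply Rdiv_le_0_compat; [lra|apply pow2_gt0]).
  destruct (nested_intervals (fun n => x n - 2 * q / 2 ^ n) (fun n => x n + 2 * q / 2 ^ n)) as [l Hl];
    try (intros n; try rewrite St; assert (h := H n); apply Rabs_le_between in h; specialize (Pn n); lra).
  exists l. intros n. apply Rabs_le. specialize (Hl n). lra.
Qed.

Lemma Cseq_geom_lim (z : nat -> C) (q : R) : (forall n, Cmod (z (S n) - z n) <= q / 2 ^ n) ->
  exists l, forall n, Cmod (z n - l) <= 4 * q / 2 ^ n.
Proof.
  intros H.
  destruct (Rseq_geom_lim (fun n => fst (z n)) q) as [l1 H1].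
  { intros n. eapply Rle_trans. 2: apply H. apply (re_le_Cmod (z (S n) - z n)). }
  destruct (Rseq_geom_lim (fun n => snd (z n)) q) as [l2 H2].
  { intros n. eapply Rle_trans. 2: apply H. apply (im_le_Cmod (z (S n) - z n)). }
  exists (l1, l2). intros n. specialize (H1 n). specialize (H2 n).
  destruct (z n) as [x y]. simpl in *.
  eapply Rle_trans. apply Cmod_le_abs. simpl.
  replace (4 * q / 2 ^ n) with (2 * q / 2 ^ n + 2 * q / 2 ^ n) by (field; apply Rgt_not_eq, pow2_gt0).
  unfold Rminus in *. lra.
Qed.

Lemma near_linear_expand (h h' : C -> C) (c : C) (s : R) : Dholo h h' c s ->
  (forall z, Cmod (z - c) < s -> Cmod (h' z - h' c) <= Cmod (h' c) / 2) ->
  forall a b, Cmod (a - c) < s -> Cmod (b - c) < s -> Cmod (h' c) / 2 * Cmod (b - a) <= Cmod (h b - h a).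
Proof.
  intros Hh Hn a b Ha Hb.
  assert (K := Cmvt_lin h h' (h' c) a b (Cmod (h' c) / 2)).
  assert (Cmod (h b - h a - h' c * (b - a)) <= Cmod (h' c) / 2 * Cmod (b - a)).
  { apply K; intros t Ht; [apply Hh|apply Hn]; apply Cseg_ball; auto. }
  assert (T := Cmod_tri_rev (h' c * (b - a)) (h b - h a)). rewrite (Cmod_sym (h' c * (b - a)) (h b - h a)) in T. rewrite Cmod_mult in T. lra.
Qed.

(* Newton's iteration with frozen derivative contracts by 1/2. *)
Lemma near_linear_onto (h h' : C -> C) (c : C) (s : R) : Dholo h h' c s -> h' c <> 0 ->
  (forall z, Cmod (z - c) < s -> Cmod (h' z - h' c) <= Cmod (h' c) / 2) ->
  forall w, Cmod (w - h c) < s * Cmod (h' c) / 2 -> exists z, Cmod (z - c) < s /\ h z = w.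
Proof.
  intros Hh Hc Hn w Hw. set (m := Cmod (h' c)) in *. assert (Hm : 0 < m) by (apply Cmod_gt_0; auto).
  set (T := fun z => (z - (h z - w) / h' c)%C).
  assert (HT : forall a b, Cmod (a - c) < s -> Cmod (b - c) < s -> Cmod (T b - T a) <= / 2 * Cmod (b - a)).
  { intros a b Ha Hb.
    assert (K : Cmod (h b - h a - h' c * (b - a)) <= m / 2 * Cmod (b - a)).
    { apply (Cmvt_lin h h'); intros t Ht; [apply Hh|apply Hn]; apply Cseg_ball; auto. }
    replace (T b - T a)%C with (- ((h b - h a - h' c * (b - a)) / h' c))%C by (unfold T; field; auto).
    rewrite Cmod_opp, Cmod_div by auto. fold m.
    apply Rmult_le_reg_r with m; auto. unfold Rdiv. rewrite Rmult_assoc, Rinv_l; lra. }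
  set (q := Cmod (w - h c) / m).
  assert (Hq : 2 * q < s).
  { unfold q. apply Rmult_lt_reg_r with m; auto. replace (2 * (Cmod (w - h c) / m) * m) with (2 * Cmod (w - h c)) by (field; lra). lra. }
  assert (Hq0 : 0 <= q) by (apply Rdiv_le_0_compat; auto; apply Cmod_ge_0).
  set (z := fix z n := match n with O => c | S k => T (z k) end).
  assert (Z1 : Cmod (z 1%nat - z 0%nat) = q).
  { simpl. unfold T. replace (c - (h c - w) / h' c - c)%C with ((w - h c) / h' c)%C by (field; auto). apply Cmod_div; auto. }
  assert (Inv : forall n, Cmod (z n - c) <= 2 * q - 2 * q / 2 ^ n /\ Cmod (z (S n) - z n) <= q / 2 ^ n).
  { induction n.
    - split. simpl. rewrite Cmod_minus_diag. lra. rewrite Z1. simpl. lra.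
    - destruct IHn as [I1 I2]. assert (hp := pow2_gt0 n).
      assert (e1 : 2 * q / 2 ^ S n = q / 2 ^ n) by (simpl; field; lra).
      assert (e2 : q / 2 ^ S n = / 2 * (q / 2 ^ n)) by (simpl; field; lra).
      assert (e3 : 2 * q / 2 ^ n = 2 * (q / 2 ^ n)) by (field; lra).
      assert (p : 0 <= q / 2 ^ n) by (apply Rdiv_le_0_compat; auto).
      assert (I3 : Cmod (z (S n) - c) <= 2 * q - 2 * q / 2 ^ S n).
      { eapply Rle_trans. apply (Cmod_tri3 _ (z n)). lra. }
      split. auto. change (z (S (S n))) with (T (z (S n))). change (z (S n)) with (T (z n)) at 2.
      eapply Rle_trans. apply HT; lra. rewrite e2. lra. }
  destruct (Cseq_geom_lim z q) as [l Hl]. intros n; apply Inv.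
  assert (Hlc : Cmod (l - c) < s).
  { destruct (pow2_small (4 * q) (s - 2 * q) ltac:(lra)) as [n Hn'].
    assert (T3 := Cmod_tri3 l (z n) c). rewrite (Cmod_sym l (z n)) in T3. specialize (Hl n). destruct (Inv n) as [I1 _].
    assert (0 <= 2 * q / 2 ^ n) by (apply Rdiv_le_0_compat; [lra|apply pow2_gt0]). lra. }
  exists l. split; auto.
  assert (Fix : T l = l).
  { apply Cmod_minus_eq0. apply Rle_antisym. 2: apply Cmod_ge_0. apply le_epsilon. intros e He. rewrite Rplus_0_l.
    destruct (pow2_small (8 * q) e He) as [n Hn'].
    assert (T3 := Cmod_tri3 (T l) (T (z n)) l).
    assert (A1 := HT (z n) l). change (T (z n)) with (z (S n)) in *.
    assert (I1 : Cmod (z n - c) < s).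
    { destruct (Inv n) as [I1 _]. assert (0 <= 2 * q / 2 ^ n) by (apply Rdiv_le_0_compat; [lra|apply pow2_gt0]). lra. }
    specialize (A1 I1 Hlc). rewrite (Cmod_sym l (z n)) in A1. assert (L1 := Hl n). assert (L2 := Hl (S n)).
    assert (hp := pow2_gt0 n).
    assert (e1 : 4 * q / 2 ^ S n = / 2 * (4 * q / 2 ^ n)) by (simpl; field; lra).
    assert (e2 : 8 * q / 2 ^ n = 2 * (4 * q / 2 ^ n)) by (simpl; field; lra).
    assert (0 <= 4 * q / 2 ^ n) by (apply Rdiv_le_0_compat; lra). lra. }
  unfold T in Fix. assert (E : ((h l - w) / h' c)%C = 0).
  { replace ((h l - w) / h' c)%C with (l - (l - (h l - w) / h' c))%C by ring. rewrite Fix. ring. }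
  apply Cmod_minus_eq0. replace (h l - w)%C with ((h l - w) / h' c * h' c)%C by (field; auto). rewrite E.
  rewrite Cmod_mult, Cmod_0. ring.
Qed.

(** The weight [R / 2 - Cmod (z - c)] in [phi] tames the derivative. At a point [z1] where [phi]
    exceeds half of its supremum, [h'] is at most [4 * a] on the disc of radius [rho], so [h] is
    nearly linear on a smaller disc and covers a disc about [h z1]. Half of the supremum suffices,
    so that no maximum need be attained. *)
Lemma bloch (h h' : C -> C) (c : C) (R : R) : 0 < R -> Dholo h h' c R ->
  exists z1, Cmod (z1 - c) < R /\
    forall w, Cmod (w - h z1) < R * Cmod (h' c) / 1024 -> exists z, Cmod (z - c) < R /\ h z = w.
Proof.
  intros HR Hh.
  destruct (deriv_bounded_disc h h' c R (R/2) ltac:(lra) Hh) as [M HM].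
  set (phi := fun z => (R / 2 - Cmod (z - c)) * Cmod (h' z)).
  destruct (Cmod_ge_0 (h' c)) as [Hc|Hc].
  2:{ exists c. split. rewrite Cmod_minus_diag; auto. intros w Hw. rewrite <- Hc in Hw. assert (h0 := Cmod_ge_0 (w - h c)). lra. }
  assert (Pc : phi c = R / 2 * Cmod (h' c)) by (unfold phi; rewrite Cmod_minus_diag; ring).
  destruct (completeness (fun y => exists z, Cmod (z - c) <= R / 2 /\ y = phi z)) as [m [Hm1 Hm2]].
  { exists (R / 2 * M). intros y [z [Hz ->]]. unfold phi. apply Rmult_le_compat; try apply Cmod_ge_0; auto. lra.
    assert (h0 := Cmod_ge_0 (z - c)). lra. }
  { exists (phi c), c. split; auto. rewrite Cmod_minus_diag. lra. }
  assert (Hpc : 0 < phi c) by (rewrite Pc; nra).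
  assert (Hmc : phi c <= m). { apply Hm1. exists c. split; auto. rewrite Cmod_minus_diag. lra. }
  destruct (classic (exists z, Cmod (z - c) <= R / 2 /\ m / 2 < phi z)) as [[z1 [Hz1 Hp1]]|Hno].
  2:{ exfalso. assert (m <= m / 2). 2: lra. apply Hm2. intros y [z [Hz ->]]. apply Rnot_lt_le. intros Hlt. apply Hno. eauto. }
  exists z1. split. lra.
  set (rho := (R / 2 - Cmod (z1 - c)) / 2). set (a := Cmod (h' z1)) in *.
  assert (Ha0 : 0 <= a) by apply Cmod_ge_0.
  assert (Ep : phi z1 = 2 * rho * a) by (unfold phi, rho, a; field).
  assert (Hrho : 0 < rho).
  { assert (0 <= rho) by (unfold rho; lra). destruct H as [H|H]; auto. rewrite <- H in Ep. lra. }
  assert (Ha : 0 < a). { destruct Ha0 as [H|H]; auto. rewrite <- H in Ep. lra. }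
  assert (Hb : forall z, Cmod (z - z1) < rho -> Cmod (h' z) <= 4 * a).
  { intros z Hz. assert (T := Cmod_tri3 z z1 c).
    assert (H : phi z <= m). { apply Hm1. exists z. split; auto. unfold rho in Hz. lra. }
    unfold phi in H. assert (rho <= R / 2 - Cmod (z - c)) by (unfold rho in *; lra).
    assert (h0 := Cmod_ge_0 (h' z)).
    apply Rmult_le_reg_l with rho; auto. nra. }
  (* The radius [rho / 64] turns the Lipschitz constant [8 * (4 * a) / rho] into half of [a]. The
     covered radius is then [rho * a / 128], and [rho * a] exceeds [R * Cmod (h' c) / 8], whence
     1024. *)
  assert (Hlip : forall z, Cmod (z - z1) < rho / 64 -> Cmod (h' z - h' z1) <= Cmod (h' z1) / 2).
  { intros z Hz. eapply Rle_trans. apply (deriv_lipschitz h h' z1 z z1 rho (4 * a)); auto.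
    - apply Dholo_sub with c R; auto. unfold rho. lra.
    - lra.
    - rewrite Cmod_minus_diag. lra.
    - fold a. apply Rle_trans with (8 * (4 * a) / rho * (rho / 64)).
      apply Rmult_le_compat_l. apply Rdiv_le_0_compat; lra. lra. right. field. lra. }
  intros w Hw.
  destruct (near_linear_onto h h' z1 (rho / 64)) with (w := w) as [z [Hz Ez]]; auto.
  - apply Dholo_sub with c R; auto. unfold rho. lra.
  - apply Cmod_gt_0. auto.
  - fold a. rewrite Pc in Hmc. lra.
  - exists z. split; auto. assert (T := Cmod_tri3 z z1 c). unfold rho in Hz. lra.
Qed.

(** * Lifting through regular values *)

(** Connectedness of the unit interval as a continuation principle; it drives uniqueness and
    continuation of lifts, the intermediate value theorem and connectedness of images. *)
Lemma real_induction (P : R -> Prop) : P 0 ->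
  (forall t, 0 <= t < 1 -> (forall s, 0 <= s <= t -> P s) -> exists d, 0 < d /\ forall s, t < s < t + d -> s <= 1 -> P s) ->
  (forall t, 0 < t <= 1 -> (forall s, 0 <= s < t -> P s) -> P t) ->
  forall t, 0 <= t <= 1 -> P t.
Proof.
  intros H0 Hs Hl.
  set (E := fun t => 0 <= t <= 1 /\ forall s, 0 <= s <= t -> P s).
  assert (E0 : E 0). { split. lra. intros s Hs'. replace s with 0 by lra. auto. }
  destruct (completeness E) as [m [Hm1 Hm2]].
  { exists 1. intros t [Ht _]. lra. }
  { exists 0. auto. }
  assert (M0 : 0 <= m) by (apply Hm1; auto).
  assert (M1 : m <= 1) by (apply Hm2; intros t [Ht _]; lra).
  assert (Below : forall s, 0 <= s < m -> P s).
  { intros s Hs'. apply NNPP. intros Hn. assert (m <= s). 2: lra.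
    apply Hm2. intros t [Ht Hp]. apply Rnot_lt_le. intros Hlt. apply Hn, Hp. lra. }
  assert (Pm : P m). { destruct M0 as [M0|M0]. apply Hl; auto; lra. rewrite <- M0; auto. }
  assert (Em : forall s, 0 <= s <= m -> P s). { intros s [h1 [h2|h2]]. apply Below; lra. rewrite h2; auto. }
  destruct M1 as [M1|M1].
  - destruct (Hs m ltac:(lra) Em) as [d [Hd HP]].
    exfalso. set (t := Rmin 1 (m + d / 2)).
    assert (m < t /\ t <= 1 /\ t <= m + d / 2) by (unfold t, Rmin; destruct Rle_dec; lra).
    assert (t <= m). 2: lra. apply Hm1. split. lra. intros s Hs'.
    destruct (Rle_lt_dec s m). apply Em; lra. apply HP; lra.
  - subst m. auto.
Qed.

Section Lifting.
Variables (f f' : C -> C).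
Hypothesis Hf : forall z, Cder f z (f' z).

Lemma near_linear_radius (z0 : C) : f' z0 <> 0 -> exists s, 0 < s /\
  forall z, Cmod (z - z0) < s -> Cmod (f' z - f' z0) <= Cmod (f' z0) / 2.
Proof.
  intros H. assert (Hm := proj1 (Cmod_gt_0 _) H).
  destruct (deriv_cont f f' z0 1 Rlt_0_1) with (e := Cmod (f' z0) / 2) as [s [Hs HS]].
  intros w _; auto. lra. exists s. split; auto. intros z Hz. left; auto.
Qed.

Lemma local_inj (z0 : C) : f' z0 <> 0 -> exists s, 0 < s /\
  forall a b, Cmod (a - z0) < s -> Cmod (b - z0) < s -> f a = f b -> a = b.
Proof.
  intros H. destruct (near_linear_radius z0 H) as [s [Hs HS]]. exists s. split; auto.
  intros a b Ha Hb E. assert (Hm := proj1 (Cmod_gt_0 _) H).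
  assert (K := near_linear_expand f f' z0 s ltac:(intros w _; auto) HS a b Ha Hb).
  rewrite E, Cmod_minus_diag in K. symmetry. apply Cmod_minus_eq0. assert (h := Cmod_ge_0 (b - a)). nra.
Qed.

Lemma local_inverse (z0 : C) : f' z0 <> 0 -> exists s eta g, 0 < s /\ 0 < eta /\
  (forall a b, Cmod (a - z0) < s -> Cmod (b - z0) < s -> f a = f b -> a = b) /\
  (forall w, Cmod (w - f z0) < eta -> Cmod (g w - z0) < s /\ f (g w) = w /\ Ccont g w).
Proof.
  intros H. destruct (near_linear_radius z0 H) as [s [Hs HS]].
  assert (Hm := proj1 (Cmod_gt_0 _) H). set (m := Cmod (f' z0)) in *.
  assert (Hd : Dholo f f' z0 s) by (intros w _; auto).
  assert (Ex : forall w, exists z, Cmod (w - f z0) < s * m / 2 -> Cmod (z - z0) < s /\ f z = w).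
  { intros w. destruct (Rlt_le_dec (Cmod (w - f z0)) (s * m / 2)) as [h|h].
    destruct (near_linear_onto f f' z0 s Hd H HS w h) as [z Hz]. exists z; auto.
    exists 0. intros; lra. }
  destruct (choice _ Ex) as [g Hg].
  exists s, (s * m / 2), g. split; auto. split. nra. split.
  - intros a b Ha Hb E. 
    assert (K := near_linear_expand f f' z0 s Hd HS a b Ha Hb). fold m in K.
    rewrite E, Cmod_minus_diag in K. symmetry. apply Cmod_minus_eq0. assert (h := Cmod_ge_0 (b - a)). nra.
  - intros w Hw. destruct (Hg w Hw) as [G1 G2]. split; auto. split; auto.
    intros e He. set (d := s * m / 2 - Cmod (w - f z0)).
    exists (Rmin d (m / 2 * e)). split. apply Rmin_pos. unfold d; lra. nra.
    intros w' Hw'. destruct (Rmin_Rgt_l _ _ _ Hw') as [h1 h2].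
    destruct (Hg w') as [G3 G4]. { assert (T := Cmod_tri3 w' w (f z0)). unfold d in h1. lra. }
    assert (K := near_linear_expand f f' z0 s Hd HS (g w) (g w') G1 G3). rewrite G2, G4 in K. fold m in K.
    apply Rmult_lt_reg_l with (m / 2); lra.
Qed.

Lemma path_lift_unique (G1 G2 : R -> C) :
  (forall t, 0 <= t <= 1 -> Pcont G1 t) -> (forall t, 0 <= t <= 1 -> Pcont G2 t) ->
  (forall t, 0 <= t <= 1 -> f (G1 t) = f (G2 t)) -> (forall t, 0 <= t <= 1 -> f' (G1 t) <> 0) ->
  G1 0 = G2 0 -> forall t, 0 <= t <= 1 -> G1 t = G2 t.
Proof.
  intros C1 C2 E N E0. apply real_induction; auto.
  - intros t Ht Hs. assert (Et := Hs t ltac:(lra)).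
    destruct (local_inj (G1 t)) as [s [Hsp Hinj]]. apply N; lra.
    destruct (C1 t ltac:(lra) s Hsp) as [d1 [Hd1 H1]].
    destruct (C2 t ltac:(lra) s Hsp) as [d2 [Hd2 H2]]. rewrite <- Et in H2.
    exists (Rmin d1 d2). split. apply Rmin_pos; auto.
    intros x Hx Hx1. apply Hinj. apply H1. rewrite Rabs_pos_eq by lra. assert (h := Rmin_l d1 d2). lra.
    apply H2. rewrite Rabs_pos_eq by lra. assert (h := Rmin_r d1 d2). lra. apply E. lra.
  - intros t Ht Hs. apply Cmod_minus_eq0. apply Rle_antisym. 2: apply Cmod_ge_0.
    apply le_epsilon. intros e He. rewrite Rplus_0_l.
    destruct (C1 t ltac:(lra) (e/2) ltac:(lra)) as [d1 [Hd1 H1]].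
    destruct (C2 t ltac:(lra) (e/2) ltac:(lra)) as [d2 [Hd2 H2]].
    set (x := Rmax 0 (t - Rmin d1 d2 / 2)).
    assert (Hm : 0 < Rmin d1 d2) by (apply Rmin_pos; auto). assert (h1 := Rmin_l d1 d2). assert (h2 := Rmin_r d1 d2).
    assert (Hx : 0 <= x /\ x < t /\ t - Rmin d1 d2 / 2 <= x).
    { unfold x, Rmax. destruct Rle_dec; lra. }
    specialize (H1 x). specialize (H2 x). rewrite Rabs_left in H1, H2 by lra.
    specialize (H1 ltac:(lra)). specialize (H2 ltac:(lra)).
    rewrite <- (Hs x) in H2 by lra. assert (T := Cmod_tri3 (G1 t) (G1 x) (G2 t)). rewrite (Cmod_sym (G1 t) (G1 x)) in T. lra.
Qed.

Definition regular_value (w : C) : Prop := (forall z, f z = w -> f' z <> 0) /\ ~ asymptotic_value f w.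

Lemma local_lift (p : C -> C) (u z : C) (d : R) : 0 < d -> (forall v, Cmod (v - u) < d -> Ccont p v) ->
  f z = p u -> f' z <> 0 -> exists s e g, 0 < s /\ 0 < e /\ e <= d /\
  (forall a b, Cmod (a - z) < s -> Cmod (b - z) < s -> f a = f b -> a = b) /\
  (forall v, Cmod (v - u) < e -> Cmod (g v - z) < s /\ f (g v) = p v /\ Ccont g v).
Proof.
  intros Hd Hp E N. destruct (local_inverse z N) as [s [eta [g [Hs [Heta [Hinj Hg]]]]]].
  destruct (Hp u) with (e := eta) as [e [He HE]]; auto. rewrite Cmod_minus_diag; auto.
  exists s, (Rmin d e), (fun v => g (p v)). split; auto. split. apply Rmin_pos; auto. split. apply Rmin_l. split; auto.
  intros v Hv. destruct (Rmin_Rgt_l _ _ _ Hv) as [h1 h2].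
  destruct (Hg (p v)) as [G1 [G2 G3]]. rewrite E. auto. split; auto. split; auto. apply Ccont_comp; auto.
Qed.

Lemma Pcont_seg (a b : C) (t : R) : Pcont (Cseg a b) t.
Proof.
  intros e He. exists (e / (Cmod (b - a) + 1)). assert (h := Cmod_ge_0 (b - a)).
  split. apply Rdiv_lt_0_compat; lra.
  intros s Hs. rewrite Cseg_diff, Cmod_mult, Cmod_R.
  apply Rle_lt_trans with (Rabs (s - t) * (Cmod (b - a) + 1)).
  apply Rmult_le_compat_l. apply Rabs_pos. lra.
  apply Rlt_le_trans with (e / (Cmod (b - a) + 1) * (Cmod (b - a) + 1)). apply Rmult_lt_compat_r; lra.
  right; field; lra.
Qed.

Lemma lift_unique_seg (g1 g2 : C -> C) (a b : C) :
  (forall t, 0 <= t <= 1 -> let v := Cseg a b t in Ccont g1 v /\ Ccont g2 v /\ f (g1 v) = f (g2 v) /\ f' (g1 v) <> 0) ->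
  g1 a = g2 a -> forall t, 0 <= t <= 1 -> g1 (Cseg a b t) = g2 (Cseg a b t).
Proof.
  intros H E. apply (path_lift_unique (fun t => g1 (Cseg a b t)) (fun t => g2 (Cseg a b t))).
  - intros t Ht. apply Pcont_comp. apply H; auto. apply Pcont_seg.
  - intros t Ht. apply Pcont_comp. apply H; auto. apply Pcont_seg.
  - intros t Ht. apply H; auto.
  - intros t Ht. apply H; auto.
  - rewrite Cseg_0; auto.
Qed.

Variables (V : C -> Prop) (p : C -> C) (u0 z0 : C).
Hypothesis Vconv : forall a b t, V a -> V b -> 0 <= t <= 1 -> V (Cseg a b t).
Hypothesis Vopen : forall u, V u -> exists e, 0 < e /\ forall v, Cmod (v - u) < e -> V v.
Hypothesis pcont : forall u, V u -> Ccont p u.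
Hypothesis preg : forall u, V u -> regular_value (p u).
Hypothesis Vu0 : V u0.
Hypothesis Hz0 : f z0 = p u0.

(** A lift is carried on a whole tube about the segment from [u0] to [u]. It then restricts to tubes
    about nearby segments, and this makes the value at the endpoint continuous in the endpoint. *)
Let tube (u : C) (d : R) (v : C) : Prop := exists t, 0 <= t <= 1 /\ Cmod (v - Cseg u0 u t) < d.
Let LT (u : C) (g : C -> C) (d : R) : Prop := 0 < d /\ g u0 = z0 /\
  forall v, tube u d v -> V v /\ f (g v) = p v /\ Ccont g v.

Lemma tube_seg u d t : 0 < d -> 0 <= t <= 1 -> tube u d (Cseg u0 u t).
Proof. intros Hd Ht. exists t. rewrite Cmod_minus_diag. auto. Qed.

Lemma LT_unique u g d g' d' : LT u g d -> LT u g' d' -> forall t, 0 <= t <= 1 -> g (Cseg u0 u t) = g' (Cseg u0 u t).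
Proof.
  intros [H1 [H2 H3]] [H1' [H2' H3']]. apply lift_unique_seg. 2: congruence.
  intros t Ht v. destruct (H3 v) as [A [B D]]. apply tube_seg; auto. destruct (H3' v) as [A' [B' D']]. apply tube_seg; auto.
  split; auto. split; auto. split. congruence. apply (preg v); auto.
Qed.

Lemma LT_near u g d u' : LT u g d -> Cmod (u' - u) < d / 2 -> LT u' g (d / 2).
Proof.
  intros [H1 [H2 H3]] Hu. split. lra. split; auto. intros v [t [Ht Hv]]. apply H3. exists t. split; auto.
  assert (T := Cmod_tri3 v (Cseg u0 u' t) (Cseg u0 u t)).
  replace (Cseg u0 u' t - Cseg u0 u t)%C with (RtoC t * (u' - u))%C in T by (unfold Cseg; ring).
  rewrite Cmod_mult, Cmod_R, Rabs_pos_eq in T by lra. assert (h := Cmod_ge_0 (u' - u)). nra.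
Qed.

Lemma LT_self u g d : LT u g d -> V u /\ f (g u) = p u /\ Ccont g u.
Proof.
  intros [H1 [H2 H3]]. apply H3. exists 1. split. lra. rewrite Cseg_1, Cmod_minus_diag; auto.
Qed.

Lemma LT_eq u g d g' d' : LT u g d -> LT u g' d' -> g u = g' u.
Proof. intros H H'. rewrite <- (Cseg_1 u0 u). apply (LT_unique u g d g' d'); auto. lra. Qed.

Lemma LT_base : exists g d, LT u0 g d.
Proof.
  destruct (Vopen u0 Vu0) as [r [Hr HV]].
  destruct (local_lift p u0 z0 r Hr) as [s [e [g [Hs [He [Her [Hinj Hg]]]]]]]; auto.
  apply (preg u0); auto.
  exists g, e. split; auto. destruct (Hg u0) as [G1 [G2 G3]]. rewrite Cmod_minus_diag; auto.
  split. apply Hinj; auto. rewrite Cmod_minus_diag; auto. congruence.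
  intros v [t [Ht Hv]]. rewrite Cseg_const in Hv. split. apply HV; lra. apply Hg; auto.
Qed.

(** Without a cluster point at 1 the path leaves every bounded set, because each point of a square
    has a neighbourhood that the path finally avoids and bisection makes this uniform. After a
    change of parameter it is then an asymptotic path for [w]. *)
Lemma path_clusters (G : R -> C) (w : C) (q : R -> C) :
  (forall s, 0 <= s < 1 -> forall e, 0 < e -> exists d, 0 < d /\ forall s', 0 <= s' -> Rabs (s' - s) < d -> Cmod (G s' - G s) < e) ->
  (forall s, 0 <= s < 1 -> f (G s) = q s) -> Pcont q 1 -> q 1 = w ->
  ~ asymptotic_value f w ->
  exists z, forall e d, 0 < e -> 0 < d -> exists s, 0 <= s < 1 /\ 1 - d < s /\ Cmod (G s - z) < e.
Proof.
  intros HG HE Hq Hw Has. apply NNPP. intros Hno. apply Has.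
  assert (Esc : forall M, exists d, 0 < d /\ forall s, 0 <= s < 1 -> 1 - d < s -> M < Cmod (G s)).
  { intros M.
    destruct (bisection (fun x1 x2 y1 y2 => exists d, 0 < d /\ forall s, 0 <= s < 1 -> 1 - d < s -> ~ (x1 <= fst (G s) <= x2 /\ y1 <= snd (G s) <= y2))
      (- Rabs M) (Rabs M) (- Rabs M) (Rabs M)) as [d [Hd HD]].
    - assert (h := Rabs_pos M). lra.
    - assert (h := Rabs_pos M). lra.
    - intros x1 x2 y1 y2 _ _ _ _ x y [d1 [P1 H1]] [d2 [P2 H2]] [d3 [P3 H3]] [d4 [P4 H4]].
      exists (Rmin (Rmin d1 d2) (Rmin d3 d4)). split. repeat apply Rmin_pos; auto.
      intros s Hs Hs' [Hx Hy].
      assert (1 - d1 < s /\ 1 - d2 < s /\ 1 - d3 < s /\ 1 - d4 < s) as [A1 [A2 [A3 A4]]].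
      { unfold Rmin in Hs'. repeat destruct Rle_dec; lra. }
      destruct (Rle_lt_dec (fst (G s)) x); destruct (Rle_lt_dec (snd (G s)) y).
      + apply (H1 s); auto; lra.
      + apply (H3 s); auto; lra.
      + apply (H2 s); auto; lra.
      + apply (H4 s); auto; lra.
    - intros x y Hx Hy. destruct (classic (exists e d, 0 < e /\ 0 < d /\ forall s, 0 <= s < 1 -> 1 - d < s -> e <= Cmod (G s - (x, y)))) as [[e [d [He [Hd H]]]]|Hn].
      + exists (e / 2). split. lra. intros n x1 x2 y1 y2 h1 h2 h3 h4 _ _ h5 h6. exists d. split; auto.
        intros s Hs Hs' [K1 K2]. specialize (H s Hs Hs').
        assert (Cmod ((fst (G s), snd (G s)) - (x, y)) < e) by (apply Cball_rect; apply Rabs_def1; lra).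
        rewrite <- surjective_pairing in H0. lra.
      + exfalso. apply Hno. exists (x, y). intros e d He Hd. apply NNPP. intros Hn'. apply Hn. exists e, d.
        split; auto. split; auto. intros s Hs Hs'. apply Rnot_lt_le. intros Hlt. apply Hn'. eauto.
    - exists d. split; auto. intros s Hs Hs'. apply Rnot_le_lt. intros Hle.
      apply (HD s Hs Hs'). assert (h1 := Rle_trans _ _ _ (re_le_Cmod (G s)) Hle). assert (h2 := Rle_trans _ _ _ (im_le_Cmod (G s)) Hle).
      assert (h3 := Rle_abs M). assert (h4 := Rabs_le_between (Re (G s)) M). assert (h5 := Rabs_le_between (Im (G s)) M).
      apply h4 in h1. apply h5 in h2. unfold Re, Im in *. lra. }
  (* This reparametrizes [[0, 1)] by [[0, infinity)]. *)
  set (phi := fun t => t / (1 + t)).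
  assert (Hphi : forall t, 0 <= t -> 0 <= phi t < 1 /\ 1 - phi t = / (1 + t)).
  { intros t Ht. assert (1 - phi t = / (1 + t)) by (unfold phi; field; lra).
    assert (0 < / (1 + t)) by (apply Rinv_0_lt_compat; lra).
    assert (0 <= phi t) by (apply Rdiv_le_0_compat; lra). lra. }
  assert (Hphi1 : forall d, 0 < d -> forall t, / d < t -> 1 - d < phi t).
  { intros d Hd t Ht. assert (0 < / d) by (apply Rinv_0_lt_compat; auto). destruct (Hphi t ltac:(lra)) as [_ E].
    assert (/ (1 + t) < d). 2: lra. rewrite <- (Rinv_inv d). apply Rinv_lt_contravar; nra. }
  (* Continuity at 0 is two-sided, whereas [G] is controlled for nonnegative parameters; the
     truncation keeps the parameter there. *)
  exists (fun t => G (Rmax 0 (phi t))). split; [|split].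
  - intros t Ht. apply Pcont_continuous. destruct (Hphi t Ht) as [H _].
    intros e He. destruct (HG (Rmax 0 (phi t))) with (e := e) as [d [Hd HD]]; auto.
    { unfold Rmax; destruct Rle_dec; lra. }
    assert (Cphi : continuous phi t).
    { apply (ex_derive_continuous (K := R_AbsRing) (V := R_NormedModule)). unfold phi. auto_derive. lra. }
    destruct (Cphi (ball (phi t) (mkposreal d Hd))) as [d' Hd']. { exists (mkposreal d Hd). auto. }
    exists d'. split. apply cond_pos. intros s Hs. apply HD. apply Rmax_l. specialize (Hd' s Hs).
    change (Rabs (phi s - phi t) < d) in Hd'.
    eapply Rle_lt_trans. 2: apply Hd'. unfold Rmax. repeat destruct Rle_dec; try lra; unfold Rabs; repeat destruct Rcase_abs; lra.
  - intros P [M HM]. destruct (Esc M) as [d [Hd HD]]. exists (/ d). intros t Ht. apply HM.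
    assert (0 < / d) by (apply Rinv_0_lt_compat; auto). destruct (Hphi t ltac:(lra)) as [H1 _].
    rewrite Rmax_right by lra. apply HD; auto.
  - intros P [e He]. destruct (Hq e (cond_pos e)) as [d [Hd HD]]. exists (/ d). intros t Ht. apply He.
    assert (0 < / d) by (apply Rinv_0_lt_compat; auto). destruct (Hphi t ltac:(lra)) as [H1 _].
    rewrite Rmax_right by lra. rewrite HE by auto. apply C_NormedModule_mixin_compat1. rewrite <- Hw. apply HD.
    assert (H2 := Hphi1 d Hd t Ht). rewrite Rabs_left; lra.
Qed.

(** A cluster point [z] of the endpoint values lies above [v], so a local lift [gs] through [z]
    exists on a disc about [v]. At some time [s] the path is inside the neighbourhood where [f] is
    injective, hence the lift along the shorter segment coincides with [gs] there, and the two are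
    glued. *)
Lemma LT_limit u t : V u -> 0 < t <= 1 -> (forall s, 0 <= s < t -> exists g d, LT (Cseg u0 u s) g d) ->
  exists g d, LT (Cseg u0 u t) g d.
Proof.
  intros Vu Ht H. set (v := Cseg u0 u t). assert (Vv : V v) by (apply Vconv; auto; lra).
  assert (Hv : forall s, 0 <= s < 1 -> exists gd, LT (Cseg u0 v s) (fst gd) (snd gd)).
  { intros s Hs. destruct (H (t * s)) as [g [d Hg]]. nra. exists (g, d). simpl.
    replace (Cseg u0 v s) with (Cseg u0 u (t * s)); auto. unfold v, Cseg. rewrite RtoC_mult. ring. }
  assert (Hv' : forall s, exists gd, 0 <= s < 1 -> LT (Cseg u0 v s) (fst gd) (snd gd)).
  { intros s. destruct (Rle_lt_dec 0 s). destruct (Rlt_le_dec s 1). destruct (Hv s) as [gd Hgd]; auto. exists gd; auto.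
    exists ((fun z => z), 0). intros; lra. exists ((fun z => z), 0). intros; lra. }
  destruct (choice _ Hv') as [gd Hgd]. clear Hv Hv'.
  set (g := fun s => fst (gd s)). set (d := fun s => snd (gd s)).
  assert (Hg : forall s, 0 <= s < 1 -> LT (Cseg u0 v s) (g s) (d s)) by exact Hgd. clear Hgd.
  set (G := fun s => g s (Cseg u0 v s)).
  assert (GL : forall s s', 0 <= s < 1 -> 0 <= s' < 1 -> Cmod (Cseg u0 v s' - Cseg u0 v s) < d s / 2 -> G s' = g s (Cseg u0 v s')).
  { intros s s' Hs Hs' Hd. apply LT_eq with (d s') (d s / 2). apply Hg; auto. apply LT_near with (Cseg u0 v s); auto. }
  destruct (path_clusters G (p v) (fun s => p (Cseg u0 v s))) as [z Hz].
  - intros s Hs e He. destruct (Hg s Hs) as [D1 _].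
    destruct (LT_self _ _ _ (Hg s Hs)) as [_ [_ Cg]].
    destruct (Pcont_comp (g s) (Cseg u0 v) s Cg (Pcont_seg _ _ _) e He) as [d1 [Hd1 H1]].
    destruct (Pcont_seg u0 v s (d s / 2) ltac:(lra)) as [d2 [Hd2 H2]].
    exists (Rmin (Rmin d1 d2) (1 - s)). split. repeat apply Rmin_pos; lra.
    intros s' Hs0 Hs'. assert (A : Rabs (s' - s) < d1 /\ Rabs (s' - s) < d2 /\ Rabs (s' - s) < 1 - s).
    { unfold Rmin in Hs'. repeat destruct Rle_dec; lra. }
    destruct A as [A1 [A2 A3]]. apply Rabs_def2 in A3.
    assert (Hs1 : 0 <= s' < 1) by lra. rewrite (GL s s' Hs Hs1 (H2 _ A2)). apply H1; auto.
  - intros s Hs. apply (LT_self _ _ _ (Hg s Hs)).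
  - apply Pcont_comp. apply pcont. rewrite Cseg_1; auto. apply Pcont_seg.
  - rewrite Cseg_1; auto.
  - apply (preg v); auto.
  - assert (Fz : f z = p v).
    { apply Cmod_minus_eq0. apply Rle_antisym. 2: apply Cmod_ge_0. apply le_epsilon. intros e He. rewrite Rplus_0_l.
      destruct (Cder_cont _ _ _ (Hf z) (e/2) ltac:(lra)) as [d1 [Hd1 H1]].
      destruct (pcont v Vv (e/2) ltac:(lra)) as [d2 [Hd2 H2]].
      destruct (Pcont_seg u0 v 1 d2 Hd2) as [d3 [Hd3 H3]]. rewrite Cseg_1 in H3.
      destruct (Hz d1 d3 Hd1 Hd3) as [s [Hs [Hs1 Hs2]]].
      specialize (H3 s). rewrite Rabs_left in H3 by lra. specialize (H2 _ (H3 ltac:(lra))).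
      specialize (H1 _ Hs2). replace (f (G s)) with (p (Cseg u0 v s)) in H1.
      2:{ symmetry. apply (LT_self _ _ _ (Hg s Hs)). }
      assert (T := Cmod_tri3 (f z) (p (Cseg u0 v s)) (p v)). rewrite (Cmod_sym (f z) (p (Cseg u0 v s))) in T. lra. }
    destruct (Vopen v Vv) as [r [Hr HVr]].
    destruct (local_lift p v z r Hr) as [sg [e [gs [Hsg [He [Her [Hinj Hgs]]]]]]]; auto.
    { apply (preg v); auto. }
    destruct (Pcont_seg u0 v 1 (e/2) ltac:(lra)) as [d3 [Hd3 H3]]. rewrite Cseg_1 in H3.
    destruct (Hz sg d3 Hsg Hd3) as [s [Hs [Hs1 Hs2]]].
    specialize (H3 s). rewrite Rabs_left in H3 by lra. specialize (H3 ltac:(lra)).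
    set (us := Cseg u0 v s) in *. destruct (Hg s Hs) as [D1 [D2 D3]]. fold us in D3.
    destruct (LT_self _ _ _ (Hg s Hs)) as [_ [Fs _]]. fold us in Fs.
    assert (Es : g s us = gs us).
    { destruct (Hgs us) as [K1 [K2 K3]]. lra. apply Hinj; auto. congruence. }
    assert (Tus : tube us (d s) us) by (exists 1; rewrite Cseg_1, Cmod_minus_diag; split; [lra|auto]).
    (* Disc and tube about a segment are both star-shaped with respect to [us], so uniqueness along
       the segment from [us] to [w] applies inside both. *)
    assert (Agree : forall w, tube us (d s) w -> Cmod (w - v) < e -> g s w = gs w).
    { intros w Hw1 Hw2. rewrite <- (Cseg_1 us w). apply lift_unique_seg; auto. 2: lra.
      intros t' Ht' w'. assert (B1 : Cmod (w' - v) < e) by (apply Cseg_ball; auto; lra).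
      assert (B2 : tube us (d s) w').
      { destruct Hw1 as [r1 [R1 R2]]. exists (1 - t' + t' * r1). split. nra.
        replace (w' - Cseg u0 us (1 - t' + t' * r1))%C with (RtoC t' * (w - Cseg u0 us r1))%C.
        rewrite Cmod_mult, Cmod_R, Rabs_pos_eq by lra. assert (h := Cmod_ge_0 (w - Cseg u0 us r1)). nra.
        unfold w', Cseg. rewrite RtoC_plus, RtoC_minus, RtoC_mult. ring. }
      destruct (D3 w' B2) as [L1 [L2 L3]]. destruct (Hgs w' B1) as [M1 [M2 M3]].
      split; auto. split; auto. split. congruence. apply (preg w'); auto. }
    set (gn := fun w => if Rlt_dec (Cmod (w - v)) e then gs w else g s w).
    assert (TO : forall w, tube us (d s) w -> exists k, 0 < k /\ forall w', Cmod (w' - w) < k -> tube us (d s) w').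
    { intros w [r1 [R1 R2]]. exists (d s - Cmod (w - Cseg u0 us r1)). split. lra.
      intros w' Hw'. exists r1. split; auto. assert (T := Cmod_tri3 w' w (Cseg u0 us r1)). lra. }
    exists gn, (Rmin (d s) (e / 2)).
    assert (Hdn : 0 < Rmin (d s) (e / 2)) by (apply Rmin_pos; lra).
    assert (Gtube : forall w, tube us (d s) w -> gn w = g s w).
    { intros w Hw. unfold gn. destruct Rlt_dec; auto. symmetry; auto. }
    split; auto. split. rewrite Gtube; auto. exists 0. rewrite Cseg_0, Cmod_minus_diag. split; [lra|auto].
    intros w [r1 [R1 R2]].
    destruct (Rlt_dec (Cmod (w - v)) e) as [h|h].
    + destruct (Hgs w h) as [M1 [M2 M3]].
      assert (gn w = gs w) by (unfold gn; destruct Rlt_dec; auto; lra).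
      split. apply HVr; lra. split. congruence.
      apply Ccont_ext_loc with gs (e - Cmod (w - v)); auto. lra.
      intros w' Hw'. unfold gn. destruct Rlt_dec; auto. assert (T := Cmod_tri3 w' w v). lra.
    + assert (Tw : tube us (d s) w).
      { destruct (Rle_lt_dec r1 s) as [h1|h1].
        - destruct (Rle_lt_dec s 0) as [h2|h2].
          + exists 0. split. lra. replace (Cseg u0 us 0) with (Cseg u0 v r1). assert (h3 := Rmin_l (d s) (e / 2)). lra.
            replace r1 with 0 by lra. rewrite !Cseg_0. auto.
          + exists (r1 / s). split. split. apply Rdiv_le_0_compat; lra. apply Rmult_le_reg_r with s; auto. unfold Rdiv. rewrite Rmult_assoc, Rinv_l; lra.
            replace (Cseg u0 us (r1 / s)) with (Cseg u0 v r1). assert (h3 := Rmin_l (d s) (e / 2)). lra.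
            unfold us, Cseg. replace r1 with (r1 / s * s) at 1 by (field; lra). rewrite RtoC_mult. ring.
        (* Beyond the parameter [s] the segment stays within [e / 2] of [v], so a point of the thin
           tube there would lie in the disc. *)
        - exfalso. apply h. assert (T := Cmod_tri3 w (Cseg u0 v r1) v).
          assert (Cmod (Cseg u0 v r1 - v) <= Cmod (us - v)).
          { replace (Cseg u0 v r1 - v)%C with (RtoC (1 - r1) * (u0 - v))%C by (unfold Cseg; rewrite RtoC_minus; ring).
            replace (us - v)%C with (RtoC (1 - s) * (u0 - v))%C by (unfold us, Cseg; rewrite RtoC_minus; ring).
            rewrite !Cmod_mult, !Cmod_R, !Rabs_pos_eq by lra. apply Rmult_le_compat_r. apply Cmod_ge_0. lra. }
          assert (h3 := Rmin_r (d s) (e / 2)). lra. }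
      destruct (D3 w Tw) as [L1 [L2 L3]]. destruct (TO w Tw) as [k [Hk HK]].
      split; auto. split. rewrite Gtube; auto. apply Ccont_ext_loc with (g s) k; auto.
      intros w' Hw'. symmetry. apply Gtube; auto.
Qed.

Lemma LT_all u : V u -> exists g d, LT u g d.
Proof.
  intros Vu. rewrite <- (Cseg_1 u0 u).
  apply (real_induction (fun t => exists g d, LT (Cseg u0 u t) g d)); try lra.
  - rewrite Cseg_0. apply LT_base.
  - intros t Ht Hs. destruct (Hs t ltac:(lra)) as [g [d Hg]]. assert (D := proj1 Hg).
    destruct (Pcont_seg u0 u t (d / 2) ltac:(lra)) as [e [He HE]].
    exists e. split; auto. intros s Hs1 _. exists g, (d / 2). apply LT_near with (Cseg u0 u t); auto.
    apply HE. rewrite Rabs_pos_eq; lra.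
  - intros t Ht Hs. apply LT_limit; auto.
Qed.

Theorem lifting : exists g, g u0 = z0 /\ forall u, V u -> f (g u) = p u /\ Ccont g u.
Proof.
  assert (H : forall u, exists gd, V u -> LT u (fst gd) (snd gd)).
  { intros u. destruct (classic (V u)) as [h|h]. destruct (LT_all u h) as [g [d Hg]]. exists (g, d); auto.
    exists ((fun z => z), 0). tauto. }
  destruct (choice _ H) as [gd Hgd]. exists (fun u => fst (gd u) u). split.
  apply (Hgd u0 Vu0).
  intros u Vu. destruct (LT_self _ _ _ (Hgd u Vu)) as [_ [E Cg]]. split; auto.
  assert (D := proj1 (Hgd u Vu)).
  destruct (Vopen u Vu) as [e [He HE]].
  apply Ccont_ext_loc with (fst (gd u)) (Rmin e (snd (gd u) / 2)); auto. apply Rmin_pos; lra.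
  intros w Hw. destruct (Rmin_Rgt_l _ _ _ Hw) as [h1 h2].
  apply LT_eq with (snd (gd u) / 2) (snd (gd w)). apply LT_near with u; auto. apply Hgd. auto.
Qed.
End Lifting.

(** * The exponential map *)

Lemma ivt01 (h : R -> R) (k : R) :
  (forall t, 0 <= t <= 1 -> forall e, 0 < e -> exists d, 0 < d /\ forall s, 0 <= s <= 1 -> Rabs (s - t) < d -> Rabs (h s - h t) < e) ->
  h 0 <= k <= h 1 -> exists t, 0 <= t <= 1 /\ h t = k.
Proof.
  intros Hc Hk. apply NNPP. intros Hno.
  assert (Hne : forall t, 0 <= t <= 1 -> h t <> k) by (intros t Ht E; apply Hno; eauto).
  assert (h 1 < k). 2: lra.
  apply (real_induction (fun t => h t < k)); try lra.
  - assert (h 0 <> k) by (apply Hne; lra). lra.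
  - intros t Ht Hs. assert (H := Hs t ltac:(lra)).
    destruct (Hc t ltac:(lra) (k - h t) ltac:(lra)) as [d [Hd HD]]. exists d. split; auto.
    intros s Hs1 Hs2. assert (H1 := HD s ltac:(lra) ltac:(rewrite Rabs_pos_eq; lra)). apply Rabs_def2 in H1. lra.
  - intros t Ht Hs. assert (N := Hne t ltac:(lra)).
    destruct (Rle_lt_dec (h t) k) as [H|H]. lra. exfalso.
    destruct (Hc t ltac:(lra) (h t - k) ltac:(lra)) as [d [Hd HD]].
    set (s := Rmax 0 (t - d / 2)).
    assert (0 <= s /\ s < t /\ t - d / 2 <= s) by (unfold s, Rmax; destruct Rle_dec; lra).
    assert (H1 := HD s ltac:(lra) ltac:(rewrite Rabs_left; lra)). apply Rabs_def2 in H1.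
    specialize (Hs s ltac:(lra)). lra.
Qed.

Lemma exp_le_mono (x y : R) : x <= y -> exp x <= exp y.
Proof. intros [H|H]. left; apply exp_increasing; auto. rewrite H; lra. Qed.

Lemma polar_unit (x y : R) : x * x + y * y = 1 -> exists th, cos th = x /\ sin th = y.
Proof.
  intros H. assert (Hx : -1 <= x <= 1) by nra.
  destruct (Rle_lt_dec 0 y) as [Hy|Hy].
  - exists (acos x). rewrite cos_acos, sin_acos by auto. split; auto.
    replace (1 - x²) with (Rsqr y) by (unfold Rsqr; lra). apply sqrt_Rsqr; auto.
  - exists (- acos x). rewrite cos_neg, sin_neg, cos_acos, sin_acos by auto. split; auto.
    replace (1 - x²) with (Rsqr (- y)) by (unfold Rsqr; lra). rewrite sqrt_Rsqr; lra.
Qed.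

Lemma Cexp_surj (w : C) : w <> 0 -> exists z, Cexp z = w /\ fst z = ln (Cmod w).
Proof.
  intros Hw. assert (Hm := proj1 (Cmod_gt_0 _) Hw). set (r := Cmod w) in *.
  assert (E := Cmod_sq w). fold r in E. destruct w as [a b]. simpl in E.
  destruct (polar_unit (a / r) (b / r)) as [th [H1 H2]].
  { replace (a / r * (a / r) + b / r * (b / r)) with ((a * a + b * b) / (r * r)) by (field; lra). rewrite <- E. field. lra. }
  exists (ln r, th). split; auto. unfold Cexp; simpl. rewrite exp_ln, H1, H2 by auto. f_equal; field; lra.
Qed.

Lemma Cexp_eq_1 (z : C) : Cexp z = 1 -> exists k : Z, z = (0, 2 * PI * IZR k).
Proof.
  intros H. assert (E := Cmod_Cexp z). rewrite H, Cmod_1 in E.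
  assert (Ez : fst z = 0). { rewrite <- (ln_exp (fst z)), <- E. apply ln_1. }
  destruct z as [x y]. simpl in *. subst x. unfold Cexp in H. simpl in H. rewrite exp_0 in H. injection H as H1 H2.
  rewrite Rmult_1_l in *.
  assert (H3 : sin (y / 2) = 0).
  { assert (h := cos_2a_sin (y / 2)). replace (2 * (y / 2)) with y in h by field. nra. }
  destruct (sin_eq_0_0 _ H3) as [k Hk]. exists k. f_equal. replace y with (2 * (y / 2)) by field. rewrite Hk. ring.
Qed.

Lemma Cexp_eq (z w : C) : Cexp z = Cexp w -> exists k : Z, z = (w + (0%R, (2 * PI * IZR k)%R))%C.
Proof.
  intros H. destruct (Cexp_eq_1 (z - w)) as [k Hk].
  { unfold Cminus. rewrite Cexp_plus, H. apply Cexp_neg. }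
  exists k. rewrite <- Hk. ring.
Qed.

Lemma Cexp_period (z : C) (k : Z) : Cexp (z + (0%R, (2 * PI * IZR k)%R))%C = Cexp z.
Proof.
  rewrite Cexp_plus. replace (Cexp (0, 2 * PI * IZR k)) with (RtoC 1). ring.
  unfold Cexp; simpl. rewrite exp_0, !Rmult_1_l.
  assert (Hs : sin (2 * PI * IZR k) = 0). { apply sin_eq_0_1. exists (2 * k)%Z. rewrite mult_IZR. ring. }
  rewrite Hs.
  replace (2 * PI * IZR k) with (2 * (IZR k * PI)) by ring. rewrite cos_2a_sin.
  replace (sin (IZR k * PI)) with 0. unfold RtoC. f_equal. ring.
  symmetry. apply sin_eq_0_1. exists k; auto.
Qed.

Lemma Cexp_opposite (a b : R) (y y' : R) : Rabs (y' - y) = PI ->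
  Cmod (Cexp (b, y') - Cexp (a, y)) = exp a + exp b.
Proof.
  intros H. assert (E : Cexp (b, y') = (- (RtoC (exp (b - a)) * Cexp (a, y)))%C).
  { assert (cos y' = - cos y /\ sin y' = - sin y) as [H1 H2].
    { unfold Rabs in H. destruct Rcase_abs.
      - replace y' with (- (PI - y)) by lra. rewrite cos_neg, sin_neg, Rtrigo_facts.cos_pi_minus, Rtrigo_facts.sin_pi_minus. auto.
      - replace y' with (y + PI) by lra. rewrite neg_cos, neg_sin. auto. }
    unfold Cexp, RtoC, Cmult, Copp; simpl. rewrite H1, H2.
    replace (exp b) with (exp (b - a) * exp a) by (rewrite <- exp_plus; f_equal; ring). f_equal; ring. }
  rewrite E. replace (- (RtoC (exp (b - a)) * Cexp (a, y)) - Cexp (a, y))%C with (- (RtoC (exp (b - a) + 1) * Cexp (a, y)))%C.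
  2:{ rewrite RtoC_plus. ring. }
  rewrite Cmod_opp, Cmod_mult, Cmod_R, Cmod_Cexp. assert (h := exp_pos (b - a)). simpl. rewrite Rabs_pos_eq by lra.
  replace (exp b) with (exp (b - a) * exp a) by (rewrite <- exp_plus; f_equal; ring). ring.
Qed.

(** Along a path to infinity on which [Cexp] tends to [w], the real part stays bounded, so the
    imaginary part is unbounded. By the intermediate value theorem it changes by exactly [PI]
    between two late times, where the values of [Cexp] lie on opposite rays and cannot both be close
    to [w]. *)
Lemma Cexp_regular (w : C) : w <> 0 -> regular_value Cexp Cexp w.
Proof.
  intros Hw. split. intros; apply Cexp_neq_0.
  intros [gam [Hc [Hinf Hlim]]].
  assert (Hm := proj1 (Cmod_gt_0 _) Hw). set (m := Cmod w) in *.
  assert (L1 : exists T, forall t, T < t -> Cmod (Cexp (gam t) - w) < m / 4).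
  { assert (Hp : 0 < m / 4 / sqrt 2) by (apply Rdiv_lt_0_compat; [lra|apply sqrt_lt_R0; lra]).
    destruct (Hlim (fun v => ball w (mkposreal _ Hp) v)) as [T HT]. { exists (mkposreal _ Hp). auto. }
    exists T. intros t Ht. specialize (HT t Ht). apply C_NormedModule_mixin_compat2 in HT. simpl in HT.
    replace (sqrt 2 * (m / 4 / sqrt 2)) with (m / 4) in HT by (field; apply Rgt_not_eq, sqrt_lt_R0; lra). exact HT. }
  destruct L1 as [T1 HT1].
  assert (L2 : forall M, exists T, forall t, T < t -> M < Cmod (gam t)).
  { intros M. destruct (Hinf (fun y => M < y)) as [T HT]. { exists M. auto. } exists T. auto. }
  assert (Bd : forall t, T1 < t -> 3 / 4 * m < exp (fst (gam t)) < 5 / 4 * m).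
  { intros t Ht. specialize (HT1 t Ht). rewrite <- Cmod_Cexp.
    assert (A := Cmod_tri_rev (Cexp (gam t)) w). assert (B := Cmod_tri_rev w (Cexp (gam t))).
    rewrite (Cmod_sym w (Cexp (gam t))) in B. fold m in A, B. lra. }
  assert (Bd2 : forall t, T1 < t -> Rabs (fst (gam t)) <= Rabs (ln (3 / 4 * m)) + Rabs (ln (5 / 4 * m))).
  { intros t Ht. destruct (Bd t Ht) as [h1 h2]. apply ln_increasing in h1; [|lra]. apply ln_increasing in h2; [|apply exp_pos].
    rewrite ln_exp in h1, h2. unfold Rabs. repeat destruct Rcase_abs; lra. }
  set (B := Rabs (ln (3 / 4 * m)) + Rabs (ln (5 / 4 * m))) in *.
  set (t1 := Rmax 0 T1 + 1). assert (0 < t1 /\ T1 < t1) as [P1 P2] by (unfold t1, Rmax; destruct Rle_dec; lra).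
  set (y1 := snd (gam t1)).
  destruct (L2 (B + Rabs y1 + PI)) as [T2 HT2].
  set (t2 := Rmax t1 T2 + 1). assert (t1 < t2 /\ T2 < t2) as [P3 P4] by (unfold t2, Rmax; destruct Rle_dec; lra).
  assert (Far : PI <= Rabs (snd (gam t2) - y1)).
  { specialize (HT2 t2 P4). specialize (Bd2 t2 ltac:(lra)). assert (h := Cmod_le_abs (fst (gam t2)) (snd (gam t2))).
    rewrite <- surjective_pairing in h. assert (h' := Rabs_triang_inv (snd (gam t2)) y1). lra. }
  destruct (ivt01 (fun s => Rabs (snd (gam (t1 + s * (t2 - t1))) - y1)) PI) as [s [Hs Es]].
  - intros t Ht e He. 
    assert (Ct : Pcont gam (t1 + t * (t2 - t1))) by (apply Pcont_continuous, Hc; nra).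
    destruct (Ct e He) as [d [Hd HD]].
    exists (d / (t2 - t1)). split. apply Rdiv_lt_0_compat; lra. intros s Hs Hst.
    eapply Rle_lt_trans. apply Rabs_triang_inv2.
    replace (snd (gam (t1 + s * (t2 - t1))) - y1 - (snd (gam (t1 + t * (t2 - t1))) - y1)) with
      (Im (gam (t1 + s * (t2 - t1)) - gam (t1 + t * (t2 - t1)))) by (simpl; ring).
    eapply Rle_lt_trans. apply im_le_Cmod. apply HD.
    replace (t1 + s * (t2 - t1) - (t1 + t * (t2 - t1))) with ((s - t) * (t2 - t1)) by ring.
    rewrite Rabs_mult, (Rabs_pos_eq (t2 - t1)) by lra.
    apply Rlt_le_trans with (d / (t2 - t1) * (t2 - t1)). apply Rmult_lt_compat_r; lra. right; field; lra.
  - replace (t1 + 0 * (t2 - t1)) with t1 by ring. replace (t1 + 1 * (t2 - t1)) with t2 by ring. fold y1.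
    rewrite Rminus_diag, Rabs_R0. assert (h := PI_RGT_0). lra.
  - simpl in Es. set (t := t1 + s * (t2 - t1)) in *. assert (T1 < t) by (unfold t; nra).
    assert (K := Cexp_opposite (fst (gam t1)) (fst (gam t)) y1 (snd (gam t)) Es).
    unfold y1 in K. rewrite <- !surjective_pairing in K.
    assert (T3 := Cmod_tri3 (Cexp (gam t)) w (Cexp (gam t1))). rewrite (Cmod_sym w (Cexp (gam t1))) in T3.
    assert (A1 := HT1 t H). assert (A2 := HT1 t1 P2). assert (A3 := Bd t H). assert (A4 := Bd t1 P2). lra.
Qed.

Lemma disc_open (c : C) (r : R) (u : C) : Cmod (u - c) < r -> exists e, 0 < e /\ forall v, Cmod (v - u) < e -> Cmod (v - c) < r.
Proof.
  intros H. exists (r - Cmod (u - c)). split. lra. intros v Hv. assert (T := Cmod_tri3 v u c). lra.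
Qed.

Lemma log_on_disc (h h' : C -> C) (c : C) (R : R) : 0 < R -> Dholo h h' c R ->
  (forall u, Cmod (u - c) < R -> h u <> 0) ->
  exists G, (forall u, Cmod (u - c) < R -> Cexp (G u) = h u) /\ Dholo G (fun u => h' u / h u)%C c R.
Proof.
  intros HR Hh Hn.
  assert (Hc : Cmod (c - c) < R) by (rewrite Cmod_minus_diag; auto).
  destruct (Cexp_surj (h c)) as [z0 [Hz0 _]]. auto.
  destruct (lifting Cexp Cexp Cder_Cexp (fun u => Cmod (u - c) < R) h c z0) as [G [_ HG]]; auto.
  - intros; apply Cseg_ball; auto.
  - intros; apply disc_open; auto.
  - intros u Hu. eapply Cder_cont. apply Hh; auto.
  - intros u Hu. apply Cexp_regular. auto.
  - exists G. split. intros; apply HG; auto.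
    intros u Hu. destruct (disc_open c R u Hu) as [e [He HE]].
    destruct (HG u Hu) as [E Cg]. rewrite <- E.
    apply (Cder_lift Cexp G h u (Cexp (G u)) (h' u) e); auto.
    intros; apply HG; auto. apply Cder_Cexp. apply Cexp_neq_0.
Qed.

(* A logarithm of an injective function has an image containing no two points at distance
   [2 PI] on a vertical line, hence no disc of radius larger than [PI]; Bloch's theorem then bounds its derivative. *)
Lemma log_deriv_bound (g g' : C -> C) (v c : C) (R : R) : 0 < R -> Dholo g g' c R ->
  (forall a b, Cmod (a - c) < R -> Cmod (b - c) < R -> g a = g b -> a = b) ->
  (forall u, Cmod (u - c) < R -> g u <> v) ->
  Cmod (g' c) * R <= 4096 * Cmod (g c - v).
Proof.
  intros HR Hg Hinj Hv.
  assert (Hc : Cmod (c - c) < R) by (rewrite Cmod_minus_diag; auto).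
  destruct (log_on_disc (fun u => g u - v)%C g' c R HR) as [G [EG DG]].
  - intros u Hu. replace (g' u) with (g' u - 0)%C by ring. apply Cder_minus. apply Hg; auto. apply Cder_const.
  - intros u Hu E. apply (Hv u Hu). apply Cmod_minus_eq0. rewrite E. apply Cmod_0.
  - assert (Hgv : 0 < Cmod (g c - v)) by (apply Cmod_minus_gt0; auto).
    assert (Hgv' : (g c - v)%C <> 0) by (apply Cmod_gt_0; auto).
    assert (Hpi := PI_RGT_0). assert (Hpi4 := PI_4).
    destruct (bloch _ _ c R HR DG) as [z1 [Hz1 HB]].
    rewrite Cmod_div in HB by auto.
    apply Rnot_lt_le. intros Hlt.
    assert (Hbig : PI < R * (Cmod (g' c) / Cmod (g c - v)) / 1024).
    { apply Rle_lt_trans with 4; auto. apply Rmult_lt_reg_r with (1024 * Cmod (g c - v)). lra.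
      replace (R * (Cmod (g' c) / Cmod (g c - v)) / 1024 * (1024 * Cmod (g c - v))) with (Cmod (g' c) * R) by (field; lra). lra. }
    assert (HI : Cmod (Ci * RtoC PI) = PI) by (rewrite Cmod_mult, Cmod_Ci, Cmod_R, Rabs_pos_eq; lra).
    destruct (HB (G z1 + Ci * RtoC PI)%C) as [a [Ha Ea]].
    { replace (G z1 + Ci * RtoC PI - G z1)%C with (Ci * RtoC PI)%C by ring. lra. }
    destruct (HB (G z1 - Ci * RtoC PI)%C) as [b [Hb Eb]].
    { replace (G z1 - Ci * RtoC PI - G z1)%C with (- (Ci * RtoC PI))%C by ring. rewrite Cmod_opp. lra. }
    assert (Eab : G a = (G b + (0%R, (2 * PI * IZR 1)%R))%C).
    { rewrite Ea, Eb. replace ((0, 2 * PI * 1) : C) with (Ci * RtoC PI + Ci * RtoC PI)%C. ring.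
      unfold Ci, RtoC, Cmult, Cplus; simpl; f_equal; ring. }
    assert (a = b).
    { apply Hinj; auto. replace (g a) with ((g a - v) + v)%C by ring. replace (g b) with ((g b - v) + v)%C by ring.
      rewrite <- EG, <- EG by auto. rewrite Eab, Cexp_period. reflexivity. }
    subst b. assert (E0 : Cmod (Ci * RtoC PI - - (Ci * RtoC PI)) = 0).
    { replace (Ci * RtoC PI - - (Ci * RtoC PI))%C with ((G z1 + Ci * RtoC PI) - (G z1 - Ci * RtoC PI))%C by ring.
      rewrite <- Ea, <- Eb. apply Cmod_minus_diag. }
    replace (Ci * RtoC PI - - (Ci * RtoC PI))%C with (RtoC 2 * (Ci * RtoC PI))%C in E0 by ring.
    rewrite Cmod_mult, HI, Cmod_R, Rabs_pos_eq in E0; lra.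
Qed.

(** With the preceding bound on discs of radius [R / 2], the logarithm [G] of [g - v] has derivative
    at most [8192 / R] on the half disc. Over a distance [R / 2] it changes by at most 4096, so
    [g - v] grows by a factor of at most [exp 4096]. The number 4096 is 4, an upper bound for [PI],
    times 1024 from [bloch]. *)
Lemma injective_omitting_bound (g g' : C -> C) (v c u : C) (R : R) : 0 < R -> Dholo g g' c R ->
  (forall a b, Cmod (a - c) < R -> Cmod (b - c) < R -> g a = g b -> a = b) ->
  (forall u, Cmod (u - c) < R -> g u <> v) -> Cmod (u - c) <= R / 2 ->
  Cmod (g' u) * R <= 8192 * exp 4096 * Cmod (g c - v).
Proof.
  intros HR Hg Hinj Hv Hu.
  assert (Loc : forall w, Cmod (w - c) <= R / 2 -> Cmod (g' w) * (R / 2) <= 4096 * Cmod (g w - v)).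
  { intros w Hw. apply log_deriv_bound with (g := g) (c := w); auto. lra.
    apply Dholo_sub with c R; auto. lra.
    - intros a b Ha Hb. apply Hinj. assert (T := Cmod_tri3 a w c); lra. assert (T := Cmod_tri3 b w c); lra.
    - intros a Ha. apply Hv. assert (T := Cmod_tri3 a w c); lra. }
  assert (Hc : Cmod (c - c) < R) by (rewrite Cmod_minus_diag; auto).
  destruct (log_on_disc (fun u => g u - v)%C g' c R HR) as [G [EG DG]].
  - intros w Hw. replace (g' w) with (g' w - 0)%C by ring. apply Cder_minus. apply Hg; auto. apply Cder_const.
  - intros w Hw E. apply (Hv w Hw). apply Cmod_minus_eq0. rewrite E. apply Cmod_0.
  - assert (LG : Cmod (G u - G c) <= 4096 * 2 / R * Cmod (u - c)).
    { assert (Sg : forall t, 0 <= t <= 1 -> Cmod (Cseg c u t - c) <= R / 2).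
      { intros t Ht. replace (Cseg c u t - c)%C with (RtoC t * (u - c))%C by (unfold Cseg; ring).
        rewrite Cmod_mult, Cmod_R, Rabs_pos_eq by lra. assert (h := Cmod_ge_0 (u - c)). nra. }
      apply (Cmvt G (fun u => g' u / (g u - v))%C).
      - intros t Ht. apply DG. specialize (Sg t Ht). lra.
      - intros t Ht. specialize (Sg t Ht). set (w := Cseg c u t) in *.
        assert (Hw : 0 < Cmod (g w - v)) by (apply Cmod_minus_gt0; apply Hv; lra).
        rewrite Cmod_div by (apply Cmod_gt_0; auto). apply Rmult_le_reg_r with (Cmod (g w - v) * (R / 2)). nra.
        replace (Cmod (g' w) / Cmod (g w - v) * (Cmod (g w - v) * (R / 2))) with (Cmod (g' w) * (R / 2)) by (field; lra).
        replace (4096 * 2 / R * (Cmod (g w - v) * (R / 2))) with (4096 * Cmod (g w - v)) by (field; lra). auto. }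
    assert (LG2 : Cmod (G u - G c) <= 4096).
    { eapply Rle_trans. apply LG. replace 4096 with (4096 * 2 / R * (R / 2)) at 2 by (field; lra).
      apply Rmult_le_compat_l; auto. apply Rdiv_le_0_compat; lra. }
    assert (Eu : Cmod (g u - v) <= exp 4096 * Cmod (g c - v)).
    { rewrite <- EG, <- EG by (auto; lra). rewrite !Cmod_Cexp, <- exp_plus.
      apply exp_le_mono. assert (h := Rle_trans _ _ _ (Rle_abs _) (re_le_Cmod (G u - G c))). simpl in h. lra. }
    specialize (Loc u Hu). lra.
Qed.

(** * Distortion *)

(* [8192 * exp 4096] from [injective_omitting_bound], times the [4] of [univ_lift_omits]. *)
Definition Kdist : R := 32768 * exp 4096.

Lemma Kdist_ge1 : 1 <= Kdist.
Proof. unfold Kdist. assert (1 <= exp 4096). { rewrite <- exp_0. apply exp_le_mono; lra. } lra. Qed.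

(* The oscillation clause ranges over all subdiscs so that the notion restricts to them. *)
Definition univ_lift (f f' g p p' : C -> C) (c : C) (R : R) : Prop :=
  0 < R /\ (forall u, Cmod (u - c) < R -> Cder p u (p' u) /\ p' u <> 0 /\ f (g u) = p u /\ Ccont g u /\ f' (g u) <> 0) /\
  (forall a b, Cmod (a - c) < R -> Cmod (b - c) < R -> p a = p b -> a = b) /\
  (forall w rho, 0 < rho -> Cmod (w - c) + rho <= R -> forall u, Cmod (u - w) < rho -> Cmod (p u - p w) <= 3 * rho * Cmod (p' w)).

Section Distortion.
Variables (f f' : C -> C).
Hypothesis Hf : forall z, Cder f z (f' z).

Lemma univ_lift_sub g p p' c R w rho : univ_lift f f' g p p' c R -> 0 < rho -> Cmod (w - c) + rho <= R ->
  univ_lift f f' g p p' w rho.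
Proof.
  intros [H1 [H2 [H3 H4]]] Hr Hw.
  assert (S : forall u, Cmod (u - w) < rho -> Cmod (u - c) < R) by (intros u Hu; assert (T := Cmod_tri3 u w c); lra).
  split; [|split;[|split]]; auto.
  intros w' r' Hr' Hw'. apply H4; auto. assert (T := Cmod_tri3 w' w c); lra.
Qed.

Lemma univ_lift_holo g p p' c R : univ_lift f f' g p p' c R -> Dholo g (fun u => p' u / f' (g u))%C c R.
Proof.
  intros [H1 [H2 [H3 H4]]] u Hu. destruct (disc_open c R u Hu) as [e [He HE]].
  destruct (H2 u Hu) as [A1 [A2 [A3 [A4 A5]]]].
  apply (Cder_lift f g p u (f' (g u)) (p' u) e); auto.
  intros w Hw. apply H2; auto.
Qed.

Lemma univ_lift_omits g p p' c R : univ_lift f f' g p p' c R ->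
  exists v, Cmod (v - g c) < 4 * R * Cmod (p' c / f' (g c)) /\ forall u, Cmod (u - c) < R -> g u <> v.
Proof.
  intros H. destruct (H) as [H1 [H2 [H3 H4]]].
  assert (Hc : Cmod (c - c) < R) by (rewrite Cmod_minus_diag; auto).
  destruct (H2 c Hc) as [A1 [A2 [A3 [A4 A5]]]].
  assert (P1 := proj1 (Cmod_gt_0 _) A2). assert (P2 := proj1 (Cmod_gt_0 _) A5).
  rewrite Cmod_div by auto. set (a := Cmod (p' c)) in *. set (b := Cmod (f' (g c))) in *.
  assert (Pab : 0 < a / b) by (apply Rdiv_lt_0_compat; auto).
  assert (PR : 0 < R * (a / b)) by (apply Rmult_lt_0_compat; auto).
  apply NNPP. intros Hno.
  assert (All : forall z, Cmod (z - g c) < 4 * R * (a / b) -> Cmod (f z - f (g c)) <= 3 * R * a).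
  { intros z Hz. apply NNPP. intros Hn. apply Hno. exists z. split; auto. intros u Hu E. apply Hn.
    rewrite <- E, A3. destruct (H2 u Hu) as [_ [_ [E' _]]]. rewrite E'. apply H4; auto. rewrite Cmod_minus_diag. lra. }
  (* A radius factor strictly between 3 and 4 is needed: it stays inside the disc of [All] and makes
     Cauchy's bound smaller than [b], here by [6 / 7]. *)
  assert (K : b <= 3 * R * a / (7 / 2 * (R * (a / b)))).
  { apply (cauchy_estimate f f' (g c) (4 * R * (a / b))). lra. intros w _; auto.
    intros E HE. apply All. replace (g c + E - g c)%C with E by ring. lra. }
  replace (3 * R * a / (7 / 2 * (R * (a / b)))) with (6 / 7 * b) in K by (field; lra). lra.
Qed.

Lemma distortion_upper g p p' c R u : univ_lift f f' g p p' c R -> Cmod (u - c) <= R / 2 ->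
  Cmod (p' u / f' (g u)) <= Kdist * Cmod (p' c / f' (g c)).
Proof.
  intros H Hu. destruct (univ_lift_omits _ _ _ _ _ H) as [v [Hv1 Hv2]].
  assert (D := univ_lift_holo _ _ _ _ _ H). destruct (H) as [H1 [H2 [H3 H4]]].
  assert (K := injective_omitting_bound g _ v c u R H1 D).
  simpl in K. set (A := Cmod (p' u / f' (g u))) in *. set (B := Cmod (p' c / f' (g c))) in *.
  assert (K' : A * R <= 8192 * exp 4096 * Cmod (g c - v)).
  { apply K; auto. intros a b Ha Hb E. apply H3; auto.
    destruct (H2 a Ha) as [_ [_ [E1 _]]]. destruct (H2 b Hb) as [_ [_ [E2 _]]]. congruence. }
  rewrite (Cmod_sym (g c) v) in K'. assert (he := exp_pos 4096).
  apply Rmult_le_reg_r with R; auto. eapply Rle_trans. apply K'.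
  unfold Kdist. apply Rle_trans with (8192 * exp 4096 * (4 * R * B)). apply Rmult_le_compat_l; lra. right; ring.
Qed.

(** The upper bound with the roles exchanged: [c] lies in the half disc of the disc of radius
    [R / 2] about [u]. *)
Lemma distortion_lower g p p' c R u : univ_lift f f' g p p' c R -> Cmod (u - c) <= R / 4 ->
  Cmod (p' c / f' (g c)) <= Kdist * Cmod (p' u / f' (g u)).
Proof.
  intros H Hu. assert (H1 := proj1 H). apply (distortion_upper g p p' u (R / 2) c).
  apply univ_lift_sub with c R; auto; lra. rewrite Cmod_sym. lra.
Qed.

Lemma univ_lift_covers g p p' c R z : univ_lift f f' g p p' c R ->
  Cmod (z - g c) < R * Cmod (p' c / f' (g c)) / (64 * Kdist) -> exists u, Cmod (u - c) < R /\ g u = z.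
Proof.
  intros H Hz. assert (D := univ_lift_holo _ _ _ _ _ H). destruct (H) as [H1 [H2 [H3 H4]]].
  assert (Hc : Cmod (c - c) < R) by (rewrite Cmod_minus_diag; auto).
  destruct (H2 c Hc) as [A1 [A2 [A3 [A4 A5]]]].
  assert (P1 := proj1 (Cmod_gt_0 _) A2). assert (P2 := proj1 (Cmod_gt_0 _) A5).
  assert (HK := Kdist_ge1).
  set (g' := fun u => (p' u / f' (g u))%C) in *.
  assert (Pg : 0 < Cmod (g' c)). { unfold g'. rewrite Cmod_div by auto. apply Rdiv_lt_0_compat; auto. }
  (* By distortion the derivative of [g] has Lipschitz constant [16 * Kdist * Cmod (g' c) / R] near
     [c], so on the disc of radius [s] it varies by at most half of [Cmod (g' c)], as
     [near_linear_onto] requires. *)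
  set (s := R / (32 * Kdist)).
  assert (Hs : 0 < s) by (apply Rdiv_lt_0_compat; lra).
  assert (Hs4 : s < R / 4).
  { unfold s. apply Rmult_lt_reg_r with (32 * Kdist). lra. replace (R / (32 * Kdist) * (32 * Kdist)) with R by (field; lra). nra. }
  destruct (near_linear_onto g g' c s) with (w := z) as [u [Hu Eu]].
  - apply Dholo_sub with c R; auto. rewrite Cmod_minus_diag. lra.
  - apply Cmod_gt_0; auto.
  - intros w Hw. eapply Rle_trans. apply (deriv_lipschitz g g' c w c (R / 2) (Kdist * Cmod (g' c))).
    + lra.
    + apply Dholo_sub with c R; auto. rewrite Cmod_minus_diag. lra.
    + intros x Hx. apply (distortion_upper g p p' c R x); auto. lra.
    + lra.
    + rewrite Cmod_minus_diag. lra.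
    + apply Rle_trans with (8 * (Kdist * Cmod (g' c)) / (R / 2) * s).
      apply Rmult_le_compat_l. apply Rdiv_le_0_compat; nra. lra.
      right. unfold s. field. lra.
  - eapply Rlt_le_trans. apply Hz. right. unfold s, g'. field. lra.
  - exists u. split; auto. lra.
Qed.

(** The segment is cut into steps of length at most [R / 4], each costing one factor [Kdist]. The
    same lift [g] serves all discs. In the induction the parameter shrinks by the proportion
    [1 / N], with [N] the number of steps left. *)
Lemma distortion_seg g p p' a b R : (forall t, 0 <= t <= 1 -> univ_lift f f' g p p' (Cseg a b t) R) ->
  forall n t, 0 <= t <= 1 -> t * Cmod (b - a) <= INR n * (R / 4) -> let v := Cseg a b t in
  Cmod (p' v / f' (g v)) <= Kdist ^ n * Cmod (p' a / f' (g a)) /\ Cmod (p' a / f' (g a)) <= Kdist ^ n * Cmod (p' v / f' (g v)).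
Proof.
  intros H. assert (HR : 0 < R) by (apply (H 0); lra). assert (HK := Kdist_ge1).
  induction n; intros t Ht Hn; cbv zeta.
  - simpl in Hn. rewrite Rmult_0_l in Hn. assert (E : Cseg a b t = a).
    { apply Cmod_minus_eq0. unfold Cseg. replace (a + RtoC t * (b - a) - a)%C with (RtoC t * (b - a))%C by ring.
      rewrite Cmod_mult, Cmod_R, Rabs_pos_eq by lra. assert (h := Cmod_ge_0 (b - a)). nra. }
    rewrite E. simpl. lra.
  - rewrite S_INR in Hn. assert (hn := pos_INR n). set (N := INR n + 1) in *.
    assert (hN : 0 < / N <= 1). { split. apply Rinv_0_lt_compat; unfold N; lra. rewrite <- Rinv_1. apply Rinv_le_contravar; unfold N; lra. }
    set (t' := t * (1 - / N)).
    assert (Ht' : 0 <= t' <= 1) by (unfold t'; nra).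
    assert (hb := Cmod_ge_0 (b - a)).
    assert (Htb : t * Cmod (b - a) * / N <= R / 4).
    { apply Rmult_le_reg_r with N. unfold N; lra. rewrite Rmult_assoc, Rinv_l by (unfold N; lra). lra. }
    assert (hb2 : t' * Cmod (b - a) <= INR n * (R / 4)).
    { unfold t'. replace (t * (1 - / N) * Cmod (b - a)) with (t * Cmod (b - a) * / N * INR n). nra.
      replace (INR n) with (N - 1) by (unfold N; ring). field. unfold N; lra. }
    destruct (IHn t' Ht' hb2) as [I1 I2]. cbv zeta in I1, I2.
    assert (D : Cmod (Cseg a b t - Cseg a b t') <= R / 4).
    { rewrite Cseg_diff, Cmod_mult, Cmod_R. replace (t - t') with (t * / N) by (unfold t'; ring).
      rewrite Rabs_pos_eq by nra. lra. }
    assert (J1 := distortion_upper _ _ _ _ _ (Cseg a b t) (H t' Ht') ltac:(lra)).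
    assert (J2 := distortion_lower _ _ _ _ _ (Cseg a b t) (H t' Ht') D).
    set (A := Cmod (p' (Cseg a b t) / f' (g (Cseg a b t)))) in *.
    set (A' := Cmod (p' (Cseg a b t') / f' (g (Cseg a b t')))) in *. set (A0 := Cmod (p' a / f' (g a))) in *.
    assert (hp : 1 <= Kdist ^ n) by (apply pow_R1_Rle; auto).
    simpl. split.
    + eapply Rle_trans. apply J1. rewrite Rmult_assoc. apply Rmult_le_compat_l; lra.
    + eapply Rle_trans. apply I2. replace (Kdist * Kdist ^ n * A) with (Kdist ^ n * (Kdist * A)) by ring. apply Rmult_le_compat_l; lra.
Qed.
End Distortion.

Lemma Cexp_m1_bound (k : C) : Cmod k <= 1 -> Cmod (Cexp k - 1) <= 3 * Cmod k.
Proof.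
  intros Hk. rewrite <- Cexp_0. replace k with (k - 0)%C at 2 by ring.
  apply (Cmvt Cexp Cexp). intros; apply Cder_Cexp.
  intros t Ht. rewrite Cmod_Cexp. apply Rle_trans with (exp 1). 2: apply exp_le_3. apply exp_le_mono.
  eapply Rle_trans. apply Rle_abs. eapply Rle_trans. apply re_le_Cmod.
  replace (Cseg 0 k t) with (RtoC t * k)%C by (unfold Cseg; ring).
  rewrite Cmod_mult, Cmod_R, Rabs_pos_eq by lra. assert (h := Cmod_ge_0 k). nra.
Qed.

Lemma Cder_add_Cexp (a u : C) : Cder (fun u => a + Cexp u)%C u (Cexp u).
Proof.
  replace (Cexp u) with (0 + Cexp u)%C by ring. apply Cder_plus. apply Cder_const. apply Cder_Cexp.
Qed.

Lemma Cexp_inj_near (a b : C) : Cmod (a - b) < 2 * PI -> Cexp a = Cexp b -> a = b.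
Proof.
  intros H E. destruct (Cexp_eq a b E) as [k Hk]. assert (Hpi := PI_RGT_0).
  assert (h : Cmod (a - b) = 2 * PI * Rabs (IZR k)).
  { rewrite Hk. replace (b + (0%R, (2 * PI * IZR k)%R) - b)%C with (Ci * RtoC (2 * PI * IZR k))%C.
    rewrite Cmod_mult, Cmod_Ci, Cmod_R, Rabs_mult, (Rabs_pos_eq (2 * PI)); lra.
    apply injective_projections; simpl; ring. }
  assert (k = 0%Z).
  { rewrite h in H. assert (Rabs (IZR k) < 1) by nra. rewrite <- abs_IZR in H0. apply lt_IZR in H0. lia. }
  subst k. rewrite Hk. replace ((0, 2 * PI * 0) : C) with (RtoC 0). ring. unfold RtoC; f_equal; ring.
Qed.

(** A radius of at most 1 keeps the diameter of the disc below the period and bounds [Cexp k - 1] by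
    [3 * Cmod k], because [exp 1] is at most 3; this is the source of the 3 in [univ_lift]. *)
Lemma univ_lift_exp (f f' g : C -> C) (a c : C) (R : R) : 0 < R <= 1 ->
  (forall u, Cmod (u - c) < R -> f (g u) = (a + Cexp u)%C /\ Ccont g u /\ f' (g u) <> 0) ->
  univ_lift f f' g (fun u => a + Cexp u)%C Cexp c R.
Proof.
  intros HR H. split; [|split; [|split]]. lra.
  - intros u Hu. split. apply Cder_add_Cexp. split. apply Cexp_neq_0. apply H; auto.
  - intros x y Hx Hy E. apply Cexp_inj_near.
    assert (T := Cmod_tri3 x c y). rewrite (Cmod_sym c y) in T. assert (h := PI_4). assert (h' := PI2_1). unfold PI2 in h'. lra.
    replace (Cexp x) with (a + Cexp x - a)%C by ring. rewrite E. ring.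
  - intros w rho Hr Hw u Hu. assert (h := Cmod_ge_0 (w - c)).
    replace (a + Cexp u - (a + Cexp w))%C with (Cexp w * (Cexp (u - w) - 1))%C.
    2:{ replace u with (w + (u - w))%C at 2 by ring. rewrite Cexp_plus. ring. }
    rewrite Cmod_mult, Rmult_comm. apply Rmult_le_compat_r. apply Cmod_ge_0.
    eapply Rle_trans. apply Cexp_m1_bound. lra. lra.
Qed.

Lemma univ_lift_id (f f' g : C -> C) (c : C) (R : R) : 0 < R ->
  (forall u, Cmod (u - c) < R -> f (g u) = u /\ Ccont g u /\ f' (g u) <> 0) ->
  univ_lift f f' g (fun u => u) (fun _ => RtoC 1) c R.
Proof.
  intros HR H. split; [|split; [|split]]; auto.
  - intros u Hu. split. apply Cder_id. split. intros E; apply RtoC_inj in E; lra. apply H; auto.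
  - intros w rho Hr Hw u Hu. rewrite Cmod_1. lra.
Qed.

Section RegularDiscs.
Variables (f f' : C -> C).
Hypothesis Hf : forall z, Cder f z (f' z).

Lemma regular_disc_lift (z : C) (R : R) : 0 < R ->
  (forall w, Cmod (w - f z) < R -> regular_value f f' w) ->
  exists g, g (f z) = z /\ univ_lift f f' g (fun u => u) (fun _ => RtoC 1) (f z) R.
Proof.
  intros HR Hreg.
  destruct (lifting f f' Hf (fun u => Cmod (u - f z) < R) (fun u => u) (f z) z) as [g [Hg0 Hg]]; auto.
  - intros; apply Cseg_ball; auto.
  - intros; apply disc_open; auto.
  - intros; apply Ccont_id.
  - rewrite Cmod_minus_diag; auto.
  - exists g. split; auto. apply univ_lift_id; auto. intros u Hu. destruct (Hg u Hu) as [E Cg]. split; auto. split; auto.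
    apply (Hreg u Hu). auto.
Qed.

Lemma regular_step (z : C) (w : C) (R : R) : 0 < R ->
  (forall w, Cmod (w - f z) < R -> regular_value f f' w) -> Cmod (w - f z) <= R / 4 ->
  exists z', f z' = w /\ / Cmod (f' z') <= Kdist * / Cmod (f' z) /\ / Cmod (f' z) <= Kdist * / Cmod (f' z') /\
   Cmod (z' - z) <= Kdist * R * / Cmod (f' z).
Proof.
  intros HR Hreg Hw. destruct (regular_disc_lift z R HR Hreg) as [g [Hg0 U]].
  exists (g w). assert (HK := Kdist_ge1). destruct (U) as [_ [U2 _]].
  assert (Hn : forall u, Cmod (u - f z) < R -> Cmod (1 / f' (g u)) = / Cmod (f' (g u))).
  { intros u Hu. rewrite Cmod_div, Cmod_1. unfold Rdiv; ring. apply U2; auto. }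
  split. apply U2; lra.
  assert (D1 := distortion_upper f f' Hf _ _ _ _ _ w U ltac:(lra)).
  assert (D2 := distortion_lower f f' Hf _ _ _ _ _ w U Hw).
  assert (D0 : Cmod (f z - f z) < R) by (rewrite Cmod_minus_diag; auto).
  rewrite !Hn, Hg0 in D1, D2 by lra. split; auto. split; auto.
  rewrite <- Hg0 at 1.
  eapply Rle_trans. apply (Cmvt g (fun u => 1 / f' (g u))%C (f z) w (Kdist * / Cmod (f' z))).
  - intros t Ht. apply (univ_lift_holo f f' Hf _ _ _ _ _ U). apply Cseg_ball; auto; lra.
  - intros t Ht. assert (S : Cmod (Cseg (f z) w t - f z) <= R / 4).
    { replace (Cseg (f z) w t - f z)%C with (RtoC t * (w - f z))%C by (unfold Cseg; ring).
      rewrite Cmod_mult, Cmod_R, Rabs_pos_eq by lra. assert (h := Cmod_ge_0 (w - f z)). nra. }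
    assert (D := distortion_upper f f' Hf _ _ _ _ _ (Cseg (f z) w t) U ltac:(lra)).
    rewrite !Hn, Hg0 in D by lra. rewrite Hn by lra. auto.
  - assert (0 < / Cmod (f' z)). { apply Rinv_0_lt_compat, Cmod_gt_0. rewrite <- Hg0. apply U2; auto. }
    rewrite (Rmult_assoc Kdist R), (Rmult_comm R), <- Rmult_assoc. apply Rmult_le_compat_l. nra. lra.
Qed.

(** The lift of the disc about [f z] covers a disc about [z] of the stated radius, and there the
    values of [f] stay in the disc. This is the origin of all lower bounds for distances and
    diameters. *)
Lemma regular_separation (z z' : C) (R : R) : 0 < R ->
  (forall w, Cmod (w - f z) < R -> regular_value f f' w) -> R <= Cmod (f z' - f z) ->
  R / (64 * Kdist) * / Cmod (f' z) <= Cmod (z' - z).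
Proof.
  intros HR Hreg H. destruct (regular_disc_lift z R HR Hreg) as [g [Hg0 U]].
  apply Rnot_lt_le. intros Hlt.
  destruct (univ_lift_covers f f' Hf _ _ _ _ _ z' U) as [u [Hu Eu]].
  - rewrite Hg0, Cmod_div, Cmod_1. eapply Rlt_le_trans. apply Hlt. right; unfold Rdiv; ring.
    rewrite <- Hg0. apply (proj1 (proj2 U)). rewrite Cmod_minus_diag; auto.
  - rewrite <- Eu in H. destruct (proj1 (proj2 U) u Hu) as [_ [_ [E _]]]. rewrite E in H. lra.
Qed.
End RegularDiscs.

(** * Lifts of exponentials *)

Definition Copen (U : C -> Prop) : Prop := forall z, U z -> exists e, 0 < e /\ forall w, Cmod (w - z) < e -> U w.

Lemma open_Copen (U : C -> Prop) : open U <-> Copen U.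
Proof.
  split.
  - intros H z Hz. destruct (H z Hz) as [e He]. exists e. split. apply cond_pos.
    intros w Hw. apply He. apply C_NormedModule_mixin_compat1. exact Hw.
  - intros H z Hz. destruct (H z Hz) as [e [He HE]].
    assert (Hs : 0 < sqrt 2) by (apply sqrt_lt_R0; lra).
    assert (Hp : 0 < e / sqrt 2) by (apply Rdiv_lt_0_compat; auto).
    exists (mkposreal _ Hp). intros w Hw. apply HE. apply C_NormedModule_mixin_compat2 in Hw. simpl in Hw.
    replace (sqrt 2 * (e / sqrt 2)) with e in Hw by (field; lra). exact Hw.
Qed.

Lemma connected_convex_image (A : C -> Prop) (g : C -> C) :
  (forall a b t, A a -> A b -> 0 <= t <= 1 -> A (Cseg a b t)) -> (forall u, A u -> Ccont g u) ->
  connected (fun z => exists u, A u /\ z = g u).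
Proof.
  intros HA Hg U V HU HV Hc [z1 [[a [Aa ->]] U1]] [z2 [[b [Ab ->]] V2]].
  apply open_Copen in HU. apply open_Copen in HV.
  apply NNPP. intros Hno.
  assert (Disj : forall u, A u -> U (g u) -> V (g u) -> False).
  { intros u Hu h1 h2. apply Hno. exists (g u). split; auto. exists u; auto. }
  assert (Cov : forall u, A u -> U (g u) \/ V (g u)) by (intros u Hu; apply Hc; exists u; auto).
  assert (Hs : forall t, 0 <= t <= 1 -> A (Cseg a b t)) by (intros; apply HA; auto).
  assert (Hp : forall t, 0 <= t <= 1 -> Pcont (fun t => g (Cseg a b t)) t).
  { intros t Ht. apply Pcont_comp. apply Hg; auto. apply Pcont_seg. }
  assert (K : U (g (Cseg a b 1))).
  { apply (real_induction (fun t => U (g (Cseg a b t)))); try lra.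
    - rewrite Cseg_0; auto.
    - intros t Ht Hst. assert (Ut := Hst t ltac:(lra)). destruct (HU _ Ut) as [e [He HE]].
      destruct (Hp t ltac:(lra) e He) as [d [Hd HD]]. exists d. split; auto.
      intros s Hs1 Hs2. apply HE, HD. rewrite Rabs_pos_eq; lra.
    - intros t Ht Hst. destruct (Cov (Cseg a b t)) as [h|h]; auto. apply Hs; lra. exfalso.
      destruct (HV _ h) as [e [He HE]]. destruct (Hp t ltac:(lra) e He) as [d [Hd HD]].
      set (s := Rmax 0 (t - d / 2)).
      assert (0 <= s /\ s < t /\ t - d / 2 <= s) by (unfold s, Rmax; destruct Rle_dec; lra).
      apply (Disj (Cseg a b s)). apply Hs; lra. apply Hst; lra. apply HE, HD. rewrite Rabs_left; lra. }
  rewrite Cseg_1 in K. eapply Disj; eauto.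
Qed.

Lemma connected_union (A B : cset) (z : C) : connected A -> connected B -> A z -> B z ->
  connected (fun w => A w \/ B w).
Proof.
  intros HA HB Az Bz U V HU HV Hc [z1 [H1 U1]] [z2 [H2 V2]].
  assert (CA : subset A (fun w => U w \/ V w)) by (intros w Hw; apply Hc; auto).
  assert (CB : subset B (fun w => U w \/ V w)) by (intros w Hw; apply Hc; auto).
  assert (Az' : exists z, A z /\ (fun w => A w) z) by eauto.
  destruct (CA z Az) as [Uz|Vz].
  - destruct H2 as [H2|H2].
    + destruct (HA U V HU HV CA) as [w [Aw [Uw Vw]]]; eauto.
    + destruct (HB U V HU HV CB) as [w [Bw [Uw Vw]]]; eauto.
  - destruct H1 as [H1|H1].
    + destruct (HA U V HU HV CA) as [w [Aw [Uw Vw]]]; eauto.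
    + destruct (HB U V HU HV CB) as [w [Bw [Uw Vw]]]; eauto.
Qed.

Lemma component_maximal (X K L : cset) (z : C) : component X K -> connected L -> subset L X -> K z -> L z -> subset L K.
Proof.
  intros [H1 [H2 [H3 H4]]] HL HLX Kz Lz w Lw.
  apply (H4 (fun w => K w \/ L w)); auto.
  - apply connected_union with z; auto.
  - intros x Hx; auto.
  - intros x [Hx|Hx]; auto.
Qed.

(** The tool that identifies components: [U] witnesses that [L] is relatively open in [X]. If [K]
    left [L], then [U] and the complement of the closure of [L] would disconnect it. *)
Lemma connected_clopen (X K L U : cset) : connected K -> subset K X -> Copen U ->
  subset L U -> (forall w, X w -> U w -> L w) -> (forall w, X w -> closure L w -> L w) ->
  (exists z, K z /\ L z) -> subset K L.
Proof.
  intros HK KX HU LU UL CL [z [Kz Lz]] w Kw. apply NNPP. intros Hn.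
  destruct (HK U (fun w => ~ closure L w)) as [x [Kx [Ux Vx]]].
  - apply open_Copen; auto.
  - apply open_Copen. intros x Hx. apply NNPP. intros Hno. apply Hx. intros e He.
    apply NNPP. intros Hno'. apply Hno. exists (e / 2). split. lra. intros y Hy Hcl.
    destruct (Hcl (e / 2) ltac:(lra)) as [v [Lv Hv]]. apply Hno'. exists v. split; auto.
    assert (T := Cmod_tri3 v y x). lra.
  - intros x Kx. destruct (classic (closure L x)) as [h|h]; auto.
  - exists z; auto.
  - exists w. split; auto.
  - apply Vx. intros e He. exists x. rewrite Cmod_minus_diag. auto.
Qed.

(** * Lifts of [a + Cexp u] over a periodic convex domain *)

Section ExpSheets.
Variables (f f' : C -> C).
Hypothesis Hf : forall z, Cder f z (f' z).
Variables (V : C -> Prop) (a : C).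
Hypothesis Vconv : forall a b t, V a -> V b -> 0 <= t <= 1 -> V (Cseg a b t).
Hypothesis Vopen : Copen V.
Hypothesis Vper : forall u k, V u -> V (u + (0%R, (2 * PI * IZR k)%R))%C.
Hypothesis Vreg : forall u, V u -> regular_value f f' (a + Cexp u)%C.

Definition exp_lift (g : C -> C) : Prop := forall u, V u -> f (g u) = (a + Cexp u)%C /\ Ccont g u.

Lemma exp_lift_exists (u z : C) : V u -> f z = (a + Cexp u)%C -> exists g, exp_lift g /\ g u = z.
Proof.
  intros Hu Hz.
  destruct (lifting f f' Hf V (fun u => a + Cexp u)%C u z) as [g [Hg0 Hg]]; auto.
  - intros; eapply Cder_cont, Cder_add_Cexp.
  - exists g. split; auto.
Qed.

Lemma exp_lift_unique (g1 g2 : C -> C) (u : C) : exp_lift g1 -> exp_lift g2 -> V u -> g1 u = g2 u ->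
  forall v, V v -> g1 v = g2 v.
Proof.
  intros H1 H2 Hu E v Hv. rewrite <- (Cseg_1 u v). apply (lift_unique_seg f f' Hf); auto. 2: lra.
  intros t Ht w. assert (Vw : V w) by (apply Vconv; auto).
  destruct (H1 w Vw) as [A1 A2]. destruct (H2 w Vw) as [B1 B2].
  split; auto. split; auto. split. congruence. apply (Vreg w Vw). auto.
Qed.

Lemma exp_lift_univ (g : C -> C) (u : C) (R : R) : exp_lift g -> 0 < R <= 1 -> (forall v, Cmod (v - u) < R -> V v) ->
  univ_lift f f' g (fun u => a + Cexp u)%C Cexp u R.
Proof.
  intros Hg HR HV. apply univ_lift_exp; auto. intros v Hv. destruct (Hg v (HV v Hv)) as [E Cg].
  split; auto. split; auto. apply (Vreg v (HV v Hv)). auto.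
Qed.

Lemma exp_lift_open (g : C -> C) (u : C) (e : R) : exp_lift g -> V u -> 0 < e ->
  exists d, 0 < d /\ forall z, Cmod (z - g u) < d -> exists v, V v /\ Cmod (v - u) < e /\ g v = z.
Proof.
  intros Hg Hu He. destruct (Vopen u Hu) as [r [Hr HV]].
  set (rho := Rmin 1 (Rmin e r)).
  assert (Hrho : 0 < rho /\ rho <= 1 /\ rho <= e /\ rho <= r) by (unfold rho, Rmin; repeat destruct Rle_dec; lra).
  assert (U := exp_lift_univ g u rho Hg ltac:(lra) ltac:(intros; apply HV; lra)).
  exists (rho * Cmod (Cexp u / f' (g u)) / (64 * Kdist)). assert (HK := Kdist_ge1).
  destruct (proj1 (proj2 U) u) as [_ [N1 [_ [_ N2]]]]. rewrite Cmod_minus_diag; lra.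
  split.
  - rewrite Cmod_div by auto. apply Cmod_gt_0 in N1. apply Cmod_gt_0 in N2.
    apply Rdiv_lt_0_compat; [|lra]. apply Rmult_lt_0_compat; [lra|]. apply Rdiv_lt_0_compat; auto.
  - intros z Hz. destruct (univ_lift_covers f f' Hf _ _ _ _ _ z U Hz) as [v [Hv Ev]].
    exists v. split. apply HV; lra. split; auto. lra.
Qed.

(* The lift through [z] takes every value close to [z], so that it differs from [g] by a period as
   soon as [g] comes close to [z]. *)
Lemma exp_lift_closed (g : C -> C) (us z : C) (e : R) : exp_lift g -> V us -> f z = (a + Cexp us)%C -> 0 < e ->
  exists d, 0 < d /\ forall u, V u -> Cmod (g u - z) < d -> exists v, V v /\ Cmod (v - u) < e /\ g v = z.
Proof.
  intros Hg Hus Hz He. destruct (exp_lift_exists us z Hus Hz) as [g2 [Hg2 E2]].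
  destruct (exp_lift_open g2 us e Hg2 Hus He) as [d [Hd HD]]. exists d. split; auto.
  intros u Hu Hu'. rewrite E2 in HD. destruct (HD (g u) Hu') as [v [Vv [Hv Ev]]].
  destruct (Cexp_eq u v) as [k Hk].
  { replace (Cexp u) with (a + Cexp u - a)%C by ring. replace (Cexp v) with (a + Cexp v - a)%C by ring. f_equal.
    rewrite <- (proj1 (Hg u Hu)), <- (proj1 (Hg2 v Vv)). congruence. }
  set (P := (0, 2 * PI * IZR k) : C) in *.
  assert (P' : forall x, V x -> V (x - P)%C).
  { intros x Hx. replace (x - P)%C with (x + (0%R, (2 * PI * IZR (- k))%R))%C. apply Vper; auto.
    rewrite opp_IZR. unfold P. destruct x. apply injective_projections; simpl; ring. }
  set (g3 := fun x => g2 (x - P)%C).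
  assert (Hg3 : exp_lift g3).
  { intros x Hx. destruct (Hg2 (x - P)%C (P' x Hx)) as [A1 A2]. split.
    - unfold g3. rewrite A1. f_equal. replace x with (x - P + P)%C at 2 by ring. symmetry. apply Cexp_period.
    - apply (Ccont_comp g2 (fun x => x - P)%C); auto. apply Ccont_minus. apply Ccont_id. apply Ccont_const. }
  assert (E3 : g3 u = g u). { unfold g3. replace (u - P)%C with v by (rewrite Hk; ring). auto. }
  exists (us + P)%C. assert (VP : V (us + P)%C) by (apply Vper; auto).
  split; auto. split.
  - rewrite Hk. replace (us + P - (v + P))%C with (us - v)%C by ring. rewrite Cmod_sym. auto.
  - rewrite <- (exp_lift_unique g3 g u Hg3 Hg Hu E3 _ VP). unfold g3. replace (us + P - P)%C with us by ring. auto.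
Qed.

Lemma exp_lift_closure (g : C -> C) (us z : C) (A : C -> Prop) (e : R) : exp_lift g -> (forall u, A u -> V u) ->
  V us -> f z = (a + Cexp us)%C -> 0 < e -> closure (fun z => exists u, A u /\ z = g u) z ->
  exists u k, A u /\ Cmod (us + (0%R, (2 * PI * IZR k)%R) - u) < e /\ g (us + (0%R, (2 * PI * IZR k)%R))%C = z.
Proof.
  intros Hg HA Hus Hz He Hcl. destruct (exp_lift_closed g us z e Hg Hus Hz He) as [d [Hd HD]].
  destruct (Hcl d Hd) as [x [[u [Au ->]] Hx]]. destruct (HD u (HA u Au) Hx) as [v [Vv [Hv Ev]]].
  destruct (Cexp_eq v us) as [k Hk].
  { replace (Cexp v) with (a + Cexp v - a)%C by ring. rewrite <- (proj1 (Hg v Vv)), Ev, Hz. ring. }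
  exists u, k. rewrite <- Hk. auto.
Qed.

Lemma exp_lift_image_closure (g : C -> C) (u : C) (A : C -> Prop) : exp_lift g -> V u -> 
  (forall e, 0 < e -> exists v, A v /\ Cmod (v - u) < e) -> closure (fun z => exists u, A u /\ z = g u) (g u).
Proof.
  intros Hg Hu HA e He. destruct (proj2 (Hg u Hu) e He) as [d [Hd HD]].
  destruct (HA d Hd) as [v [Av Hv]]. exists (g v). split; eauto.
Qed.
End ExpSheets.

(** * Injectivity of lifts over the exterior disc *)

Lemma fst_Cseg (a b : C) (t : R) : fst (Cseg a b t) = fst a + t * (fst b - fst a).
Proof. unfold Cseg; simpl. ring. Qed.
Lemma snd_Cseg (a b : C) (t : R) : snd (Cseg a b t) = snd a + t * (snd b - snd a).
Proof. unfold Cseg; simpl. ring. Qed.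
Lemma fst_close (u v : C) (e : R) : Cmod (v - u) < e -> Rabs (fst v - fst u) < e.
Proof. intros H. eapply Rle_lt_trans. apply (re_le_Cmod (v - u)). auto. Qed.
Lemma snd_close (u v : C) (e : R) : Cmod (v - u) < e -> Rabs (snd v - snd u) < e.
Proof. intros H. eapply Rle_lt_trans. apply (im_le_Cmod (v - u)). auto. Qed.

Definition right_half (x0 : R) (u : C) : Prop := x0 < fst u.
Lemma right_half_convex x0 a b t : right_half x0 a -> right_half x0 b -> 0 <= t <= 1 -> right_half x0 (Cseg a b t).
Proof. unfold right_half. intros. rewrite fst_Cseg. destruct (Rle_lt_dec t 0). replace t with 0 by lra. lra. nra. Qed.
Lemma right_half_open x0 : Copen (right_half x0).
Proof.
  intros u Hu. exists (fst u - x0). split. unfold right_half in Hu; lra. intros v Hv. apply fst_close in Hv.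
  apply Rabs_def2 in Hv. unfold right_half in *. lra.
Qed.
Lemma right_half_period x0 u k : right_half x0 u -> right_half x0 (u + (0%R, (2 * PI * IZR k)%R))%C.
Proof. unfold right_half. simpl. lra. Qed.

Definition left_half (x0 : R) (u : C) : Prop := fst u < x0.
Lemma left_half_convex x0 a b t : left_half x0 a -> left_half x0 b -> 0 <= t <= 1 -> left_half x0 (Cseg a b t).
Proof. unfold left_half. intros. rewrite fst_Cseg. destruct (Rle_lt_dec t 0). replace t with 0 by lra. lra. nra. Qed.
Lemma left_half_open x0 : Copen (left_half x0).
Proof.
  intros u Hu. exists (x0 - fst u). split. unfold left_half in Hu; lra. intros v Hv. apply fst_close in Hv.
  apply Rabs_def2 in Hv. unfold left_half in *. lra.
Qed.
Lemma left_half_period x0 u k : left_half x0 u -> left_half x0 (u + (0%R, (2 * PI * IZR k)%R))%C.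
Proof. unfold left_half. simpl. lra. Qed.

Lemma exterior_connected (M : R) : 0 < M -> connected (fun z => M < Cmod z).
Proof.
  intros HM.
  assert (E : (fun z => M < Cmod z) = (fun z => exists u, right_half (ln M) u /\ z = Cexp u)).
  { apply functional_extensionality. intros z. apply propositional_extensionality. split.
    - intros Hz. destruct (Cexp_surj z) as [u [Hu1 Hu2]]. apply Cmod_gt_0. lra. exists u. split; auto.
      unfold right_half. rewrite Hu2. apply ln_increasing; auto.
    - intros [u [Hu ->]]. rewrite Cmod_Cexp. rewrite <- (exp_ln M) by auto. apply exp_increasing; auto. }
  rewrite E. apply connected_convex_image. intros; apply right_half_convex; auto.
  intros; eapply Cder_cont, Cder_Cexp.
Qed.

Lemma exp_lift_deriv (f f' : C -> C) (V : C -> Prop) (a : C) (g : C -> C) (u : C) : (forall z, Cder f z (f' z)) ->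
  Copen V -> (forall u, V u -> regular_value f f' (a + Cexp u)%C) -> exp_lift f V a g -> V u -> Cder g u (Cexp u / f' (g u)).
Proof.
  intros Hf HV Hreg Hg Hu. destruct (HV u Hu) as [e [He HE]]. destruct (Hg u Hu) as [E Cg].
  apply (Cder_lift f g (fun u => a + Cexp u)%C u (f' (g u)) (Cexp u) e); auto.
  intros w Hw. apply Hg; auto. apply (Hreg u Hu); auto. apply Cder_add_Cexp.
Qed.

(** By continuity [f] has modulus at least 1 at a limit point, so a logarithm of the value lies in
    the closed half-plane, which is inside the domain of [g] because [x0] is negative. *)
Lemma right_lift_closure (f f' : C -> C) (x0 : R) (g : C -> C) (z : C) : (forall z, Cder f z (f' z)) -> x0 < 0 ->
  (forall u, right_half x0 u -> regular_value f f' (0 + Cexp u)%C) -> exp_lift f (right_half x0) 0 g ->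
  closure (fun z => exists u, right_half 0 u /\ z = g u) z -> exists u, 0 <= fst u /\ z = g u.
Proof.
  intros Hf Hx0 Vreg Hg Hcl.
  assert (HA : forall u, right_half 0 u -> right_half x0 u) by (unfold right_half; intros; lra).
  assert (Fz : 1 <= Cmod (f z)).
  { apply le_epsilon. intros e He. destruct (Cder_cont _ _ _ (Hf z) e He) as [d [Hd HD]].
    destruct (Hcl d Hd) as [v [[u [Au ->]] Hv]]. specialize (HD _ Hv).
    assert (T := Cmod_tri_rev (f (g u)) (f z)). rewrite (proj1 (Hg u (HA u Au))), Cplus_0_l in HD, T. rewrite Cmod_Cexp in T.
    assert (h := exp_le_mono 0 (fst u)). rewrite exp_0 in h. unfold right_half in Au. lra. }
  destruct (Cexp_surj (f z)) as [us [E1 E2]]. apply Cmod_gt_0; lra.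
  assert (Hus : 0 <= fst us) by (rewrite E2, <- ln_1; apply ln_le; lra).
  destruct (exp_lift_closure f f' Hf (right_half x0) 0 (right_half_convex x0) (right_half_open x0) (right_half_period x0) Vreg g us z (right_half 0) 1) as [u [m [Au [Hum Em]]]]; auto.
  - unfold right_half; lra.
  - rewrite Cplus_0_l; auto.
  - lra.
  - eexists. split. 2: symmetry; apply Em. simpl. lra.
Qed.

Lemma right_image_open (f f' : C -> C) (x0 : R) (g : C -> C) : (forall z, Cder f z (f' z)) -> x0 < 0 ->
  (forall u, right_half x0 u -> regular_value f f' (0 + Cexp u)%C) -> exp_lift f (right_half x0) 0 g ->
  Copen (fun z => exists u, right_half 0 u /\ z = g u).
Proof.
  intros Hf Hx0 Vreg Hg z [u [Hu ->]]. unfold right_half in Hu.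
  destruct (exp_lift_open f f' Hf (right_half x0) 0 (right_half_open x0) Vreg g u (fst u)) as [d [Hd HD]]; auto.
  unfold right_half; lra.
  exists d. split; auto. intros w Hw. destruct (HD w Hw) as [v [_ [Hv1 Hv2]]]. exists v. split; auto.
  apply fst_close in Hv1. apply Rabs_def2 in Hv1. unfold right_half. lra.
Qed.

(** * A periodic lift forces polynomial growth *)

Section Injectivity.
Variables (f f' : C -> C).
Hypothesis Hf : forall z, Cder f z (f' z).
Variable x0 : R.
Hypothesis Hx0 : x0 < 0.
Hypothesis Vreg : forall u, right_half x0 u -> regular_value f f' (0 + Cexp u)%C.
Variable g : C -> C.
Hypothesis Hg : exp_lift f (right_half x0) 0 g.
Variable k : Z.
Hypothesis Hk : (0 < k)%Z.
Hypothesis Hper : forall u, right_half x0 u -> g (u + (0%R, (2 * PI * IZR k)%R))%C = g u.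

Lemma lift_period_mult (m : Z) : forall u, right_half x0 u -> g (u + (0%R, (2 * PI * (IZR k * IZR m))%R))%C = g u.
Proof.
  assert (Hn : forall n : nat, forall u, right_half x0 u -> g (u + (0%R, (2 * PI * (IZR k * INR n))%R))%C = g u).
  { induction n; intros u Hu.
    - f_equal. destruct u; apply injective_projections; simpl; ring.
    - rewrite <- (IHn u Hu). rewrite <- (Hper (u + (0%R, (2 * PI * (IZR k * INR n))%R))%C).
      f_equal. rewrite S_INR. destruct u; apply injective_projections; simpl; ring.
      unfold right_half in *; simpl; lra. }
  intros u Hu. destruct (Z_le_dec 0 m) as [h|h].
  - rewrite <- (Z2Nat.id m h), <- INR_IZR_INZ. apply Hn; auto.
  - rewrite <- (Hn (Z.to_nat (- m)) (u + (0%R, (2 * PI * (IZR k * IZR m))%R))%C).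
    f_equal. rewrite INR_IZR_INZ, Z2Nat.id, opp_IZR by lia. destruct u; apply injective_projections; simpl; ring.
    unfold right_half in *; simpl; lra.
Qed.

Lemma lift_Cmod (u : C) : right_half x0 u -> Cmod (f (g u)) = exp (fst u).
Proof. intros Hu. rewrite (proj1 (Hg u Hu)), Cplus_0_l. apply Cmod_Cexp. Qed.

Lemma lift_escapes (M : R) : exists X, forall u, right_half x0 u -> X < fst u -> M < Cmod (g u).
Proof.
  destruct (bounded_disc f 0 M) as [B HB].
  { intros z _. apply Ccont_loc_bounded. eapply Cder_cont; apply Hf. }
  exists (ln (Rabs B + 1)). intros u Hu Hx. apply Rnot_le_lt. intros Hle.
  assert (h := HB (g u)). replace (g u - 0)%C with (g u) in h by ring. specialize (h Hle). rewrite lift_Cmod in h by auto.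
  apply exp_increasing in Hx. assert (h' := Rabs_pos B). assert (h'' := Rle_abs B). rewrite exp_ln in Hx; lra.
Qed.

(** The image of the right half-plane is open, and its further limit points are values on the
    imaginary axis, which form a bounded set by periodicity. The exterior of a large disc is
    connected and meets the image, so it is contained in it. *)
Lemma lift_covers_infinity : exists M, forall z, M < Cmod z -> exists u, right_half x0 u /\ g u = z.
Proof.
  assert (Hpi := PI_RGT_0). assert (HK : 0 < IZR k) by (apply IZR_lt; auto).
  (* Boundedness on discs is applied to a function of the imaginary part, to bound [g] on one period
     of the imaginary axis. *)
  destruct (bounded_disc (fun z => g (0, snd z)) 0 (2 * PI * IZR k)) as [M0 HM0].
  { intros z _. apply Ccont_loc_bounded. apply (Ccont_comp g (fun z => (0, snd z))).
    apply Hg. unfold right_half; simpl; lra.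
    intros e He. exists e. split; auto. intros w Hw. apply snd_close in Hw.
    replace ((0%R, snd w) - (0%R, snd z))%C with (Ci * RtoC (snd w - snd z))%C by (apply injective_projections; simpl; ring).
    rewrite Cmod_mult, Cmod_Ci, Cmod_R. lra. }
  set (M := Rabs M0 + 1). assert (HM : 1 <= M /\ M0 < M) by (unfold M; assert (h := Rabs_pos M0); assert (h' := Rle_abs M0); lra).
  exists M.
  set (U := fun z => exists u, right_half 0 u /\ z = g u).
  assert (Sub : subset (fun z => M < Cmod z) (fun z => U z /\ M < Cmod z)).
  { apply connected_clopen with (X := fun z => M < Cmod z) (U := U).
    - apply exterior_connected; lra.
    - intros z Hz; auto.
    - apply (right_image_open f f' x0); auto.
    - intros z [h _]; auto.
    - intros z h1 h2; auto.
    - intros z Hz Hcl. split; auto.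
      destruct (right_lift_closure f f' x0 g z Hf Hx0 Vreg Hg) as [[x y] [Hu ->]].
      { intros e He. destruct (Hcl e He) as [v [[h _] hv]]. exists v; auto. }
      destruct Hu as [Hu|Hu]; simpl in Hu. eexists. split. 2: reflexivity. exact Hu.
      exfalso. subst x. set (q := Int_part (y / (2 * PI * IZR k))).
      destruct (base_Int_part (y / (2 * PI * IZR k))) as [B1 B2]. fold q in B1, B2.
      assert (P2 : 0 < 2 * PI * IZR k) by nra.
      (* The imaginary part is reduced to one period, where [HM0] applies. *)
      set (y' := y - 2 * PI * IZR k * IZR q).
      assert (Hy' : 0 <= y' <= 2 * PI * IZR k).
      { assert (Ey : y = y / (2 * PI * IZR k) * (2 * PI * IZR k)) by (field; nra). unfold y'. rewrite Ey at 1 2. nra. }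
      assert (h := HM0 (0, y')). simpl in h.
      replace ((0%R, y') - 0)%C with (Ci * RtoC y')%C in h by (apply injective_projections; simpl; ring).
      rewrite Cmod_mult, Cmod_Ci, Cmod_R, Rabs_pos_eq in h by lra.
      rewrite <- (lift_period_mult (- q) (0, y)) in Hz by (unfold right_half; simpl; lra).
      replace ((0%R, y) + (0%R, (2 * PI * (IZR k * IZR (- q)))%R))%C with ((0, y') : C) in Hz. lra.
      rewrite opp_IZR. unfold y'. apply injective_projections; simpl; ring.
    - destruct (lift_escapes M) as [X HX]. set (u := (Rmax X 0 + 1, 0) : C).
      assert (Hu : 0 < fst u /\ X < fst u) by (unfold u; simpl; unfold Rmax; destruct Rle_dec; lra).
      exists (g u). assert (M < Cmod (g u)) by (apply HX; unfold right_half; lra).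
      split; auto. split; auto. exists u. split; auto. apply Hu. }
  intros z Hz. destruct (Sub z Hz) as [[u [Hu ->]] _]. exists u. split; auto. unfold right_half in *; lra.
Qed.

(* Schwarz's lemma for [xi |-> 1 / g (- k log xi)], which is single valued near [0] by periodicity. *)
Lemma lift_growth : exists L X, 0 < L /\ forall u, right_half x0 u -> X < fst u -> exp (fst u / IZR k) <= L * Cmod (g u).
Proof.
  assert (HK : 0 < IZR k) by (apply IZR_lt; auto).
  destruct (lift_escapes 1) as [X0' HX0']. set (X0 := Rmax X0' 0).
  assert (HX0 : forall u, X0 < fst u -> right_half x0 u /\ 1 < Cmod (g u)).
  { intros u Hu. assert (right_half x0 u) by (unfold right_half, X0, Rmax in *; destruct Rle_dec; lra).
    split; auto. apply HX0'; auto. unfold X0, Rmax in *; destruct Rle_dec; lra. }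
  assert (Ex : forall xi : C, exists v : C, xi <> 0 -> Cexp v = xi /\ fst v = ln (Cmod xi)).
  { intros xi. destruct (Ceq_dec xi 0) as [h|h]. exists 0. intros N; exfalso; apply N; exact h. destruct (Cexp_surj xi h) as [v Hv]. exists v; auto. }
  (* An arbitrary logarithm at every point, with no continuity; [Same] shows that [g] does not see
     the choice. *)
  destruct (choice _ Ex) as [lg Hlg].
  set (nk := (- RtoC (IZR k))%C).
  assert (Fnk : forall v : C, fst (nk * v)%C = - IZR k * fst v) by (intros [x y]; unfold nk; simpl; ring).
  set (r0 := exp (- X0 / IZR k)). assert (Hr0 : 0 < r0) by apply exp_pos.
  assert (Rg : forall xi v : C, Cmod xi < r0 -> Cexp v = xi -> X0 < fst (nk * v)%C).
  { intros xi v H1 H2. rewrite Fnk. rewrite <- H2, Cmod_Cexp in H1. apply exp_lt_inv in H1.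
    apply Rmult_lt_compat_l with (r := IZR k) in H1; auto.
    replace (IZR k * (- X0 / IZR k)) with (- X0) in H1 by (field; lra). lra. }
  assert (Same : forall xi v v' : C, Cmod xi < r0 -> Cexp v = xi -> Cexp v' = xi -> g (nk * v)%C = g (nk * v')%C).
  { intros xi v v' Hxi E E'. destruct (Cexp_eq v v') as [m Hm]. congruence.
    rewrite <- (lift_period_mult (- m) (nk * v')%C) by (apply HX0; apply (Rg xi); auto).
    f_equal. rewrite Hm, opp_IZR. unfold nk. destruct v'. apply injective_projections; simpl; ring. }
  set (q := fun xi : C => (/ g (nk * lg xi))%C).
  assert (qD : forall xi : C, xi <> 0 -> Cmod xi < r0 -> exists l, Cder q xi l).
  { intros xi Hxi Hr. assert (Hm := proj1 (Cmod_gt_0 _) Hxi).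
    destruct (log_on_disc (fun w => w) (fun _ => RtoC 1) xi (Cmod xi)) as [G [EG DG]]; auto.
    { intros w _. apply Cder_id. }
    { intros w Hw E. subst w. rewrite Cmod_sym in Hw. replace (xi - 0)%C with xi in Hw by ring. lra. }
    assert (Exi : Cmod (xi - xi) < Cmod xi) by (rewrite Cmod_minus_diag; auto).
    set (u := (nk * G xi)%C).
    assert (Hu : X0 < fst u) by (apply (Rg xi); auto).
    assert (Dg : Cder g u (Cexp u / f' (g u))).
    { apply (exp_lift_deriv f f' (right_half x0) 0); auto. apply right_half_open. apply HX0; auto. }
    assert (Ng : g u <> 0). { apply Cmod_gt_0. destruct (HX0 u Hu). lra. }
    assert (D1 := Cder_scal nk G xi _ (DG xi Exi)).
    assert (D2 := Cder_comp g (fun w => nk * G w)%C xi _ _ Dg D1).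
    assert (D3 := Cder_comp Cinv (fun w => g (nk * G w)%C) xi _ _ (Cder_inv _ Ng) D2).
    eexists.
    eapply (Cder_ext_loc (fun w => / g (nk * G w))%C q xi _ (Rmin (Cmod xi) (r0 - Cmod xi))). 3: apply D3.
    apply Rmin_pos; lra.
    intros w Hw. destruct (Rmin_Rgt_l _ _ _ Hw) as [h1 h2].
    unfold q. f_equal. assert (Hw0 : w <> 0).
    { intros E. subst w. rewrite Cmod_sym in h1. replace (xi - 0)%C with xi in h1 by ring. lra. }
    apply (Same w). assert (T := Cmod_tri_rev w xi). lra. apply EG; auto. apply Hlg; auto. }
  (* The factor [xi] makes differentiability at 0 immediate, since [q] tends to 0 there, and spares
     a theorem on removable singularities. As [Q] and its derivative vanish at 0, [Q] is
     quadratically small, and division by [xi] gives the Schwarz type bound for [q]. *)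
  set (Q := fun xi : C => if Ceq_dec xi 0 then RtoC 0 else (xi * q xi)%C).
  assert (Q0 : Cder Q 0 0).
  { intros e He. destruct (lift_escapes (/ e)) as [X1 HX1]. exists (Rmin r0 (exp (- X1 / IZR k))). 
    split. apply Rmin_pos; auto. apply exp_pos.
    intros w Hw. destruct (Rmin_Rgt_l _ _ _ Hw) as [h1 h2].
    replace (w - 0)%C with w in * by ring. unfold Q. destruct (Ceq_dec 0 0) as [_|n]; [|tauto].
    destruct (Ceq_dec w 0) as [->|Hn].
    - replace (0 - 0 - 0 * 0)%C with (RtoC 0) by ring. rewrite Cmod_0. lra.
    - replace (w * q w - 0 - 0 * w)%C with (q w * w)%C by ring. rewrite Cmod_mult. apply Rmult_le_compat_r. apply Cmod_ge_0.
      destruct (Hlg w Hn) as [E1 E2]. assert (Hu := Rg w _ h1 E1). destruct (HX0 _ Hu) as [V1 V2].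
      unfold q. rewrite Cmod_inv by (apply Cmod_gt_0; lra).
      rewrite <- (Rinv_inv e). apply Rinv_le_contravar. apply Rinv_0_lt_compat; auto. left. apply HX1; auto.
      rewrite Fnk. rewrite <- E1, Cmod_Cexp in h2. apply exp_lt_inv in h2.
      apply Rmult_lt_compat_l with (r := IZR k) in h2; auto.
      replace (IZR k * (- X1 / IZR k)) with (- X1) in h2 by (field; lra). lra. }
  assert (QD : forall xi : C, exists l, Cmod (xi - 0) < r0 -> Cder Q xi l).
  { intros xi. destruct (Ceq_dec xi 0) as [->|Hn]. exists 0; auto.
    destruct (Rlt_le_dec (Cmod xi) r0) as [h|h].
    - destruct (qD xi Hn h) as [l Hl]. exists (1 * q xi + xi * l)%C. intros _.
      assert (Hm := proj1 (Cmod_gt_0 _) Hn).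
      eapply (Cder_ext_loc (fun w => w * q w)%C _ _ _ (Cmod xi)); auto.
      intros w Hw. unfold Q. destruct (Ceq_dec w 0) as [->|]; auto.
      rewrite Cmod_sym in Hw. replace (xi - 0)%C with xi in Hw by ring. lra.
      apply (Cder_mult (fun w => w) q); auto. apply Cder_id.
    - exists 0. replace (xi - 0)%C with xi by ring. lra. }
  destruct (choice _ QD) as [Q' HQ'].
  assert (DQ : Dholo Q Q' 0 r0) by (intros xi; apply HQ').
  assert (EQ0 : Q' 0 = 0). { apply (Cder_unique Q 0); auto. apply DQ. rewrite Cmod_minus_diag; auto. }
  destruct (deriv_loc_bounded Q Q' 0 r0 Hr0 DQ) as [r1 [M [Hr1 [Hr10 HM]]]].
  set (L := 8 * M / r1).
  assert (HL : forall xi, Cmod xi < r1 / 2 -> Cmod (Q' xi) <= L * Cmod xi).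
  { intros xi Hxi. replace (Q' xi) with (Q' xi - Q' 0)%C by (rewrite EQ0; ring). replace xi with (xi - 0)%C at 2 by ring.
    apply deriv_lipschitz with Q (RtoC 0); auto. apply Dholo_sub with (RtoC 0) r0; auto. rewrite Cmod_minus_diag; lra.
    replace (xi - 0)%C with xi by ring. auto. rewrite Cmod_minus_diag; lra. }
  assert (HM0 : 0 <= M). { assert (h := HM 0). rewrite Cmod_minus_diag in h. assert (h' := Cmod_ge_0 (Q' 0)). lra. }
  assert (HL0 : 0 <= L) by (apply Rdiv_le_0_compat; lra).
  assert (HQ : forall xi, Cmod xi < r1 / 2 -> Cmod (Q xi) <= L * Cmod xi * Cmod xi).
  { intros xi Hxi. replace (Q xi) with (Q xi - Q 0)%C. replace xi with (xi - 0)%C at 3 by ring.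
    assert (Sg : forall t, 0 <= t <= 1 -> Cmod (Cseg 0 xi t) <= Cmod xi).
    { intros t Ht. replace (Cseg 0 xi t) with (RtoC t * xi)%C by (unfold Cseg; apply injective_projections; simpl; ring).
      rewrite Cmod_mult, Cmod_R, Rabs_pos_eq by lra. assert (h := Cmod_ge_0 xi). nra. }
    apply (Cmvt Q Q').
    - intros t Ht. apply DQ. replace (Cseg 0 xi t - 0)%C with (Cseg 0 xi t) by (apply injective_projections; simpl; ring). specialize (Sg t Ht). lra.
    - intros t Ht. specialize (Sg t Ht). eapply Rle_trans. apply HL. lra. apply Rmult_le_compat_l; auto.
    - unfold Q. destruct (Ceq_dec 0 0); [|tauto]. apply injective_projections; simpl; ring. }
  exists (L + 1), (Rmax X0 (- IZR k * ln (r1 / 2))). split. lra. intros u Hu HX.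
  assert (HXa : X0 < fst u /\ - IZR k * ln (r1 / 2) < fst u) by (unfold Rmax in HX; destruct Rle_dec; lra).
  destruct HXa as [Ha Hb]. destruct (HX0 u Ha) as [_ Hgu].
  set (v := (/ nk * u)%C). assert (Nk : nk <> 0).
  { intros E. apply (f_equal fst) in E. unfold nk in E. simpl in E. lra. }
  assert (Ev : (nk * v)%C = u) by (unfold v; field; auto).
  set (xi := Cexp v).
  assert (Fv : fst v = - (fst u / IZR k)). { assert (h := Fnk v). rewrite Ev in h. rewrite h. field. lra. }
  assert (Mxi : Cmod xi = exp (- (fst u / IZR k))) by (unfold xi; rewrite Cmod_Cexp, Fv; auto).
  assert (S1 : Cmod xi < r1 / 2).
  { rewrite Mxi. rewrite <- (exp_ln (r1 / 2)) by lra. apply exp_increasing.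
    apply Rmult_lt_reg_l with (IZR k); auto. replace (IZR k * - (fst u / IZR k)) with (- fst u) by (field; lra). lra. }
  assert (S2 : Cmod xi < r0) by lra.
  assert (Nx : xi <> 0) by apply Cexp_neq_0. assert (Pm := proj1 (Cmod_gt_0 _) Nx).
  specialize (HQ xi S1). unfold Q in HQ. destruct (Ceq_dec xi 0) as [|_]; [tauto|].
  rewrite Cmod_mult in HQ. unfold q in HQ. rewrite (Same xi (lg xi) v) in HQ; auto. 2: apply Hlg; auto.
  rewrite Ev, Cmod_inv in HQ by (apply Cmod_gt_0; lra).
  assert (HQ2 : / Cmod (g u) <= L * Cmod xi).
  { apply Rmult_le_reg_l with (Cmod xi); auto. lra. }
  rewrite Mxi, exp_Ropp in HQ2. set (X := exp (fst u / IZR k)) in *. assert (HX1 : 0 < X) by apply exp_pos.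
  apply Rmult_le_compat_r with (r := X * Cmod (g u)) in HQ2. 2: nra.
  replace (/ Cmod (g u) * (X * Cmod (g u))) with X in HQ2 by (field; lra).
  replace (L * / X * (X * Cmod (g u))) with (L * Cmod (g u)) in HQ2 by (field; lra). nra.
Qed.

(** Outside a disc every point is [g u], and for large [fst u] the modulus of [f (g u)], which is
    [exp (fst u / IZR k)] to the power [k], is at most [L * Cmod (g u)] to the power [k]. Elsewhere
    [f] is bounded. *)
Lemma periodic_lift_polynomial : is_polynomial f.
Proof.
  assert (HK : 0 < IZR k) by (apply IZR_lt; auto).
  destruct lift_covers_infinity as [M HM]. destruct lift_growth as [L [X [HL HX]]].
  destruct (bounded_disc f 0 M) as [B HB].
  { intros z _. apply Ccont_loc_bounded. eapply Cder_cont; apply Hf. }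
  set (n := Z.to_nat k). assert (En : INR n = IZR k) by (unfold n; rewrite INR_IZR_INZ, Z2Nat.id; auto; lia).
  set (A := Rabs B + exp X + L ^ n).
  assert (HA : 0 <= L ^ n) by (apply pow_le; lra). assert (HB0 := Rabs_pos B). assert (HB1 := Rle_abs B). assert (HX0 := exp_pos X).
  apply poly_growth with n f' A; auto. intros z. assert (Hz := Cmod_ge_0 z).
  assert (P1 : 1 <= (1 + Cmod z) ^ n) by (apply pow_R1_Rle; lra).
  assert (Small : forall b, b <= Rabs B + exp X -> b <= A * (1 + Cmod z) ^ n).
  { intros b Hb. unfold A. apply Rle_trans with ((Rabs B + exp X + L ^ n) * 1). lra. apply Rmult_le_compat_l; lra. }
  destruct (Rle_lt_dec (Cmod z) M) as [h|h].
  - apply Small. assert (h' := HB z). replace (z - 0)%C with z in h' by ring. specialize (h' h). lra.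
  - destruct (HM z h) as [u [Hu <-]]. rewrite lift_Cmod by auto.
    destruct (Rle_lt_dec (fst u) X) as [h1|h1].
    + apply Small. apply exp_le_mono in h1. lra.
    + specialize (HX u Hu h1). 
      assert (E : exp (fst u) = exp (fst u / IZR k) ^ n).
      { clear - En HK. rewrite <- Rpower_pow by apply exp_pos. unfold Rpower. rewrite ln_exp, En. f_equal. field. lra. }
      rewrite E. apply Rle_trans with ((L * Cmod (g u)) ^ n).
      apply pow_incr. split; auto. left; apply exp_pos.
      rewrite Rpow_mult_distr. unfold A.
      apply Rmult_le_compat; auto. apply pow_le; auto. lra. apply pow_incr. lra.
Qed.
End Injectivity.

(** Two points with the same image differ by a multiple of the period, and uniqueness of lifts
    spreads this coincidence to a period of [g]. The sign of [k] is normalized at the end. *)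
Lemma exp_lift_injective (f f' : C -> C) (x0 : R) (g : C -> C) : (forall z, Cder f z (f' z)) -> x0 < 0 ->
  (forall u, right_half x0 u -> regular_value f f' (0 + Cexp u)%C) -> ~ is_polynomial f ->
  exp_lift f (right_half x0) 0 g -> forall u v, right_half x0 u -> right_half x0 v -> g u = g v -> u = v.
Proof.
  intros Hf Hx Hreg Hnp Hg u v Hu Hv E.
  destruct (Cexp_eq u v) as [k Hk].
  { replace (Cexp u) with (0 + Cexp u)%C by ring. replace (Cexp v) with (0 + Cexp v)%C by ring.
    rewrite <- (proj1 (Hg u Hu)), <- (proj1 (Hg v Hv)). congruence. }
  destruct (Z.eq_dec k 0) as [->|Hk0].
  { rewrite Hk. destruct v; apply injective_projections; simpl; ring. }
  exfalso. apply Hnp.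
  assert (Per : forall w, right_half x0 w -> g (w + (0%R, (2 * PI * IZR k)%R))%C = g w).
  { apply (exp_lift_unique f f' Hf (right_half x0) 0 (right_half_convex x0) Hreg
      (fun w => g (w + (0%R, (2 * PI * IZR k)%R))%C) g v); auto. 2: rewrite <- Hk; auto.
    intros w Hw. destruct (Hg _ (right_half_period x0 w k Hw)) as [A B]. split.
    rewrite A. rewrite Cexp_period. auto.
    apply (Ccont_comp g (fun w => w + (0%R, (2 * PI * IZR k)%R))%C); auto.
    apply Ccont_plus. apply Ccont_id. apply Ccont_const. }
  destruct (Z_lt_le_dec 0 k) as [h|h].
  - apply (periodic_lift_polynomial f f' Hf x0 Hx Hreg g Hg k h Per).
  - apply (periodic_lift_polynomial f f' Hf x0 Hx Hreg g Hg (- k)). lia.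
    intros w Hw. rewrite <- (Per (w + (0%R, (2 * PI * IZR (- k))%R))%C).
    f_equal. rewrite opp_IZR. destruct w; apply injective_projections; simpl; ring.
    apply right_half_period; auto.
Qed.

(** * Partition arcs and edges *)

Lemma Cexp_surj_angle (w : C) : w <> 0 -> exists y, 0 <= y < 2 * PI /\ Cexp (ln (Cmod w), y) = w.
Proof.
  intros Hw. destruct (Cexp_surj w Hw) as [[x y] [E1 E2]]. simpl in E2. subst x. assert (Hpi := PI_RGT_0).
  set (q := Int_part (y / (2 * PI))). destruct (base_Int_part (y / (2 * PI))) as [B1 B2]. fold q in B1, B2.
  assert (Ey : y = y / (2 * PI) * (2 * PI)) by (field; lra).
  exists (y - 2 * PI * IZR q). split. split; rewrite Ey at 1; nra.
  transitivity (Cexp (ln (Cmod w), y)); [|exact E1]. rewrite <- (Cexp_period (ln (Cmod w), y) (- q)). f_equal. rewrite opp_IZR.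
  apply injective_projections; simpl; ring.
Qed.

Lemma entire_deriv (f : C -> C) : entire f -> exists f', forall z, Cder f z (f' z).
Proof.
  intros H. apply (choice (fun z l => Cder f z l)). intros z. destruct (H z) as [l Hl]. exists l. apply Cder_is_derive; auto.
Qed.

Lemma not_sing_regular (f f' : C -> C) (w : C) : (forall z, Cder f z (f' z)) -> ~ sing f w -> regular_value f f' w.
Proof.
  intros Hf Hn. split.
  - intros z Ez E0. apply Hn. intros e He. exists w. rewrite Cmod_minus_diag. split; auto. left. exists z. split; auto.
    apply Cder_is_derive. rewrite <- E0. auto.
  - intros Ha. apply Hn. intros e He. exists w. rewrite Cmod_minus_diag. split; auto.
Qed.

Section Arcs.
Variables (f f' : C -> C).
Hypothesis Hf : forall z, Cder f z (f' z).
Variables (a : C) (eps : R).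
Hypothesis Heps : 0 < eps.
Hypothesis Vreg : forall u, left_half (ln (4 * eps)) u -> regular_value f f' (a + Cexp u)%C.

Let V := left_half (ln (4 * eps)).

Lemma ln_lt_ln4 : ln eps < ln (4 * eps).
Proof. apply ln_increasing; lra. Qed.

Lemma closure_level (L : cset) (z : C) : (forall w, L w -> Cmod (f w - a) = eps) -> closure L z -> Cmod (f z - a) = eps.
Proof.
  intros HL Hcl. apply cond_eq. intros e He.
  destruct (Cder_cont _ _ _ (Hf z) e He) as [d [Hd HD]]. destruct (Hcl d Hd) as [v [Lv Hv]]. specialize (HD v Hv).
  rewrite <- (HL v Lv). replace (f v - f z)%C with ((f v - a) - (f z - a))%C in HD by ring.
  assert (T1 := Cmod_tri_rev (f v - a) (f z - a)). assert (T2 := Cmod_tri_rev (f z - a) (f v - a)).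
  rewrite (Cmod_sym (f z - a) (f v - a)) in T2. apply Rabs_def1; lra.
Qed.

Lemma boundary_Wset (z : C) : boundary (Wset f a eps) z -> Cmod (f z - a) = eps.
Proof.
  intros [H1 H2]. apply Rle_antisym.
  - apply le_epsilon. intros e He.
    destruct (Cder_cont _ _ _ (Hf z) e He) as [d [Hd HD]]. destruct (H1 d Hd) as [v [Lv Hv]]. specialize (HD v Hv).
    unfold Wset in Lv. assert (T := Cmod_tri3 (f z) (f v) a). rewrite (Cmod_sym (f z) (f v)) in T. lra.
  - apply Rnot_lt_le. intros Hlt. apply H2.
    destruct (Cder_cont _ _ _ (Hf z) (eps - Cmod (f z - a)) ltac:(lra)) as [d [Hd HD]].
    exists d. split; auto. intros v Hv. specialize (HD v Hv). unfold Wset. assert (T := Cmod_tri3 (f v) (f z) a). lra.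
Qed.

Lemma lift_level (g : C -> C) (u : C) : exp_lift f V a g -> V u -> Cmod (f (g u) - a) = exp (fst u).
Proof.
  intros Hg Hu. rewrite (proj1 (Hg u Hu)). replace (a + Cexp u - a)%C with (Cexp u) by ring. apply Cmod_Cexp.
Qed.

Lemma lift_boundary_Wset (g : C -> C) (u : C) : exp_lift f V a g -> fst u = ln eps -> boundary (Wset f a eps) (g u).
Proof.
  intros Hg Hu. assert (Hl := ln_lt_ln4). assert (Vu : V u) by (unfold V, left_half; lra). split.
  - intros e He. destruct (proj2 (Hg u Vu) e He) as [d [Hd HD]].
    set (v := (u - RtoC (d / 2))%C). assert (Fv : fst v = ln eps - d / 2) by (unfold v; simpl; lra).
    exists (g v). split.
    + unfold Wset. rewrite lift_level; auto. rewrite Fv. rewrite <- (exp_ln eps) at 2 by auto. apply exp_increasing; lra.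
      unfold V, left_half. lra.
    + apply HD. unfold v. replace (u - RtoC (d / 2) - u)%C with (- RtoC (d / 2))%C by ring.
      rewrite Cmod_opp, Cmod_R, Rabs_pos_eq; lra.
  - intros [e [He H]]. specialize (H (g u)). rewrite Cmod_minus_diag in H. specialize (H He). unfold Wset in H.
    rewrite lift_level, Hu, exp_ln in H; auto. lra.
Qed.

(** The lift through one point of the component sends the open segment of angles between 0 and
    [2 * PI] onto a relatively open and closed part [L] of the level curve without the preimages of
    [a + eps]; hence [L] is the component. The closure adds the images of both ends of the segment,
    which may coincide. *)
Lemma partition_arc_param (I : cset) : partition_arc f a eps I ->
  exists g, exp_lift f V a g /\ forall z, I z <-> exists y, 0 <= y <= 2 * PI /\ z = g (ln eps, y).
Proof.
  intros [K [HK ->]]. assert (Hl := ln_lt_ln4). assert (Hpi := PI_RGT_0).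
  set (X := fun z => boundary (Wset f a eps) z /\ f z <> (a + RtoC eps)%C) in *.
  assert (VV : forall y, V (ln eps, y)) by (intros y; unfold V, left_half; simpl; lra).
  assert (Ang : forall z, Cmod (f z - a) = eps -> exists y, 0 <= y < 2 * PI /\ f z = (a + Cexp (ln eps, y))%C /\ (f z <> (a + RtoC eps)%C -> 0 < y)).
  { intros z Hz. destruct (Cexp_surj_angle (f z - a)%C) as [y [Hy Ey]]. apply Cmod_gt_0; lra. rewrite Hz in Ey.
    exists y. assert (E : f z = (a + Cexp (ln eps, y))%C) by (rewrite Ey; ring). split; auto. split; auto.
    intros N. destruct Hy as [[Hy|Hy] _]; auto. exfalso. apply N. rewrite E, <- Hy. f_equal.
    unfold Cexp, RtoC; simpl. rewrite exp_ln, cos_0, sin_0 by auto. f_equal; ring. }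
  destruct (proj1 (proj2 HK)) as [z1 Kz1]. destruct (proj1 HK z1 Kz1) as [B1 N1].
  destruct (Ang z1 (boundary_Wset z1 B1)) as [y1 [Hy1 [E1 P1]]]. specialize (P1 N1).
  destruct (exp_lift_exists f f' Hf V a (left_half_convex _) (left_half_open _) Vreg (ln eps, y1) z1 (VV y1) E1) as [g [Hg Eg]].
  exists g. split; auto.
  set (A := fun u : C => fst u = ln eps /\ 0 < snd u < 2 * PI).
  assert (AV : forall u, A u -> V u) by (intros u [h _]; unfold V, left_half; lra).
  set (L := fun z => exists u, A u /\ z = g u).
  assert (Llev : forall w, L w -> Cmod (f w - a) = eps).
  { intros w [u [Hu ->]]. rewrite lift_level by auto. rewrite (proj1 Hu). apply exp_ln; auto. }
  assert (LX : subset L X).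
  { intros w [u [Hu ->]]. split. apply lift_boundary_Wset; auto. apply Hu.
    intros E. rewrite (proj1 (Hg u (AV u Hu))) in E.
    destruct Hu as [Hu1 Hu2]. destruct u as [x y]. simpl in *. subst x.
    assert (E' : Cexp (ln eps, y) = Cexp (ln eps, 0)).
    { replace (Cexp (ln eps, y)) with (a + Cexp (ln eps, y) - a)%C by ring. rewrite E.
      unfold Cexp; simpl. rewrite exp_ln, cos_0, sin_0 by auto. apply injective_projections; simpl; ring. }
    destruct (Cexp_eq _ _ E') as [k Hk]. apply (f_equal snd) in Hk. simpl in Hk.
    assert (h1 : 0 < IZR k) by nra. assert (h2 : IZR k < 1) by nra. apply lt_IZR in h1. apply lt_IZR in h2. lia. }
  assert (Lconn : connected L).
  { apply connected_convex_image. intros u v t [Hu1 Hu2] [Hv1 Hv2] Ht. split. rewrite fst_Cseg; rewrite Hu1, Hv1; ring.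
    rewrite snd_Cseg. destruct (Rle_lt_dec t 0). replace t with 0 by lra. lra. nra. intros u Hu. apply Hg. auto. }
  assert (Lz1 : L z1). { exists (ln eps, y1). split; auto. split; simpl; lra. }
  (* Within [Rmin y (2 * PI - y)] of an angle of the open interval, no translate of [y] by a nonzero
     period can occur, so [k] is 0. *)
  assert (Cl : forall z y, 0 < y < 2 * PI -> f z = (a + Cexp (ln eps, y))%C -> closure L z -> z = g (ln eps, y)).
  { intros z y Hy Ey Hcl.
    destruct (exp_lift_closure f f' Hf V a (left_half_convex _) (left_half_open _) (left_half_period _) Vreg g (ln eps, y) z A (Rmin y (2 * PI - y)))
      as [u [k [[Au1 Au2] [Hu Ez]]]]; auto. apply Rmin_pos; lra.
    apply snd_close in Hu. simpl in Hu. assert (h1 := Rmin_l y (2 * PI - y)). assert (h2 := Rmin_r y (2 * PI - y)).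
    apply Rabs_def2 in Hu.
    assert (k = 0%Z). { assert (h3 : -1 < IZR k) by nra. assert (h4 : IZR k < 1) by nra. apply lt_IZR in h3. apply lt_IZR in h4. lia. }
    subst k. rewrite <- Ez. f_equal. apply injective_projections; simpl; ring. }
  assert (LK : subset L K) by (apply component_maximal with X z1; auto).
  assert (KL : subset K L).
  (* The open witness is the image of the whole strip of angles; on the level curve the modulus of
     [f z - a] forces the real part to be [ln eps]. *)
  { apply connected_clopen with (X := X) (U := fun z => exists u, (V u /\ 0 < snd u < 2 * PI) /\ z = g u).
    - apply HK.
    - apply HK.
    - intros z [u [[Hu1 Hu2] ->]].
      destruct (exp_lift_open f f' Hf V a (left_half_open _) Vreg g u (Rmin (snd u) (2 * PI - snd u)) Hg Hu1) as [d [Hd HD]]. apply Rmin_pos; lra.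
      exists d. split; auto. intros w Hw. destruct (HD w Hw) as [v [Vv [Hv1 Hv2]]]. exists v. split; auto. split; auto.
      apply snd_close in Hv1. apply Rabs_def2 in Hv1. assert (h1 := Rmin_l (snd u) (2 * PI - snd u)). assert (h2 := Rmin_r (snd u) (2 * PI - snd u)). lra.
    - intros z [u [Hu ->]]. exists u. split; auto. split; auto. apply Hu.
    - intros z Xz [u [[Hu1 Hu2] ->]]. exists u. split; auto. split; auto.
      assert (h := boundary_Wset _ (proj1 Xz)). rewrite lift_level in h by auto. rewrite <- h. symmetry; apply ln_exp.
    - intros z [Bz Nz] Hcl. destruct (Ang z (boundary_Wset z Bz)) as [y [Hy [Ey Py]]]. specialize (Py Nz).
      exists (ln eps, y). split. split; simpl; lra. apply Cl; auto. lra.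
    - exists z1. auto. }
  assert (EKL : K = L). { apply functional_extensionality. intros z. apply propositional_extensionality. split; auto. }
  rewrite EKL. intros z. split.
  - intros Hcl. destruct (Ang z (closure_level L z Llev Hcl)) as [y [Hy [Ey _]]].
    destruct (Rle_lt_dec y 0) as [h|h].
    + assert (y = 0) by lra. subst y.
      destruct (exp_lift_closure f f' Hf V a (left_half_convex _) (left_half_open _) (left_half_period _) Vreg g (ln eps, 0) z A PI)
        as [u [k [[Au1 Au2] [Hu Ez]]]]; auto.
      apply snd_close in Hu. simpl in Hu. apply Rabs_def2 in Hu.
      (* Above [a + eps] two translates remain, and they are the two ends of the arc. *)
      assert (h3 : -1 < IZR k) by nra. assert (h4 : IZR k < 2) by nra. apply lt_IZR in h3. apply lt_IZR in h4.
      exists (2 * PI * IZR k). assert (hk : 0 <= IZR k <= 1) by (split; apply IZR_le; lia). split. nra.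
      rewrite <- Ez. f_equal. apply injective_projections; simpl; ring.
    + exists y. split. lra. apply Cl; auto. lra.
  - intros [y [Hy ->]]. apply (exp_lift_image_closure f V a); auto.
    (* The angle is moved slightly towards [PI], which brings an end into the open interval. *)
    intros e He. set (t := Rmin (1/2) (e / (4 * PI))).
    assert (Ht : 0 < t /\ t <= 1/2 /\ t <= e / (4 * PI)).
    { assert (0 < e / (4 * PI)) by (apply Rdiv_lt_0_compat; lra). unfold t, Rmin; destruct Rle_dec; lra. }
    exists (ln eps, y + t * (PI - y)). split. split; simpl; auto. nra.
    replace ((ln eps, (y + t * (PI - y))%R) - (ln eps, y))%C with (Ci * RtoC (t * (PI - y)))%C by (apply injective_projections; simpl; ring).
    rewrite Cmod_mult, Cmod_Ci, Cmod_R, Rmult_1_l, Rabs_mult, (Rabs_pos_eq t) by lra.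
    assert (Rabs (PI - y) <= PI) by (apply Rabs_le; lra).
    apply Rle_lt_trans with (e / (4 * PI) * PI). apply Rmult_le_compat; try lra. apply Rabs_pos.
    replace (e / (4 * PI) * PI) with (e / 4) by (field; lra). lra.
Qed.
End Arcs.

Section Edges.
Variables (f f' : C -> C).
Hypothesis Hf : forall z, Cder f z (f' z).
Variable x0 : R.
Hypothesis Hx0 : x0 < 0.
Hypothesis Vreg : forall u, right_half x0 u -> regular_value f f' (0 + Cexp u)%C.
Hypothesis Hnp : ~ is_polynomial f.

Let V := right_half x0.

(** The branch of the logarithm is the inverse [tau] of the injective lift [g], and the component of
    [Omega f] is the image of the right half-plane. Since [g] is an open map on a larger half-plane,
    [tau] is continuous up to the boundary of the component. All [k] are offered; the caller picks
    the edge through [z0]. *)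
Lemma edge_param (z0 : C) (th : R) : f z0 = Cexp (0, th) ->
  exists g, exp_lift f V 0 g /\ g (0, th) = z0 /\
  forall k : Z, exists J, edge f J /\ forall z, J z <-> exists y, PI * IZR k <= y <= PI * (IZR k + 1) /\ z = g (0, y).
Proof.
  intros Hz0.
  assert (V0 : forall u : C, 0 <= fst u -> V u) by (intros u Hu; unfold V, right_half; lra).
  destruct (exp_lift_exists f f' Hf V 0 (right_half_convex _) (right_half_open _) Vreg (0, th) z0) as [g [Hg Eg]].
  { apply V0. simpl. lra. } { rewrite Cplus_0_l. auto. }
  exists g. split; auto. split; auto. intros k.
  assert (Inj : forall u v, V u -> V v -> g u = g v -> u = v) by (apply (exp_lift_injective f f' x0 g); auto).
  assert (Fg : forall u, V u -> f (g u) = Cexp u) by (intros u Hu; rewrite (proj1 (Hg u Hu)); ring).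
  assert (Ex : forall z, exists u, forall v, V v -> g v = z -> u = v).
  { intros z. destruct (classic (exists v, V v /\ g v = z)) as [[v [Vv Ev]]|h].
    - exists v. intros v' Vv' Ev'. apply Inj; auto. congruence.
    (* An arbitrary value of [tau] off the image of [g]. *)
    - exists (RtoC 0). intros v Vv Ev. exfalso. eauto. }
  destruct (choice _ Ex) as [tau Htau].
  assert (Tg : forall u, V u -> tau (g u) = u) by (intros u Hu; apply Htau; auto).
  set (A := right_half 0). assert (AV : forall u, A u -> V u) by (intros u Hu; apply V0; unfold A, right_half in Hu; lra).
  set (O := fun z => exists u, A u /\ z = g u).
  assert (Ocl : forall z, closure O z -> exists u, 0 <= fst u /\ z = g u) by (intros z; apply (right_lift_closure f f' x0); auto).
  assert (Ocl2 : forall u, 0 <= fst u -> closure O (g u)).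
  { intros u Hu. apply (exp_lift_image_closure f V 0); auto. intros e He.
    exists (u + RtoC (e / 2))%C. split. unfold A, right_half; simpl; lra.
    replace (u + RtoC (e / 2) - u)%C with (RtoC (e / 2)) by ring. rewrite Cmod_R, Rabs_pos_eq; lra. }
  assert (TC : forall u, V u -> Ccont tau (g u)).
  { intros u Hu e He. destruct (exp_lift_open f f' Hf V 0 (right_half_open x0) Vreg g u e Hg Hu He) as [d [Hd HD]].
    exists d. split; auto. intros z Hz. destruct (HD z Hz) as [v [Vv [Hv1 Hv2]]]. rewrite <- Hv2, !Tg by auto. auto. }
  assert (Oopen : Copen O) by (apply (right_image_open f f' x0); auto).
  exists (fun z => closure O z /\ fst (tau z) = 0 /\ PI * IZR k <= snd (tau z) <= PI * (IZR k + 1)). split.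
  - exists O, tau, k. split; [|split; [|split; [|split; [|split; [|split; [|split]]]]]]; auto.
    + split; [|split; [|split]].
      * intros z [u [Au ->]]. unfold Omega. rewrite Fg, Cmod_Cexp by auto. rewrite <- exp_0. apply exp_increasing. apply Au.
      * exists (g (RtoC 1)), (RtoC 1). split; auto. unfold A, right_half; simpl; lra.
      * apply connected_convex_image. intros; apply right_half_convex; auto. intros u Hu. apply Hg. auto.
      (* Maximality: a limit point of [O] is a value of [g] on the closed half-plane, and inside
         [Omega f] its real part is positive. *)
      * intros K' HK' OK' KO'. apply connected_clopen with (X := Omega f) (U := O); auto.
        -- intros w; auto.
        -- intros z Oz Hcl. destruct (Ocl z Hcl) as [u [E2 ->]]. exists u. split; auto.
           unfold Omega in Oz. rewrite Fg, Cmod_Cexp, <- exp_0 in Oz by auto. apply exp_lt_inv; auto.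
        -- exists (g (RtoC 1)). assert (O (g (RtoC 1))). { exists (RtoC 1). split; auto. unfold A, right_half; simpl; lra. } split; auto.
    + intros z [u [Au ->]]. assert (Vu := AV u Au).
      assert (Dg : Cder g u (Cexp u / f' (g u))).
      { apply (exp_lift_deriv f f' V 0); auto. apply right_half_open. }
      exists (1 / (Cexp u / f' (g u)))%C. apply Cder_is_derive.
      destruct (exp_lift_open f f' Hf V 0 (right_half_open x0) Vreg g u 1 Hg Vu ltac:(lra)) as [d [Hd HD]].
      apply (Cder_lift g tau (fun w => w) (g u) _ 1 d); auto.
      * intros w Hw. destruct (HD w Hw) as [v [Vv [_ Ev]]]. rewrite <- Ev, Tg by auto. auto.
      * rewrite Tg; auto.
      * intros E. apply (Cexp_neq_0 u). replace (Cexp u) with (Cexp u / f' (g u) * f' (g u))%C. rewrite E. ring.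
        field. apply (Vreg u Vu). apply Hg; auto.
      * apply Cder_id.
    + intros z [u [Au ->]]. rewrite Tg by auto. apply Au.
    + intros z w [u [Au ->]] [v [Av ->]] E. rewrite !Tg in E by auto. congruence.
    + intros u Hu. exists (g u). rewrite Tg. split; auto. exists u; auto. apply V0; lra.
    + intros z Hcl e He. destruct (Ocl z Hcl) as [u [E2 ->]].
      destruct (TC u (V0 u E2) e He) as [d [Hd HD]]. exists d. split; auto.
    + intros z Hcl. destruct (Ocl z Hcl) as [u [E2 ->]]. rewrite Tg, Fg; auto.
  - intros z. split.
    + intros [Hcl [T1 T2]]. destruct (Ocl z Hcl) as [u [E2 ->]]. rewrite Tg in T1, T2 by auto.
      exists (snd u). split; auto. rewrite <- T1, <- surjective_pairing. auto.
    + intros [y [Hy ->]]. rewrite Tg by (apply V0; simpl; lra). simpl. split; auto. apply Ocl2; simpl; lra.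
Qed.
End Edges.

(** * Diameters, lengths and chains *)

(** A member and a bound keep the extended supremum finite, so that [real] does not return its
    default value. *)
Lemma real_Lub (E : R -> Prop) (x M : R) : E x -> (forall y, E y -> y <= M) ->
  real (Lub_Rbar E) <= M /\ forall y, E y -> y <= real (Lub_Rbar E).
Proof.
  intros Ex HM. destruct (Lub_Rbar_correct E) as [H1 H2].
  assert (h := H2 (Finite M)). assert (h' := H1 x Ex).
  assert (hM : Rbar_le (Lub_Rbar E) (Finite M)) by (apply h; intros y Hy; apply HM; auto).
  destruct (Lub_Rbar E) as [l| |]; simpl in *; try contradiction.
  split; auto.
Qed.

Lemma real_Glb (E : R -> Prop) (x m : R) : E x -> (forall y, E y -> m <= y) ->
  m <= real (Glb_Rbar E) /\ forall y, E y -> real (Glb_Rbar E) <= y.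
Proof.
  intros Ex HM. destruct (Glb_Rbar_correct E) as [H1 H2].
  assert (h := H2 (Finite m)). assert (h' := H1 x Ex).
  assert (hM : Rbar_le (Finite m) (Glb_Rbar E)) by (apply h; intros y Hy; apply HM; auto).
  destruct (Glb_Rbar E) as [l| |]; simpl in *; try contradiction.
  split; auto.
Qed.

Lemma diam_bounds (A : cset) (m M : R) : (forall z w, A z -> A w -> Cmod (z - w) <= M) ->
  (exists z w, A z /\ A w /\ m <= Cmod (z - w)) ->
  m <= diam A /\ diam A <= M /\ forall z w, A z -> A w -> Cmod (z - w) <= diam A.
Proof.
  intros HM [z [w [Az [Aw Hm]]]].
  destruct (real_Lub (fun d => exists z w, A z /\ A w /\ d = Cmod (z - w)) (Cmod (z - w)) M) as [H1 H2].
  - exists z, w; auto.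
  - intros y [p [q [Ap [Aq ->]]]]. auto.
  - assert (H3 : forall z w, A z -> A w -> Cmod (z - w) <= diam A) by (intros p q Hp Hq; apply H2; exists p, q; auto).
    split; [|split]; auto. specialize (H3 z w Az Aw). lra.
Qed.

Lemma setdist_bounds (A B : cset) (m M : R) : (forall z w, A z -> B w -> m <= Cmod (z - w)) ->
  (exists z w, A z /\ B w /\ Cmod (z - w) <= M) -> m <= setdist A B <= M.
Proof.
  intros Hm [z [w [Az [Bw HM]]]].
  destruct (real_Glb (fun d => exists z w, A z /\ B w /\ d = Cmod (z - w)) (Cmod (z - w)) m) as [H1 H2].
  - exists z, w; auto.
  - intros y [p [q [Ap [Aq ->]]]]. auto.
  - split. exact H1. apply Rle_trans with (2 := HM). apply H2. exists z, w; auto.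
Qed.

Lemma nbhd_of_close (A : cset) (z w : C) (r : R) : A w -> Cmod (z - w) < r * diam A -> nbhd A r z.
Proof.
  intros Aw H. unfold nbhd. eapply Rle_lt_trans. 2: apply H.
  destruct (real_Glb (fun d => exists w, A w /\ d = Cmod (z - w)) (Cmod (z - w)) 0) as [_ H2]; eauto.
  intros y [v [_ ->]]. apply Cmod_ge_0.
Qed.

Lemma comparable_bounds (c d x y : R) : 0 < c -> c <= x <= d -> c <= y <= d -> comparable (d / c) x y.
Proof.
  intros Hc Hx Hy. assert (Hd : 0 < d) by lra. split.
  - apply Rle_trans with c; [|lra]. unfold Rdiv. rewrite Rinv_mult, Rinv_inv.
    apply Rmult_le_reg_r with d; auto. replace (x * (/ d * c) * d) with (x * c) by (field; lra). nra.
  - apply Rle_trans with d; [lra|]. replace d with (d / c * c) at 1 by (field; lra).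
    apply Rmult_le_compat_l; [|lra]. left; apply Rdiv_lt_0_compat; auto.
Qed.

Lemma increasing_from_le1 (ts : list R) : forall t, increasing_from t ts -> t <= 1.
Proof.
  induction ts; simpl; intros t H. lra. destruct H as [H1 H2]. specialize (IHts _ H2). lra.
Qed.

Lemma polysum_lipschitz (gam : R -> C) (L : R) :
  (forall s t, 0 <= s <= 1 -> 0 <= t <= 1 -> Cmod (gam s - gam t) <= L * Rabs (s - t)) ->
  forall ts t, 0 <= t -> increasing_from t ts -> polysum gam (t :: ts) <= L * (1 - t).
Proof.
  intros HL. induction ts; intros t Ht H.
  - simpl in *. subst. lra.
  - destruct H as [H1 H2]. change (Cmod (gam a - gam t) + polysum gam (a :: ts) <= L * (1 - t)).
    specialize (IHts a ltac:(lra) H2). apply increasing_from_le1 in H2.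
    specialize (HL a t ltac:(lra) ltac:(lra)). rewrite Rabs_pos_eq in HL by lra. lra.
Qed.

(** The length is at least the diameter, by polygons through 0, two given parameters and 1, and at
    most the Lipschitz constant. As the diameter is at least [c], the ratio [L / c] serves both
    inequalities. *)
Lemma length_comparable_lipschitz (A : cset) (gam : R -> C) (c L : R) : 0 < c -> 0 <= L ->
  (forall s t, 0 <= s < 1 -> 0 <= t < 1 -> gam s = gam t -> s = t) ->
  (forall z, A z <-> exists t, 0 <= t <= 1 /\ gam t = z) ->
  (forall t, continuous gam t) ->
  (forall s t, 0 <= s <= 1 -> 0 <= t <= 1 -> Cmod (gam s - gam t) <= L * Rabs (s - t)) ->
  c <= diam A -> c <= L -> length_comparable (L / c) A.
Proof.
  intros Hc HL0 Hinj HA Hcont HL Hd HcL. exists gam. split; [split; [|split]|]; auto.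
  set (E := fun x => exists ts, increasing_from 0 ts /\ x = polysum gam (0 :: ts)).
  destruct (Lub_Rbar_correct E) as [H1 H2]. change (Rbar_le (diam A / (L / c)) (Lub_Rbar E) /\ Rbar_le (Lub_Rbar E) (L / c * diam A)).
  assert (Hp : forall z w, A z -> A w -> Rbar_le (Cmod (z - w)) (Lub_Rbar E)).
  { assert (Ho : forall s t, 0 <= s <= t -> t <= 1 -> Rbar_le (Cmod (gam t - gam s)) (Lub_Rbar E)).
    { intros s t Hs Ht. apply Rbar_le_trans with (polysum gam (0 :: s :: t :: 1 :: nil)).
      simpl. assert (h1 := Cmod_ge_0 (gam s - gam 0)). assert (h2 := Cmod_ge_0 (gam 1 - gam t)). lra.
      apply H1. exists (s :: t :: 1 :: nil). split; auto. simpl. lra. }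
    intros z w Az Aw. apply HA in Az. apply HA in Aw. destruct Az as [s [Hs <-]]. destruct Aw as [t [Ht <-]].
    destruct (Rle_lt_dec s t). rewrite Cmod_sym. apply Ho; lra. apply Ho; lra. }
  assert (HU : Rbar_le (Lub_Rbar E) L).
  { apply H2. intros x [ts [Hts ->]]. simpl. replace L with (L * (1 - 0)) by ring. apply (polysum_lipschitz gam L HL ts 0); auto. lra. }
  assert (A0 : A (gam 0)) by (apply HA; exists 0; split; [lra|auto]).
  destruct (Lub_Rbar E) as [l| |]; simpl in *; try tauto.
  2:{ specialize (Hp _ _ A0 A0). tauto. }
  assert (Dl : diam A <= l).
  { apply (diam_bounds A 0 l). intros; apply Hp; auto. exists (gam 0), (gam 0). split; auto. split; auto. apply Cmod_ge_0. }
  split.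
  - apply Rle_trans with (diam A); auto. assert (1 <= L / c).
    { apply Rmult_le_reg_r with c; auto. unfold Rdiv. rewrite Rmult_assoc, Rinv_l; lra. }
    apply Rmult_le_reg_r with (L / c). lra. unfold Rdiv at 1. rewrite Rmult_assoc, Rinv_l by lra. nra.
  - apply Rle_trans with L; auto. apply Rle_trans with (L / c * c). right; field; lra. apply Rmult_le_compat_l; auto.
    apply Rdiv_le_0_compat; auto.
Qed.

Section Tents.
Variables (a : C) (h : R).
Hypothesis Hh : 0 < h.

(* A roof over the points of [l] at height within [h] of [a]. The other points of [l] stay clear of it
   because distinct points are [8 * h] apart. *)
Fixpoint tent (l : list C) (x : R) : R :=
  match l with
  | nil => 0
  | b :: l' => if Rlt_dec (Rabs (snd b - snd a)) h then Rmax (tent l' x) (2 * h - Rabs (x - fst b)) else tent l' x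
  end.

Lemma tent_lipschitz l x y : Rabs (tent l x - tent l y) <= Rabs (x - y).
Proof.
  induction l as [|b l IH]; simpl. rewrite Rminus_diag, Rabs_R0. apply Rabs_pos.
  destruct Rlt_dec; auto.
  assert (T : Rabs (Rabs (x - fst b) - Rabs (y - fst b)) <= Rabs (x - y)).
  { eapply Rle_trans. apply Rabs_triang_inv2. replace (x - fst b - (y - fst b)) with (x - y) by ring. lra. }
  apply Rabs_le_between in IH. apply Rabs_le_between in T. apply Rabs_le.
  unfold Rmax. repeat destruct Rle_dec; lra.
Qed.

Lemma tent_cases l x : 0 <= tent l x <= 2 * h /\
  (forall b, In b l -> Rabs (snd b - snd a) < h -> 2 * h - Rabs (x - fst b) <= tent l x) /\
  (tent l x = 0 \/ exists b, In b l /\ Rabs (snd b - snd a) < h /\ tent l x = 2 * h - Rabs (x - fst b)).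
Proof.
  induction l as [|b l [I1 [I2 I3]]]; simpl.
  - split. lra. split; [tauto|auto].
  - assert (P := Rabs_pos (x - fst b)). destruct Rlt_dec as [r|n].
    + split; [|split].
      * unfold Rmax; destruct Rle_dec; lra.
      * intros b' [->|H] Hb'. apply Rmax_r. eapply Rle_trans. apply I2; auto. apply Rmax_l.
      * unfold Rmax; destruct Rle_dec. right. exists b; auto.
        destruct I3 as [I3|[b' [H1 [H2 H3]]]]; auto. right; exists b'; auto.
    + split; auto. split.
      * intros b' [->|H] Hb'. tauto. auto.
      * destruct I3 as [I3|[b' [H1 [H2 H3]]]]; auto. right; exists b'; auto.
Qed.

Definition tent_path (l : list C) (x : R) : C := (x, snd a + tent l x).

Lemma tent_path_lipschitz l x y : Cmod (tent_path l x - tent_path l y) <= 2 * Rabs (x - y).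
Proof.
  unfold tent_path. replace ((x, (snd a + tent l x)%R) - (y, (snd a + tent l y)%R))%C with ((x - y, tent l x - tent l y) : C)
   by (apply injective_projections; simpl; ring).
  eapply Rle_trans. apply Cmod_le_abs. assert (T := tent_lipschitz l x y). lra.
Qed.

(** A point with a roof is either horizontally far or lies more than [h / 2] below the roof. A point
    without a roof is vertically far from the line; and where the path follows the roof of some
    [b'], it is within [5 * h] of [b'], too close to be near a second point of the list. *)
Lemma tent_path_avoids l x : (forall b b', In b l -> In b' l -> b <> b' -> 8 * h < Cmod (b - b')) ->
  forall b, In b l -> h / 2 <= Cmod (tent_path l x - b).
Proof.
  intros Hsep b Hb. apply Rnot_lt_le. intros Hlt.
  destruct (tent_cases l x) as [T1 [T2 T3]].
  assert (X := fst_close _ _ _ Hlt). assert (Y := snd_close _ _ _ Hlt). unfold tent_path in X, Y. simpl in X, Y.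
  destruct (Rlt_dec (Rabs (snd b - snd a)) h) as [r|n].
  - specialize (T2 b Hb r). apply Rabs_def2 in Y. apply Rabs_def2 in r. lra.
  - destruct T3 as [T3|[b' [B1 [B2 B3]]]].
    + rewrite T3 in Y. apply n. replace (snd a + 0 - snd b) with (- (snd b - snd a)) in Y by ring. rewrite Rabs_Ropp in Y. lra.
    + assert (N : b <> b') by (intros E; subst; auto).
      specialize (Hsep b b' Hb B1 N).
      assert (D : Cmod (tent_path l x - b') <= 5 * h).
      { unfold tent_path. destruct b' as [p q]. simpl in *.
        replace ((x, (snd a + tent l x)%R) - (p, q))%C with ((x - p, snd a + tent l x - q) : C) by (apply injective_projections; simpl; ring).
        eapply Rle_trans. apply Cmod_le_abs. apply Rabs_def2 in B2.
        assert (Rabs (snd a + tent l x - q) <= 3 * h) by (apply Rabs_le; lra). lra. }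
      assert (T := Cmod_tri3 b (tent_path l x) b'). rewrite (Cmod_sym b (tent_path l x)) in T. lra.
Qed.

(** The roof over [a] reaches its full height above [a]. With [h = eps / 2] this start is
    [a + i eps], the value of [f] at a point of the arc. *)
Lemma tent_path_start l : In a l -> tent_path l (fst a) = (a + Ci * RtoC (2 * h))%C.
Proof.
  intros Ha. destruct (tent_cases l (fst a)) as [T1 [T2 _]]. specialize (T2 a Ha).
  rewrite !Rminus_diag, Rabs_R0 in T2. specialize (T2 Hh).
  unfold tent_path. assert (E : tent l (fst a) = 2 * h) by lra. rewrite E.
  apply injective_projections; simpl; ring.
Qed.
End Tents.

(** The points [gam (n / N)] are at most [R / 4] apart, so [regular_step] leads from a point above
    each to a point above the next. The factors [Kdist] multiply and the displacements add up; the
    curve itself is never lifted. *)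
Lemma chain_distortion (f f' : C -> C) (gam : R -> C) (z0 : C) (D R : R) (N : nat) :
  (forall z, Cder f z (f' z)) -> 0 < R ->
  (forall t, 0 <= t <= 1 -> forall w, Cmod (w - gam t) < R -> regular_value f f' w) ->
  (forall s t, 0 <= s <= 1 -> 0 <= t <= 1 -> Cmod (gam s - gam t) <= D * Rabs (s - t)) ->
  (0 < N)%nat -> D / INR N <= R / 4 -> f z0 = gam 0 ->
  exists z, f z = gam 1 /\ / Cmod (f' z) <= Kdist ^ N * / Cmod (f' z0) /\ / Cmod (f' z0) <= Kdist ^ N * / Cmod (f' z) /\
    Cmod (z - z0) <= INR N * R * Kdist ^ N * / Cmod (f' z0).
Proof.
  intros Hf HR Hreg HD HN HDN E0. assert (HK := Kdist_ge1). assert (HN' : 0 < INR N) by (apply lt_0_INR; auto).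
  set (l0 := / Cmod (f' z0)).
  assert (P0 : 0 < l0).
  { apply Rinv_0_lt_compat, Cmod_gt_0. apply (Hreg 0) with (f z0); auto. lra. rewrite E0, Cmod_minus_diag; auto. }
  assert (Main : forall n, (n <= N)%nat -> exists z, f z = gam (INR n / INR N) /\ / Cmod (f' z) <= Kdist ^ n * l0 /\ l0 <= Kdist ^ n * / Cmod (f' z) /\
    Cmod (z - z0) <= INR n * R * Kdist ^ n * l0).
  { induction n; intros Hn.
    - exists z0. unfold Rdiv. simpl. rewrite Rmult_0_l, Cmod_minus_diag. fold l0. repeat split; auto; lra.
    - destruct IHn as [z [Ez [Z1 [Z2 Z3]]]]. lia.
      assert (hn : 0 <= INR n / INR N <= 1 /\ 0 <= INR (S n) / INR N <= 1).
      { assert (h0 := pos_INR n). assert (h1 : INR (S n) <= INR N) by (apply le_INR; auto). rewrite S_INR in *.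
        repeat split. apply Rdiv_le_0_compat; lra. apply Rmult_le_reg_r with (INR N); auto. unfold Rdiv. rewrite Rmult_assoc, Rinv_l; lra.
        apply Rdiv_le_0_compat; lra. apply Rmult_le_reg_r with (INR N); auto. unfold Rdiv. rewrite Rmult_assoc, Rinv_l; lra. }
      destruct hn as [h1 h2].
      destruct (regular_step f f' Hf z (gam (INR (S n) / INR N)) R HR) as [z' [Ez' [Y1 [Y2 Y3]]]].
      + rewrite Ez. apply Hreg; auto.
      + rewrite Ez. eapply Rle_trans. apply HD; auto.
        replace (INR (S n) / INR N - INR n / INR N) with (/ INR N) by (rewrite S_INR; field; lra).
        rewrite Rabs_pos_eq. exact HDN. left. apply Rinv_0_lt_compat; auto.
      + exists z'. split; auto. assert (hp : 1 <= Kdist ^ n) by (apply pow_R1_Rle; auto).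
        set (lz := / Cmod (f' z)) in *. set (lz' := / Cmod (f' z')) in *. rewrite S_INR. simpl.
        split; [|split].
        * eapply Rle_trans. apply Y1. rewrite Rmult_assoc. apply Rmult_le_compat_l; lra.
        * eapply Rle_trans. apply Z2. rewrite (Rmult_comm Kdist), Rmult_assoc. apply Rmult_le_compat_l; lra.
        * assert (h0 := pos_INR n). eapply Rle_trans. apply (Cmod_tri3 _ z).
          replace ((INR n + 1) * R * (Kdist * Kdist ^ n) * l0) with
           (Kdist * R * (Kdist ^ n * l0) + Kdist * (INR n * R * Kdist ^ n * l0)) by ring.
          apply Rplus_le_compat.
          eapply Rle_trans. apply Y3. apply Rmult_le_compat_l; auto. nra.
          eapply Rle_trans. apply Z3. 
          assert (Q : 0 <= INR n * R * Kdist ^ n * l0). { repeat apply Rmult_le_pos; lra. }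
          nra. }
  destruct (Main N) as [z Hz]; auto. unfold Rdiv in Hz. rewrite Rinv_r in Hz by lra. eauto.
Qed.

(** * Comparison of arcs and edges *)

(** Common to arcs and edges. Arcs use discs of radius 1 and [n = 32], as [2 * PI] is at most
    [32 / 4]; edges use discs of radius [4 * eps] and the number [N] of the chain. *)
Lemma vertical_distortion (f f' : C -> C) (V : C -> Prop) (a : C) (g : C -> C) (x y1 y2 y0 R : R) (n : nat) :
  (forall z, Cder f z (f' z)) -> (forall u, V u -> regular_value f f' (a + Cexp u)%C) -> exp_lift f V a g ->
  0 < R <= 1 -> (forall y v, Cmod (v - (x, y)) < R -> V v) -> y1 <= y0 <= y2 -> y2 - y1 <= INR n * (R / 4) ->
  (forall y, y1 <= y <= y2 -> / Cmod (f' (g (x, y))) <= Kdist ^ n * / Cmod (f' (g (x, y0))) /\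
     / Cmod (f' (g (x, y0))) <= Kdist ^ n * / Cmod (f' (g (x, y)))) /\
  (forall s t, y1 <= s <= y2 -> y1 <= t <= y2 ->
     Cmod (g (x, s) - g (x, t)) <= exp x * (Kdist ^ n * / Cmod (f' (g (x, y0)))) * Rabs (s - t)).
Proof.
  intros Hf Hreg Hg HR HV Hy0 Hn.
  assert (U : forall y, univ_lift f f' g (fun u => a + Cexp u)%C Cexp (x, y) R).
  { intros y. apply (exp_lift_univ f f' V a Hreg); auto. intros v Hv. apply (HV y); auto. }
  assert (E : forall y, Cmod (Cexp (x, y) / f' (g (x, y))) = exp x * / Cmod (f' (g (x, y)))).
  { intros y. rewrite Cmod_div, Cmod_Cexp. reflexivity. apply (proj1 (proj2 (U y)) (x, y)). rewrite Cmod_minus_diag; lra. }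
  assert (Sg : forall s t r, Cseg (x, s) (x, t) r = (x, s + r * (t - s))).
  { intros s t r. apply injective_projections. rewrite fst_Cseg; simpl; ring. rewrite snd_Cseg; simpl; ring. }
  assert (Df : forall s t, Cmod ((x, s) - (x, t)) = Rabs (s - t)).
  { intros s t. replace ((x, s) - (x, t))%C with (Ci * RtoC (s - t))%C by (apply injective_projections; simpl; ring).
    rewrite Cmod_mult, Cmod_Ci, Cmod_R. ring. }
  assert (Main : forall y, y1 <= y <= y2 -> / Cmod (f' (g (x, y))) <= Kdist ^ n * / Cmod (f' (g (x, y0))) /\
     / Cmod (f' (g (x, y0))) <= Kdist ^ n * / Cmod (f' (g (x, y)))).
  { intros y Hy. destruct (distortion_seg f f' Hf g (fun u => a + Cexp u)%C Cexp (x, y0) (x, y) R) with (n := n) (t := 1) as [D1 D2].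
    - intros t Ht. rewrite Sg. apply U.
    - lra.
    - rewrite Df, Rmult_1_l. apply Rle_trans with (y2 - y1); auto. apply Rabs_le; lra.
    - rewrite Cseg_1 in D1, D2. rewrite !E in D1, D2. assert (h := exp_pos x).
      split; apply Rmult_le_reg_l with (exp x); auto; lra. }
  split; auto. intros s t Hs Ht. rewrite <- Df.
  apply (Cmvt g (fun u => Cexp u / f' (g u))%C).
  - intros r Hr. rewrite Sg. apply (univ_lift_holo f f' Hf _ _ _ _ _ (U (t + r * (s - t)))). rewrite Cmod_minus_diag; lra.
  - intros r Hr. rewrite Sg, E. apply Rmult_le_compat_l. left; apply exp_pos. apply Main.
    assert (0 <= (1 - r) * (t - y1) + r * (s - y1)) by nra. assert (0 <= (1 - r) * (y2 - t) + r * (y2 - s)) by nra. lra.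
Qed.

(** All diameters and distances are squeezed between [c * lam] and [d * lam], and the scale [lam]
    cancels in the quotients. The factor 2 in the neighbourhoods makes their inequality strict. *)
Lemma arcs_comparable (I J : cset) (GI GJ : R -> C) (c d lam : R) : 0 < c <= d -> 0 < lam ->
  (forall z, I z <-> exists t, 0 <= t <= 1 /\ GI t = z) -> (forall z, J z <-> exists t, 0 <= t <= 1 /\ GJ t = z) ->
  (forall t, continuous GI t) -> (forall t, continuous GJ t) ->
  (forall s t, 0 <= s < 1 -> 0 <= t < 1 -> GI s = GI t -> s = t) ->
  (forall s t, 0 <= s < 1 -> 0 <= t < 1 -> GJ s = GJ t -> s = t) ->
  (forall s t, 0 <= s <= 1 -> 0 <= t <= 1 -> Cmod (GI s - GI t) <= d * lam * Rabs (s - t)) ->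
  (forall s t, 0 <= s <= 1 -> 0 <= t <= 1 -> Cmod (GJ s - GJ t) <= d * lam * Rabs (s - t)) ->
  (forall z w, I z -> J w -> c * lam <= Cmod (z - w) <= d * lam) ->
  (exists z w, I z /\ I w /\ c * lam <= Cmod (z - w)) -> (exists z w, J z /\ J w /\ c * lam <= Cmod (z - w)) ->
  subset I (nbhd J (2 * (d / c))) /\ subset J (nbhd I (2 * (d / c))) /\ cbounded I /\ cbounded J /\
  comparable (d / c) (diam I) (diam J) /\ comparable (d / c) (diam J) (setdist I J) /\ comparable (d / c) (diam I) (setdist I J) /\
  length_comparable (d / c) I /\ length_comparable (d / c) J.
Proof.
  intros Hc Hl HI HJ CI' CJ' NI NJ LI LJ HIJ DI DJ.
  assert (Hcl : 0 < c * lam) by nra. assert (Hdl : c * lam <= d * lam) by nra.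
  assert (UI : forall z w, I z -> I w -> Cmod (z - w) <= d * lam).
  { intros z w Hz Hw. apply HI in Hz. apply HI in Hw. destruct Hz as [s [Hs <-]]. destruct Hw as [t [Ht <-]].
    eapply Rle_trans. apply LI; auto. assert (Rabs (s - t) <= 1) by (apply Rabs_le; lra). nra. }
  assert (UJ : forall z w, J z -> J w -> Cmod (z - w) <= d * lam).
  { intros z w Hz Hw. apply HJ in Hz. apply HJ in Hw. destruct Hz as [s [Hs <-]]. destruct Hw as [t [Ht <-]].
    eapply Rle_trans. apply LJ; auto. assert (Rabs (s - t) <= 1) by (apply Rabs_le; lra). nra. }
  destruct (diam_bounds I (c * lam) (d * lam) UI DI) as [I1 [I2 _]].
  destruct (diam_bounds J (c * lam) (d * lam) UJ DJ) as [J1 [J2 _]].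
  assert (Iz : I (GI 0)) by (apply HI; exists 0; split; [lra|auto]).
  assert (Jz : J (GJ 0)) by (apply HJ; exists 0; split; [lra|auto]).
  assert (SD : c * lam <= setdist I J <= d * lam).
  { apply setdist_bounds. intros; apply HIJ; auto. exists (GI 0), (GJ 0). split; auto. split; auto. apply HIJ; auto. }
  assert (EK : d / c = d * lam / (c * lam)) by (field; lra).
  assert (Big : forall x, c * lam <= x -> d * lam < 2 * (d / c) * x).
  { intros x Hx. apply Rlt_le_trans with (2 * (d / c) * (c * lam)).
    replace (2 * (d / c) * (c * lam)) with (2 * (d * lam)) by (field; lra). lra.
    apply Rmult_le_compat_l; auto. assert (0 < d / c) by (apply Rdiv_lt_0_compat; lra). lra. }
  split; [|split; [|split; [|split; [|split; [|split; [|split; [|split]]]]]]].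
  - intros z Hz. apply nbhd_of_close with (GJ 0); auto. eapply Rle_lt_trans. apply HIJ; auto. auto.
  - intros z Hz. apply nbhd_of_close with (GI 0); auto. rewrite Cmod_sym. eapply Rle_lt_trans. apply HIJ; auto. auto.
  - exists (Cmod (GI 0) + d * lam). intros z Hz. assert (T := Cmod_tri_rev z (GI 0)). specialize (UI _ _ Hz Iz). lra.
  - exists (Cmod (GJ 0) + d * lam). intros z Hz. assert (T := Cmod_tri_rev z (GJ 0)). specialize (UJ _ _ Hz Jz). lra.
  - rewrite EK. apply comparable_bounds; auto.
  - rewrite EK. apply comparable_bounds; auto.
  - rewrite EK. apply comparable_bounds; auto.
  - rewrite EK. apply length_comparable_lipschitz with GI; auto. lra.
  - rewrite EK. apply length_comparable_lipschitz with GJ; auto. lra.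
Qed.

Lemma exists_unit_crossing (gam : R -> C) : (forall s t, 0 <= s <= 1 -> 0 <= t <= 1 -> Cmod (gam s - gam t) <= 4 * Rabs (s - t)) ->
  Cmod (gam 0) <= 1 <= Cmod (gam 1) -> exists t, 0 <= t <= 1 /\ Cmod (gam t) = 1.
Proof.
  intros HL H. apply ivt01; auto. intros t Ht e He. exists (e / 4). split. lra.
  intros s Hs Hst. eapply Rle_lt_trans. 2: apply (Rle_lt_trans _ _ e (HL s t Hs Ht)); lra.
  assert (T1 := Cmod_tri_rev (gam s) (gam t)). assert (T2 := Cmod_tri_rev (gam t) (gam s)).
  rewrite (Cmod_sym (gam t) (gam s)) in T2. apply Rabs_le; lra.
Qed.

Lemma Cexp_ver_eq (x s t : R) : Rabs (s - t) < 2 * PI -> Cexp (x, s) = Cexp (x, t) -> s = t.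
Proof.
  intros H E. apply Cexp_inj_near in E. injection E; auto.
  replace ((x, s) - (x, t))%C with (Ci * RtoC (s - t))%C by (apply injective_projections; simpl; ring).
  rewrite Cmod_mult, Cmod_Ci, Cmod_R. lra.
Qed.

Section Main.
Variables (f f' : C -> C) (eps : R).
Hypothesis Heps : 0 < eps.
Hypothesis Hf : forall z, Cder f z (f' z).
Hypothesis Hnp : ~ is_polynomial f.
Hypothesis Hfin : finite_set (sing f).
Hypothesis Hcirc : forall a z, sing f a -> Cmod z = 1 -> 4 * eps < Cmod (a - z).
Hypothesis Hin : forall a, sing f a -> Cmod a < 1.
Hypothesis Hsep : forall a b, sing f a -> sing f b -> a <> b -> 4 * eps < Cmod (a - b).

(** The distance to the circle is tested at the radial projection of [a], or at 1 if [a] is 0. *)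
Lemma sing_Cmod (a : C) : sing f a -> Cmod a < 1 - 4 * eps.
Proof.
  intros Ha. assert (h := Hin a Ha). destruct (Ceq_dec a 0) as [->|Hn].
  - assert (H := Hcirc _ (RtoC 1) Ha Cmod_1). replace (0 - 1)%C with (- (1))%C in H by ring. rewrite Cmod_opp, Cmod_1 in H.
    rewrite Cmod_0. lra.
  - assert (Hm := proj1 (Cmod_gt_0 _) Hn). set (m := Cmod a) in *.
    assert (E : Cmod (RtoC (/ m) * a) = 1).
    { rewrite Cmod_mult, Cmod_R, Rabs_pos_eq. fold m. field. lra. left. apply Rinv_0_lt_compat; auto. }
    assert (H := Hcirc a _ Ha E). replace (a - RtoC (/ m) * a)%C with (RtoC (1 - / m) * a)%C in H by (rewrite RtoC_minus; ring).
    rewrite Cmod_mult, Cmod_R in H. fold m in H.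
    rewrite Rabs_left1 in H. replace (- (1 - / m) * m) with (1 - m) in H by (field; lra). lra.
    assert (1 < / m). { rewrite <- Rinv_1. apply Rinv_lt_contravar; lra. } lra.
Qed.

Lemma regular_left (a : C) (u : C) : sing f a -> left_half (ln (4 * eps)) u -> regular_value f f' (a + Cexp u)%C.
Proof.
  intros Ha Hu. apply not_sing_regular; auto. intros Hs.
  assert (E : Cmod (a - (a + Cexp u)) = exp (fst u)).
  { replace (a - (a + Cexp u))%C with (- Cexp u)%C by ring. rewrite Cmod_opp. apply Cmod_Cexp. }
  assert (h := exp_pos (fst u)).
  assert (N : a <> (a + Cexp u)%C) by (intros e; rewrite <- e, Cmod_minus_diag in E; lra).
  specialize (Hsep _ _ Ha Hs N). rewrite E in Hsep. unfold left_half in Hu. apply exp_increasing in Hu.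
  rewrite exp_ln in Hu; lra.
Qed.

Lemma regular_right (u : C) : 4 * eps < 1 -> right_half (ln (1 - 4 * eps)) u -> regular_value f f' (0 + Cexp u)%C.
Proof.
  intros H4 Hu. apply not_sing_regular; auto. intros Hs. apply sing_Cmod in Hs. rewrite Cplus_0_l, Cmod_Cexp in Hs.
  unfold right_half in Hu. apply exp_increasing in Hu. rewrite exp_ln in Hu; lra.
Qed.

Lemma regular_near_circle (w v : C) : Cmod w = 1 -> Cmod (v - w) < 4 * eps -> regular_value f f' v.
Proof.
  intros Hw Hv. apply not_sing_regular; auto. intros Hs. specialize (Hcirc _ _ Hs Hw). lra.
Qed.

(** The tent path is followed to its crossing with the unit circle. Its parametrization by the unit
    interval is Lipschitz with constant 4, a slope factor 2 times a width of at most 2, and the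
    steps may have length [eps / 16]; this gives [64 / eps] links. The first conclusion is kept to
    bound the diameter of the arc from below. *)
Lemma chain_to_circle (a z0 : C) (N : nat) : sing f a -> f z0 = (a + Ci * RtoC eps)%C -> 64 / eps <= INR N ->
  (forall w, Cmod (w - f z0) < eps / 4 -> regular_value f f' w) /\
  exists z, Cmod (f z) = 1 /\ / Cmod (f' z) <= Kdist ^ N * / Cmod (f' z0) /\ / Cmod (f' z0) <= Kdist ^ N * / Cmod (f' z) /\
    Cmod (z - z0) <= INR N * (eps / 4) * Kdist ^ N * / Cmod (f' z0).
Proof.
  intros Ha Ez HN. destruct Hfin as [l Hl]. assert (Hm := sing_Cmod a Ha). assert (Hm0 := Cmod_ge_0 a).
  assert (HNp : 0 < INR N). { assert (0 < 64 / eps) by (apply Rdiv_lt_0_compat; lra). lra. }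
  assert (Fa : Rabs (fst a) <= Cmod a) by apply re_le_Cmod. apply Rabs_le_between in Fa.
  (* The separation [4 * eps] of singular values is then the [8 * h] that [tent_path_avoids] needs,
     and its clearance [h / 2] is [eps / 4]. *)
  set (h := eps / 2). assert (Hh : 0 < h) by (unfold h; lra).
  set (tp := tent_path a h l).
  assert (Reg : forall x v, Cmod (v - tp x) < eps / 4 -> regular_value f f' v).
  { intros x v Hv. apply not_sing_regular; auto. intros Hs. apply Hl in Hs.
    assert (K := tent_path_avoids a h Hh l x). fold tp in K.
    assert (K' : h / 2 <= Cmod (tp x - v)).
    { apply K; auto. intros b b' Hb Hb' Hn. unfold h. replace (8 * (eps / 2)) with (4 * eps) by field. apply Hsep; auto; apply Hl; auto. }
    rewrite Cmod_sym in K'. unfold h in K'. lra. }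
  assert (E0 : tp (fst a) = f z0).
  { rewrite Ez. unfold tp. rewrite tent_path_start; auto. unfold h. replace (2 * (eps / 2)) with eps by field. auto. apply Hl; auto. }
  assert (LG : forall k s t, 0 <= k <= 1 -> 0 <= s <= 1 -> 0 <= t <= 1 ->
     Cmod (tp (fst a + s * k * (1 - fst a)) - tp (fst a + t * k * (1 - fst a))) <= 4 * Rabs (s - t)).
  { intros k s t Hk Hs Ht. eapply Rle_trans. apply tent_path_lipschitz.
    replace (fst a + s * k * (1 - fst a) - (fst a + t * k * (1 - fst a))) with ((s - t) * (k * (1 - fst a))) by ring.
    rewrite Rabs_mult, (Rabs_pos_eq (k * (1 - fst a))) by nra. assert (P := Rabs_pos (s - t)). assert (k * (1 - fst a) <= 2) by nra. nra. }
  (* The path starts inside the unit disc because [Cmod a + eps] is below 1, and at real part 1 it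
     is no longer inside. *)
  destruct (exists_unit_crossing (fun t => tp (fst a + t * 1 * (1 - fst a)))) as [k [Hk Ek]].
  { intros s t Hs Ht. apply LG; auto. lra. }
  { split. replace (fst a + 0 * 1 * (1 - fst a)) with (fst a) by ring. rewrite E0, Ez. eapply Rle_trans. apply Cmod_triangle.
    rewrite Cmod_mult, Cmod_Ci, Cmod_R, Rabs_pos_eq; lra.
    replace (fst a + 1 * 1 * (1 - fst a)) with 1 by ring. eapply Rle_trans. 2: apply re_le_Cmod. unfold tp, tent_path; simpl. rewrite Rabs_R1. lra. }
  split. intros w Hw. apply (Reg (fst a)). rewrite E0. auto.
  destruct (chain_distortion f f' (fun t => tp (fst a + t * k * (1 - fst a))) z0 4 (eps / 4) N) as [z [Z1 Z2]]; auto.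
  - lra.
  - intros t Ht w Hw. apply (Reg _ w Hw).
  - apply INR_lt. simpl. auto.
  - apply Rmult_le_reg_r with (INR N); auto. unfold Rdiv at 1. rewrite Rmult_assoc, Rinv_l by lra.
    apply Rmult_le_compat_r with (r := eps) in HN; [|lra]. replace (64 / eps * eps) with 64 in HN by (field; lra). lra.
  - rewrite <- E0. f_equal. ring.
  - exists z. split; auto. rewrite Z1. replace (fst a + 1 * k * (1 - fst a)) with (fst a + k * 1 * (1 - fst a)) by ring. exact Ek.
Qed.

(** [Q] collects the distortion along the chain, the edge and the arc. In [d] the sum [12 + INR N]
    is 8 for the arc, 4 for the edge and [INR N] for the chain. In [c] the number 256 is 4 times 64:
    the separation bound [R / (64 * Kdist)] at the smallest radius used, [R = eps / 4], divided by
    [Q]. *)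
Lemma main_fixed (a : C) (I : cset) (N : nat) : sing f a -> partition_arc f a eps I -> 64 / eps <= INR N ->
  let Q := Kdist ^ N * Kdist ^ N * Kdist ^ 32 in
  let d := 2 * (12 + INR N) * Q in let c := eps / (256 * Kdist * Q) in
  exists J, edge f J /\
  subset I (nbhd J (2 * (d / c))) /\ subset J (nbhd I (2 * (d / c))) /\ cbounded I /\ cbounded J /\
  comparable (d / c) (diam I) (diam J) /\ comparable (d / c) (diam J) (setdist I J) /\ comparable (d / c) (diam I) (setdist I J) /\
  length_comparable (d / c) I /\ length_comparable (d / c) J.
Proof.
  intros Ha HI HN Q d c. assert (HK := Kdist_ge1).
  assert (Hm := sing_Cmod a Ha). assert (Hm0 := Cmod_ge_0 a). assert (H4 : 4 * eps < 1) by lra.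
  assert (Hpi := PI_RGT_0). assert (Hpi4 := PI_4).
  assert (HNp : 64 <= INR N * eps).
  { apply Rmult_le_compat_r with (r := eps) in HN; [|lra]. replace (64 / eps * eps) with 64 in HN by (field; lra). lra. }
  assert (hN := pos_INR N).
  assert (KN : 1 <= Kdist ^ N) by (apply pow_R1_Rle; auto). assert (K32 : 1 <= Kdist ^ 32) by (apply pow_R1_Rle; auto).
  assert (KNN : Kdist ^ N <= Kdist ^ N * Kdist ^ N) by (rewrite <- (Rmult_1_r (Kdist ^ N)) at 1; apply Rmult_le_compat_l; lra).
  assert (Q1 : Kdist ^ N * Kdist ^ N <= Q) by (unfold Q; rewrite <- (Rmult_1_r (Kdist ^ N * Kdist ^ N)) at 1; apply Rmult_le_compat_l; lra).
  assert (Q2 : Kdist ^ 32 <= Q) by (unfold Q; rewrite <- (Rmult_1_l (Kdist ^ 32)) at 1; apply Rmult_le_compat_r; lra).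
  clearbody Q.
  destruct (partition_arc_param f f' Hf a eps Heps (fun u => regular_left a u Ha) I HI) as [g [Hg PI1]].
  set (VI := left_half (ln (4 * eps))) in *.
  assert (L4 : forall y v, Cmod (v - (ln eps, y)) < 1 -> VI v).
  { intros y v Hv. apply fst_close in Hv. simpl in Hv. apply Rabs_def2 in Hv. unfold VI, left_half.
    (* Since [ln 4] exceeds 1, unit discs about the line of real part [ln eps] stay in the left
       half-plane. *)
    rewrite ln_mult by lra. assert (1 < ln 4). { rewrite <- (ln_exp 1). apply ln_increasing. apply exp_pos. assert (h := exp_le_3). lra. } lra. }
  assert (VIy : forall y, VI (ln eps, y)) by (intros y; apply (L4 y); rewrite Cmod_minus_diag; lra).
  (* The point of the arc above [a + i eps], where the tent path starts; [lam] is the common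
     scale. *)
  set (z0 := g (ln eps, PI / 2)). set (lam := / Cmod (f' z0)).
  assert (Fy : forall y, f (g (ln eps, y)) = (a + Cexp (ln eps, y))%C) by (intros y; apply (Hg _ (VIy y))).
  assert (Ez0 : f z0 = (a + Ci * RtoC eps)%C).
  { unfold z0. rewrite Fy. f_equal. unfold Cexp; simpl. rewrite exp_ln, cos_PI2, sin_PI2 by auto. apply injective_projections; simpl; ring. }
  assert (Hlam : 0 < lam).
  { apply Rinv_0_lt_compat, Cmod_gt_0. apply (regular_left a (ln eps, PI / 2) Ha (VIy _)). apply Fy. }
  destruct (vertical_distortion f f' VI a g (ln eps) 0 (2 * PI) (PI / 2) 1 32 Hf (fun u => regular_left a u Ha) Hg ltac:(lra) L4 ltac:(lra)) as [_ DI].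
  { rewrite INR_IZR_INZ. change (Z.of_nat 32) with 32%Z. lra. } fold z0 lam in DI. rewrite exp_ln in DI by auto.
  destruct (chain_to_circle a z0 N Ha Ez0 HN) as [Reg0 [z1 [C1 [C2 [C3 C4]]]]]. fold lam in C2, C3, C4.
  set (lam1 := / Cmod (f' z1)) in *.
  destruct (Cexp_surj_angle (f z1)) as [th [Hth Eth]]. apply Cmod_gt_0; lra. rewrite C1, ln_1 in Eth.
  destruct (edge_param f f' Hf (ln (1 - 4 * eps))) with (z0 := z1) (th := th) as [G [HG [EG HJ]]]; auto.
  { rewrite <- ln_1. apply ln_increasing; lra. } { intros u Hu. apply regular_right; auto. }
  set (VJ := right_half (ln (1 - 4 * eps))) in *.
  (* Hence discs of radius [4 * eps] about the imaginary axis stay in the right half-plane. *)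
  assert (LJ : ln (1 - 4 * eps) <= - (4 * eps)).
  { rewrite <- (ln_exp (- (4 * eps))). destruct (exp_ineq1_le (- (4 * eps))) as [h|h].
    left. apply ln_increasing; lra. rewrite <- h. right. reflexivity. }
  assert (LVJ : forall y v, Cmod (v - (0, y)) < 4 * eps -> VJ v).
  { intros y v Hv. apply fst_close in Hv. simpl in Hv. apply Rabs_def2 in Hv. unfold VJ, right_half. lra. }
  assert (VJy : forall y, VJ (0, y)) by (intros y; apply (LVJ y); rewrite Cmod_minus_diag; lra).
  assert (FG : forall y, f (G (0, y)) = Cexp (0, y)) by (intros y; rewrite (proj1 (HG _ (VJy y))); ring).
  assert (MG : forall y, Cmod (Cexp (0, y)) = 1) by (intros y; rewrite Cmod_Cexp; apply exp_0).
  (* The edge is the one through the end [z1] of the chain; as [th] lies in [[0, 2 * PI)], it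
     belongs to [k = 0] or [k = 1]. *)
  assert (Ek : exists k : Z, PI * IZR k <= th <= PI * (IZR k + 1)).
  { destruct (Rle_lt_dec th PI). exists 0%Z. simpl. lra. exists 1%Z. simpl. lra. }
  destruct Ek as [k Hk]. destruct (HJ k) as [J [EJ PJ]]. clear HJ.
  set (y0 := PI * IZR k) in *. replace (PI * (IZR k + 1)) with (y0 + PI) in * by (unfold y0; ring).
  destruct (vertical_distortion f f' VJ 0 G 0 y0 (y0 + PI) th (4 * eps) N Hf) as [DJ1 DJ2]; auto.
  { intros u Hu. apply regular_right; auto. } { lra. } { replace (4 * eps / 4) with eps by field. lra. }
  rewrite EG in DJ1, DJ2. fold lam1 in DJ1, DJ2. rewrite exp_0, Rmult_1_l in DJ2.
  assert (Hlam1 : Kdist ^ N * lam1 <= Q * lam).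
  { apply Rle_trans with (Kdist ^ N * (Kdist ^ N * lam)). apply Rmult_le_compat_l; lra. rewrite <- Rmult_assoc. apply Rmult_le_compat_r; lra. }
  assert (LamJ : forall y, y0 <= y <= y0 + PI -> lam <= Q * / Cmod (f' (G (0, y)))).
  { intros y Hy. destruct (DJ1 y Hy) as [_ D].
    assert (P : 0 < / Cmod (f' (G (0, y)))).
    { apply Rinv_0_lt_compat, Cmod_gt_0. apply (regular_right (0, y) H4 (VJy y)). rewrite FG. ring. }
    apply Rle_trans with (Kdist ^ N * (Kdist ^ N * / Cmod (f' (G (0, y))))).
    eapply Rle_trans. apply C3. apply Rmult_le_compat_l; lra. rewrite <- Rmult_assoc. apply Rmult_le_compat_r; lra. }
  assert (HQ : 1 <= Q) by lra.
  assert (QL : 0 < Q * lam) by nra.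
  assert (Hc0 : 0 < c) by (unfold c; apply Rdiv_lt_0_compat; nra).
  assert (Hcd : c <= d).
  { apply Rle_trans with 1.
    - unfold c. apply Rmult_le_reg_r with (256 * Kdist * Q). nra. unfold Rdiv. rewrite Rmult_assoc, Rinv_l by nra. nra.
    - unfold d. nra. }
  assert (Sep : forall y, y0 <= y <= y0 + PI -> forall z R, 0 < R -> R <= 4 * eps -> eps <= R -> R <= Cmod (f z - f (G (0, y))) -> c * lam <= Cmod (z - G (0, y))).
  { intros y Hy z R HR HR4 HRe Hz.
    eapply Rle_trans. 2: apply (regular_separation f f' Hf (G (0, y)) z R); auto.
    - specialize (LamJ y Hy). set (m := / Cmod (f' (G (0, y)))) in *.
      apply Rle_trans with (c * (Q * m)). apply Rmult_le_compat_l; lra.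
      unfold c. replace (eps / (256 * Kdist * Q) * (Q * m)) with (eps / 4 / (64 * Kdist) * m) by (field; lra).
      apply Rmult_le_compat_r. assert (0 < Q * m) by lra. nra. apply Rmult_le_compat_r. left; apply Rinv_0_lt_compat; lra. lra.
    - intros w Hw. apply (regular_near_circle (f (G (0, y)))). rewrite FG; auto. lra. }
  assert (NI : forall y, 0 <= y <= 2 * PI -> Cmod (g (ln eps, y) - z0) <= 8 * (Q * lam)).
  { intros y Hy. eapply Rle_trans. apply (DI y (PI / 2)); lra.
    assert (Rabs (y - PI / 2) <= 8) by (apply Rabs_le; lra). assert (P := Rabs_pos (y - PI / 2)).
    assert (Kdist ^ 32 * lam <= Q * lam) by (apply Rmult_le_compat_r; lra).
    assert (0 < Kdist ^ 32 * lam) by nra.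
    assert (eps * (Kdist ^ 32 * lam) <= Q * lam) by nra. assert (0 < eps * (Kdist ^ 32 * lam)) by nra. nra. }
  assert (NJ : forall y, y0 <= y <= y0 + PI -> Cmod (G (0, y) - z0) <= (4 + INR N) * (Q * lam)).
  { intros y Hy. eapply Rle_trans. apply (Cmod_tri3 _ z1). rewrite Rmult_plus_distr_r. apply Rplus_le_compat.
    - rewrite <- EG. eapply Rle_trans. apply DJ2; lra.
      assert (Rabs (y - th) <= 4) by (apply Rabs_le; lra). assert (P := Rabs_pos (y - th)).
      assert (0 <= Kdist ^ N * lam1). { apply Rmult_le_pos; [lra|]. left. apply Rmult_lt_reg_l with (Kdist ^ N); lra. } nra.
    - eapply Rle_trans. apply C4. replace (INR N * (eps / 4) * Kdist ^ N * lam) with (INR N * (eps / 4 * Kdist ^ N * lam)) by ring.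
      apply Rmult_le_compat_l; auto. apply Rmult_le_compat_r; [lra|]. nra. }
  exists J. split; auto.
  apply (arcs_comparable I J (fun t => g (ln eps, 2 * PI * t)) (fun t => G (0, y0 + PI * t)) c d lam); auto.
  - intros z. rewrite PI1. split.
    + intros [y [Hy ->]]. exists (y / (2 * PI)). split. split. apply Rdiv_le_0_compat; lra.
      apply Rmult_le_reg_r with (2 * PI). lra. unfold Rdiv. rewrite Rmult_assoc, Rinv_l; lra.
      f_equal. f_equal. field. lra.
    + intros [t [Ht <-]]. exists (2 * PI * t). split; auto. nra.
  - intros z. rewrite PJ. split.
    + intros [y [Hy ->]]. exists ((y - y0) / PI). split. split. apply Rdiv_le_0_compat; lra.
      apply Rmult_le_reg_r with PI. lra. unfold Rdiv. rewrite Rmult_assoc, Rinv_l; lra.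
      f_equal. f_equal. field. lra.
    + intros [t [Ht <-]]. exists (y0 + PI * t). split; auto. nra.
  - intros t. apply Pcont_continuous. apply (Pcont_comp g (fun t => (ln eps, 2 * PI * t))). apply (Hg _ (VIy _)).
    intros e He. destruct (Pcont_seg (ln eps, 0) (ln eps, 2 * PI) t e He) as [b [Hb HB]]. exists b. split; auto.
    intros s Hs. specialize (HB s Hs). replace (Cseg (ln eps, 0) (ln eps, 2 * PI) s) with ((ln eps, 2 * PI * s) : C) in HB.
    replace (Cseg (ln eps, 0) (ln eps, 2 * PI) t) with ((ln eps, 2 * PI * t) : C) in HB. auto.
    apply injective_projections; [rewrite fst_Cseg|rewrite snd_Cseg]; simpl; ring.
    apply injective_projections; [rewrite fst_Cseg|rewrite snd_Cseg]; simpl; ring.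
  - intros t. apply Pcont_continuous. apply (Pcont_comp G (fun t => (0, y0 + PI * t))). apply (HG _ (VJy _)).
    intros e He. destruct (Pcont_seg (0, y0) (0, y0 + PI) t e He) as [b [Hb HB]]. exists b. split; auto.
    intros s Hs. specialize (HB s Hs). replace (Cseg (0, y0) (0, y0 + PI) s) with ((0, y0 + PI * s) : C) in HB.
    replace (Cseg (0, y0) (0, y0 + PI) t) with ((0, y0 + PI * t) : C) in HB. auto.
    apply injective_projections; [rewrite fst_Cseg|rewrite snd_Cseg]; simpl; ring.
    apply injective_projections; [rewrite fst_Cseg|rewrite snd_Cseg]; simpl; ring.
  - intros s t Hs Ht E. apply (f_equal f) in E. rewrite !Fy in E.
    assert (E' : 2 * PI * s = 2 * PI * t).
    { apply (Cexp_ver_eq (ln eps)). replace (2 * PI * s - 2 * PI * t) with (2 * PI * (s - t)) by ring.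
      rewrite Rabs_mult, (Rabs_pos_eq (2 * PI)) by lra. assert (Rabs (s - t) < 1) by (apply Rabs_def1; lra). nra.
      replace (Cexp (ln eps, (2 * PI * s)%R)) with (a + Cexp (ln eps, (2 * PI * s)%R) - a)%C by ring. rewrite E. ring. }
    apply Rmult_eq_reg_l in E'; lra.
  - intros s t Hs Ht E. apply (f_equal f) in E. rewrite !FG in E.
    assert (E' : y0 + PI * s = y0 + PI * t).
    { apply (Cexp_ver_eq 0); auto. replace (y0 + PI * s - (y0 + PI * t)) with (PI * (s - t)) by ring.
      rewrite Rabs_mult, (Rabs_pos_eq PI) by lra. assert (Rabs (s - t) < 1) by (apply Rabs_def1; lra). nra. }
    apply Rplus_eq_reg_l in E'. apply Rmult_eq_reg_l in E'; lra.
  - intros s t Hs Ht. eapply Rle_trans. apply DI; nra.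
    replace (2 * PI * s - 2 * PI * t) with (2 * PI * (s - t)) by ring. rewrite Rabs_mult, (Rabs_pos_eq (2 * PI)) by lra.
    rewrite <- Rmult_assoc. apply Rmult_le_compat_r. apply Rabs_pos.
    assert (Kdist ^ 32 * lam <= Q * lam) by (apply Rmult_le_compat_r; lra). assert (0 < Kdist ^ 32 * lam) by nra.
    assert (eps * (Kdist ^ 32 * lam) <= Q * lam) by nra. unfold d. assert (0 < eps * (Kdist ^ 32 * lam)) by nra. nra.
  - intros s t Hs Ht. eapply Rle_trans. apply DJ2; nra.
    replace (y0 + PI * s - (y0 + PI * t)) with (PI * (s - t)) by ring. rewrite Rabs_mult, (Rabs_pos_eq PI) by lra.
    rewrite <- Rmult_assoc. apply Rmult_le_compat_r. apply Rabs_pos.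
    assert (0 <= Kdist ^ N * lam1). { apply Rmult_le_pos; [lra|]. left. apply Rmult_lt_reg_l with (Kdist ^ N); lra. }
    unfold d. nra.
  - intros z w Hz Hw. apply PI1 in Hz. apply PJ in Hw. destruct Hz as [y [Hy ->]]. destruct Hw as [y' [Hy' ->]]. split.
    (* On the arc [f] has modulus at most [Cmod a + eps], less than [1 - 3 * eps], and on the edge
       it has modulus 1. *)
    + apply (Sep y' Hy' _ (3 * eps)); try lra. rewrite Fy, FG.
      assert (T := Cmod_tri_rev (Cexp (0, y')) (a + Cexp (ln eps, y))). rewrite MG in T.
      rewrite (Cmod_sym (Cexp (0, y')) (a + Cexp (ln eps, y))) in T. assert (T' := Cmod_triangle a (Cexp (ln eps, y))).
      rewrite (Cmod_Cexp (ln eps, y)) in T'. simpl fst in T'. rewrite exp_ln in T' by auto. lra.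
    + assert (T := Cmod_tri3 (g (ln eps, y)) z0 (G (0, y'))). rewrite (Cmod_sym z0) in T.
      specialize (NI y Hy). specialize (NJ y' Hy'). unfold d. nra.
  (* The values at [z2] and [z0] are antipodal on the circle of radius [eps], hence [2 * eps]
     apart. *)
  - set (z2 := g (ln eps, 3 * (PI / 2))). exists z2, z0. split; [|split].
    + apply PI1. exists (3 * (PI / 2)). split; auto. lra.
    + apply PI1. exists (PI / 2). split; auto. lra.
    + eapply Rle_trans. 2: apply (regular_separation f f' Hf z0 z2 (eps / 4) ltac:(lra) Reg0).
      * fold lam. apply Rmult_le_compat_r; [lra|]. unfold c.
        replace (eps / (256 * Kdist * Q)) with (eps / 4 / (64 * Kdist) * / Q) by (field; lra).
        assert (0 < eps / 4 / (64 * Kdist)) by (apply Rdiv_lt_0_compat; lra).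
        assert (/ Q <= 1). { rewrite <- Rinv_1. apply Rinv_le_contravar; lra. } nra.
      * rewrite Ez0. unfold z2. rewrite Fy.
        replace (a + Cexp (ln eps, (3 * (PI / 2))%R) - (a + Ci * RtoC eps))%C with (- (RtoC (2 * eps) * Ci))%C.
        rewrite Cmod_opp, Cmod_mult, Cmod_R, Cmod_Ci, Rabs_pos_eq; lra.
        unfold Cexp; simpl. rewrite exp_ln, cos_3PI2, sin_3PI2 by auto. apply injective_projections; simpl; ring.
  (* The ends of an edge have antipodal values on the unit circle, and their distance 2 exceeds
     [4 * eps]. *)
  - exists (G (0, y0 + PI)), (G (0, y0)). split; [|split].
    + apply PJ. exists (y0 + PI). split; auto. lra.
    + apply PJ. exists y0. split; auto. lra.
    + apply (Sep y0 ltac:(lra) _ (4 * eps)); try lra. rewrite !FG.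
      assert (O := Cexp_opposite 0 0 y0 (y0 + PI)). rewrite O, exp_0. lra.
      replace (y0 + PI - y0) with PI by ring. apply Rabs_pos_eq; lra.
Qed.
End Main.

Theorem mainTheorem4 :
  forall eps : R, 0 < eps ->
  exists r K : R, 0 < r /\ 1 <= K /\
  forall f : C -> C,
    classS f ->
    (forall a, sing f a -> Cmod a < 1) ->
    (forall a z, sing f a -> Cmod z = 1 -> 4 * eps < Cmod (Cminus a z)) ->
    (forall a b, sing f a -> sing f b -> a <> b -> 4 * eps < Cmod (Cminus a b)) ->
    forall a, sing f a ->
    forall I, partition_arc f a eps I ->
    exists J, edge f J /\
      subset I (nbhd J r) /\ subset J (nbhd I r) /\
      cbounded I /\ cbounded J /\
      comparable K (diam I) (diam J) /\
      comparable K (diam J) (setdist I J) /\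
      comparable K (diam I) (setdist I J) /\
      length_comparable K I /\ length_comparable K J.
Proof.
  intros eps Heps. destruct (INR_unbounded (64 / eps)) as [N HN].
  assert (HK := Kdist_ge1). assert (hN := pos_INR N).
  set (Q := Kdist ^ N * Kdist ^ N * Kdist ^ 32). 
  assert (HQ : 1 <= Q).
  { assert (K1 : 1 <= Kdist ^ N) by (apply pow_R1_Rle; auto). assert (K2 : 1 <= Kdist ^ 32) by (apply pow_R1_Rle; auto).
    assert (1 <= Kdist ^ N * Kdist ^ N) by nra. unfold Q. nra. }
  set (d := 2 * (12 + INR N) * Q). set (c := eps / (256 * Kdist * Q)).
  assert (Hc : 0 < c) by (unfold c; apply Rdiv_lt_0_compat; nra).
  assert (Hd : 1 <= d) by (unfold d; nra).
  destruct (classic (c <= d)) as [Hcd|Hcd].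
  - exists (2 * (d / c)), (d / c).
    assert (1 <= d / c). { apply Rmult_le_reg_r with c; auto. unfold Rdiv. rewrite Rmult_assoc, Rinv_l; lra. }
    split; [lra|]. split; auto.
    intros f [[Hent Hnp] Hfin] H1 H2 H3 a Ha I HI.
    destruct (entire_deriv f Hent) as [f' Hf].
    apply (main_fixed f f' eps Heps Hf Hnp Hfin H2 H1 H3 a I N Ha HI). lra.
  (* Here [eps] is so large that no singular value can satisfy the hypotheses: one would give
     [4 * eps < 1] and with it [c <= 1 <= d]. Any constants will do. *)
  - exists 1, 1. split; [lra|]. split; [lra|].
    intros f [[Hent Hnp] Hfin] H1 H2 H3 a Ha I HI. exfalso. apply Hcd.
    assert (h := sing_Cmod f eps H2 H1 a Ha). assert (h' := Cmod_ge_0 a).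
    apply Rle_trans with 1; auto. unfold c. apply Rmult_le_reg_r with (256 * Kdist * Q). nra.
    unfold Rdiv. rewrite Rmult_assoc, Rinv_l by nra. nra.
Qed.
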